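(* Let $q_E\colon E\to M$ be a smooth vector bundle, let $\Delta\colon \Gamma(TM\oplus E^* )\times\Gamma(E\oplus T^*M)\to\Gamma(E\oplus T^*M)$ be a Dorfman connection, and let $\nu,\nu_1,\nu_2\in\Gamma(TM\oplus E^* )$ and $\tau,\tau_1,\tau_2\in\Gamma(E\oplus T^*M)$. Then, for the Courant–Dorfman bracket $[\![\cdot,\cdot]\!]$ on $\Gamma_E(TE\oplus T^*E)$: 1. $[\![\tau_1^\uparrow, \tau_2^\uparrow]\!]=0$; 2. $[\![\sigma^\Delta(\nu), \tau^\uparrow]\!]=(\Delta_{\nu}\tau)^\uparrow$; 3. $[\![\sigma^\Delta(\nu_1),\sigma^\Delta(\nu_2)]\!]=\sigma^\Delta([\![\nu_1, \nu_2]\!]_\Delta)-\widetilde{R_\Delta(\nu_1, \nu_2)(\cdot,0)}$.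
   Context: Everything is smooth. $TM\oplus E^*$ is anchored by $\mathrm{pr}_{TM}$ and paired with $E\oplus T^*M$ by $\langle (X,\varepsilon),(e,\theta)\rangle=\langle\varepsilon,e\rangle+\langle\theta,X\rangle$. A Dorfman connection here is an $\mathbb R$-bilinear map $\Delta\colon \Gamma(TM\oplus E^* )\times\Gamma(E\oplus T^*M)\to\Gamma(E\oplus T^*M)$ such that for all $f\in C^\infty(M)$, $\nu=(X,\varepsilon)$, $\tau$: (a) $\Delta_{f\nu}\tau=f\Delta_\nu\tau+\langle\nu,\tau\rangle(0,\mathbf df)$; (b) $\Delta_\nu(f\tau)=f\Delta_\nu\tau+X(f)\tau$; (c) $\Delta_\nu(0,\mathbf df)=(0,\mathbf d(X(f)))$. Its dual bracket on $\Gamma(TM\oplus E^* )$ is defined by $\langle[\![\nu_1,\nu_2]\!]_\Delta,\tau\rangle=\mathrm{pr}_{TM}(\nu_1)\langle\nu_2,\tau\rangle-\langle\nu_2,\Delta_{\nu_1}\tau\rangle$, and its curvature is $R_\Delta(\nu_1,\nu_2)=\Delta_{\nu_1}\Delta_{\nu_2}-\Delta_{\nu_2}\Delta_{\nu_1}-\Delta_{[\![\nu_1,\nu_2]\!]_\Delta}$, which is $C^\infty(M)$-linear in its argument in $\Gamma(E\oplus T^*M)$; thus $R_\Delta(\nu_1,\nu_2)(\cdot,0)\in\Gamma(\mathrm{Hom}(E,E\oplus T^*M))$. For $\varepsilon\in\Gamma(E^* )$, $\ell_\varepsilon(e_m)=\langle\varepsilon(m),e_m\rangle$. For $(e,\theta)\in\Gamma(E\oplus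 T^*M)$, the section $(e,\theta)^\uparrow$ of $TE\oplus T^*E\to E$ is $(e,\theta)^\uparrow(e'_m)=\big(\tfrac{d}{dt}|_{t=0}(e'_m+te(m)),\ (T_{e'_m}q_E)^t\theta(m)\big)$. For $\phi\in\Gamma(\mathrm{Hom}(E,E\oplus T^*M))$, the section $\widetilde\phi$ of $TE\oplus T^*E\to E$ is $\widetilde\phi(e_m)=\tau^\uparrow(e_m)$ for any $\tau\in\Gamma(E\oplus T^*M)$ with $\tau(m)=\phi(e_m)$. The horizontal lift is $\sigma^\Delta(X,\varepsilon)(e_m)=(T_me\,X(m),\mathbf d_{e_m}\ell_\varepsilon)-(\Delta_{(X,\varepsilon)}(e,0))^\uparrow(e_m)$ for any $e\in\Gamma(E)$ with $e(m)=e_m$ (independent of the choice of $e$). The Courant–Dorfman bracket on the manifold $E$ is $[\![(X,\theta),(Y,\eta)]\!]=([X,Y],\pounds_X\eta-\mathbf i_Y\mathbf d\theta)$ for $X,Y\in\mathfrak X(E)$, $\theta,\eta\in\Omega^1(E)$. *)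

(* Defs.v *)
From HB Require Import structures.
From mathcomp Require Import all_boot all_order all_algebra.
From mathcomp Require Import all_classical all_reals all_analysis.

Set Implicit Arguments.
Unset Strict Implicit.
Unset Printing Implicit Defensive.

Import Order.TTheory GRing.Theory Num.Theory.
Import numFieldNormedType.Exports.

Local Open Scope classical_set_scope.
Local Open Scope ring_scope.

(* On a finite-dimensional space, requiring every directional derivative
   ['D_v f] to be of class C^j is the same as requiring this of the Fréchet
   differential. *)
Fixpoint Ck (R : realType) (V W : normedModType R) (j : nat)
    (U : set V) (f : V -> W) {struct j} : Prop :=
  match j with
  | 0%N => forall x, U x -> {for x, continuous f}
  | j'.+1 => (forall x, U x -> differentiable f x) /\
             (forall v, Ck j' U ('D_v f))
  end.

Definition smooth_on (R : realType) (V W : normedModType R)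
    (U : set V) (f : V -> W) : Prop := forall j, Ck j U f.

(* [cinv] is total, but only its values on [cimg] are meaningful. *)
Record chart (R : realType) (T : topologicalType) (n : nat) := Chart {
  cfun :> T -> 'rV[R]_n;
  cinv : 'rV[R]_n -> T;
  cdom : set T;
  cimg : set 'rV[R]_n;
  open_cdom : open cdom;
  open_cimg : open cimg;
  cfun_img : forall p, cdom p -> cimg (cfun p);
  cinv_dom : forall x, cimg x -> cdom (cinv x);
  cfunK : forall p, cdom p -> cinv (cfun p) = p;
  cinvK : forall x, cimg x -> cfun (cinv x) = x;
  cfun_continuous : forall p, cdom p -> {for p, continuous cfun};
  cinv_continuous : forall x, cimg x -> {for x, continuous cinv}
}.

Definition smooth_transition (R : realType) (T : topologicalType) (n : nat)
    (c c' : chart R T n) : Prop :=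
  smooth_on (cimg c `&` cinv c @^-1` cdom c') (c' \o cinv c).

(* The atlas need not be maximal. [chart_at] selects a preferred chart around
   each point; it is used to represent tangent vectors by their coordinates. *)
Record smooth_structure (R : realType) (T : topologicalType) (n : nat) :=
  SmoothStructure {
  satlas : set (chart R T n);
  schart_at : T -> chart R T n;
  schart_at_atlas : forall p, satlas (schart_at p);
  schart_at_dom : forall p, cdom (schart_at p) p;
  satlas_smooth : forall c c', satlas c -> satlas c' -> smooth_transition c c'
}.

Record manifold (R : realType) (n : nat) := Manifold {
  mcar :> topologicalType;
  mstruct : smooth_structure R mcar n;
  mfd_hausdorff : hausdorff_space mcar;
  mfd_second_countable : @second_countable mcar
}.

Definition atlas (R : realType) (n : nat) (M : manifold R n) :
  set (chart R M n) := satlas (mstruct M).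

Definition chart_at (R : realType) (n : nat) (M : manifold R n) (p : M) :
  chart R M n := schart_at (mstruct M) p.

Definition smooth_chart (R : realType) (n : nat) (M : manifold R n)
    (c : chart R M n) : Prop :=
  forall c', atlas c' -> smooth_transition c c' /\ smooth_transition c' c.

Definition smooth_fun (R : realType) (n : nat) (M : manifold R n)
    (f : M -> R) : Prop :=
  forall c, atlas c -> smooth_on (cimg c) (f \o cinv c : 'rV[R]_n -> R^o).

Definition smooth_map (R : realType) (n n' : nat)
    (M : manifold R n) (N : manifold R n') (f : M -> N) : Prop :=
  continuous f /\
  forall c c', atlas c -> atlas c' ->
    smooth_on (cimg c `&` (f \o cinv c) @^-1` cdom c') (c' \o f \o cinv c).

(* A tangent vector at [p] is given by its coordinates in [chart_at p]. *)
Definition tangent (R : realType) (n : nat) (M : manifold R n) (p : M) :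
  vectType R := 'rV[R]_n.

Definition dual (R : realType) (V : vectType R) : vectType R := 'Hom(V, R^o).

Definition cotangent (R : realType) (n : nat) (M : manifold R n) (p : M) :
  vectType R := dual (tangent p).

Section Tangent.
Variables (R : realType) (n : nat) (M : manifold R n).

(* T_p M -> R^n and its inverse, for an arbitrary chart [c] around [p] *)
Definition tcoord (c : chart R M n) (p : M) (v : tangent p) : 'rV[R]_n :=
  'd (c \o cinv (chart_at p)) (chart_at p p) v.

Definition tvec (c : chart R M n) (p : M) (w : 'rV[R]_n) : tangent p :=
  'd (chart_at p \o cinv c) (c p) w.

Definition tmap (n' : nat) (N : manifold R n') (f : M -> N) (p : M) :
    'Hom(tangent p, tangent (f p)) :=
  linfun ('d (chart_at (f p) \o f \o cinv (chart_at p)) (chart_at p p)).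

Definition dfun (f : M -> R) (p : M) : cotangent p :=
  linfun ('d (f \o cinv (chart_at p) : 'rV[R]_n -> R^o) (chart_at p p)).

(* the velocity at t = 0 of a curve with gamma 0 = p *)
Definition velocity (gamma : R -> M) (p : M) : tangent p :=
  derive1 (chart_at p \o gamma) 0.

(* Vector fields and 1-forms are functions of the point; [vcoord] and [fcoord]
   are their expressions in a chart, and smoothness is a separate predicate. *)
Definition vcoord (c : chart R M n) (X : forall p : M, tangent p)
    (x : 'rV[R]_n) : 'rV[R]_n := tcoord c (X (cinv c x)).

Definition fcoord (c : chart R M n) (theta : forall p : M, cotangent p)
    (x w : 'rV[R]_n) : R^o := theta (cinv c x) (tvec c (cinv c x) w).

Definition smooth_vfield (X : forall p : M, tangent p) : Prop :=
  forall c, atlas c -> smooth_on (cimg c) (vcoord c X).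

Definition smooth_form (theta : forall p : M, cotangent p) : Prop :=
  forall c, atlas c -> forall w, smooth_on (cimg c) (fcoord c theta ^~ w).

(* [X, Y], in the coordinates of [chart_at p] *)
Definition lie_bracket (X Y : forall p : M, tangent p) (p : M) : tangent p :=
  let c := chart_at p in
  'd (vcoord c Y) (c p) (X p) - 'd (vcoord c X) (c p) (Y p).

(* (L_X eta)(Z) = X(eta(Z)) - eta([X, Z]), for Z the vector field with constant
   coordinates [w] in [chart_at p], so that [X, Z] = - D_w X *)
Definition lie_derivative (X : forall p : M, tangent p)
    (eta : forall p : M, cotangent p) (p : M) : cotangent p :=
  let c := chart_at p in
  linfun (fun w : tangent p => 'd (fcoord c eta ^~ w) (c p) (X p)
                               + eta p ('d (vcoord c X) (c p) w)).

(* d theta (U, W) = U(theta(W)) - W(theta(U)) - theta([U, W]), for U, W with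
   constant coordinates in [chart_at p] *)
Definition ext_derivative (theta : forall p : M, cotangent p) (p : M)
    (u w : tangent p) : R^o :=
  let c := chart_at p in
  'd (fcoord c theta ^~ w) (c p) u - 'd (fcoord c theta ^~ u) (c p) w.

Definition interior_d (Y : forall p : M, tangent p)
    (theta : forall p : M, cotangent p) (p : M) : cotangent p :=
  linfun (ext_derivative theta (Y p)).

Definition courant_bracket (s t : forall p : M, (tangent p * cotangent p)%type)
    (p : M) : (tangent p * cotangent p)%type :=
  let X q := (s q).1 in let theta q := (s q).2 in
  let Y q := (t q).1 in let eta q := (t q).2 in
  (lie_bracket X Y p, lie_derivative X eta p - interior_d Y theta p).

End Tangent.

Record total (R : realType) (B : Type) (fib : B -> vectType R) :=
  Vec { base : B; vec : fib base }.
Arguments Vec {R B fib base} vec.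

(* A chart [b] of the total space is a vector bundle chart if it covers a chart
   [c] of the base, has image (image of c) x R^k and is linear on fibres: its
   last k coordinates then trivialize the bundle over the domain of [c]. *)
Definition vb_chart (R : realType) (n k : nat) (M : manifold R n)
    (fib : M -> vectType R) (top : Topological (total fib))
    (b : chart R (Topological.Pack top) (n + k)) : Prop :=
  exists c : chart R M n,
    [/\ smooth_chart c,
        cdom b = [set x : total fib | cdom c (base x)],
        cimg b = [set z | cimg c (lsubmx z)],
        forall x : total fib, cdom b x -> lsubmx (b x) = c (base x) &
        forall m, cdom c m ->
          linear (fun v : fib m => rsubmx (b (Vec v)) : 'rV[R]_k)].

(* Every vector bundle admits an atlas of vector bundle charts, which determines
   the smooth structure of its total space; the bundle is presented by such an
   atlas. *)
Record vbundle (R : realType) (n k : nat) (M : manifold R n) := VBundle {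
  fib : M -> vectType R;
  tot_top : Topological (total fib);
  tot_struct : smooth_structure R (Topological.Pack tot_top) (n + k);
  tot_hausdorff : hausdorff_space (Topological.Pack tot_top);
  tot_second_countable : @second_countable (Topological.Pack tot_top);
  tot_vb_chart : forall b, satlas tot_struct b -> vb_chart b
}.

Definition total_space (R : realType) (n k : nat) (M : manifold R n)
    (E : vbundle k M) : manifold R (n + k) :=
  Manifold (tot_struct E) (@tot_hausdorff _ _ _ _ E)
    (@tot_second_countable _ _ _ _ E).

Coercion total_space : vbundle >-> manifold.

Section Bundle.
Variables (R : realType) (n k : nat) (M : manifold R n) (E : vbundle k M).

Definition proj (x : E) : M := base x.

Definition to_total (e : forall m : M, fib E m) (m : M) : E := Vec (e m).

Definition smooth_section (e : forall m : M, fib E m) : Prop :=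
  smooth_map (to_total e).

(* smoothness of the components with respect to the local frames of the dual
   bundle E^* given by the vector bundle charts *)
Definition smooth_dual_section (eps : forall m : M, dual (fib E m)) : Prop :=
  forall b : chart R E (n + k), atlas b -> forall w : 'rV[R]_k,
    smooth_on [set x : 'rV[R]_n | cimg b (row_mx x w)]
      (fun x => let y : E := cinv b (row_mx x w) in
                eps (proj y) (vec y) : R^o).

(* Sections are functions of the point, and Gamma(TM + E^* ), Gamma(E + T^*M)
   are carved out by the predicates [smoothA] and [smoothB]. *)
Definition sectionA : Type := forall m : M, (tangent m * dual (fib E m))%type.
Definition sectionB : Type := forall m : M, (fib E m * cotangent m)%type.

Definition smoothA (nu : sectionA) : Prop :=
  smooth_vfield (fun m => (nu m).1) /\ smooth_dual_section (fun m => (nu m).2).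

Definition smoothB (tau : sectionB) : Prop :=
  smooth_section (fun m => (tau m).1) /\ smooth_form (fun m => (tau m).2).

Definition pairing (m : M) (v : (tangent m * dual (fib E m))%type)
    (t : (fib E m * cotangent m)%type) : R := v.2 t.1 + t.2 v.1.

Definition exactB (f : M -> R) : sectionB := fun m => (0, dfun f m).

Definition anchor_der (nu : sectionA) (f : M -> R) (m : M) : R :=
  dfun f m (nu m).1.

(* Only the values of [Delta] on smooth sections matter. *)
Record dorfman_connection (Delta : sectionA -> sectionB -> sectionB) : Prop := {
  dorfman_smooth : forall nu tau,
    smoothA nu -> smoothB tau -> smoothB (Delta nu tau);
  dorfman_linearl : forall (a : R) nu nu' tau m,
    smoothA nu -> smoothA nu' -> smoothB tau ->
    Delta (fun p => a *: nu p + nu' p) tau m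
      = a *: Delta nu tau m + Delta nu' tau m;
  dorfman_linearr : forall (a : R) nu tau tau' m,
    smoothA nu -> smoothB tau -> smoothB tau' ->
    Delta nu (fun p => a *: tau p + tau' p) m
      = a *: Delta nu tau m + Delta nu tau' m;
  dorfman_scalel : forall (f : M -> R) nu tau m,
    smooth_fun f -> smoothA nu -> smoothB tau ->
    Delta (fun p => f p *: nu p) tau m
      = f m *: Delta nu tau m + pairing (nu m) (tau m) *: exactB f m;
  dorfman_scaler : forall (f : M -> R) nu tau m,
    smooth_fun f -> smoothA nu -> smoothB tau ->
    Delta nu (fun p => f p *: tau p) m
      = f m *: Delta nu tau m + anchor_der nu f m *: tau m;
  dorfman_exact : forall (f : M -> R) nu m,
    smooth_fun f -> smoothA nu ->
    Delta nu (exactB f) m = exactB (anchor_der nu f) m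
}.

Variable Delta : sectionA -> sectionB -> sectionB.

(* The pairing is nondegenerate and the right-hand side is tensorial in [tau],
   so exactly one [b] satisfies this condition. *)
Definition dual_bracket (nu1 nu2 : sectionA) : sectionA := fun m =>
  xget 0 [set b : (tangent m * dual (fib E m))%type |
    forall tau, smoothB tau ->
      pairing b (tau m) =
      anchor_der nu1 (fun p => pairing (nu2 p) (tau p)) m
      - pairing (nu2 m) (Delta nu1 tau m)].

Definition curvature (nu1 nu2 : sectionA) (tau : sectionB) : sectionB :=
  fun m => Delta nu1 (Delta nu2 tau) m - Delta nu2 (Delta nu1 tau) m
           - Delta (dual_bracket nu1 nu2) tau m.

Definition inlB (e : forall m : M, fib E m) : sectionB := fun m => (e m, 0).

(* R_Delta(nu1, nu2)(., 0) as a map E -> E + T^*M: by tensoriality the value at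
   [v] may be computed with any section [e] through [v]. *)
Definition curvature_hom (nu1 nu2 : sectionA) (m : M) (v : fib E m) :
    (fib E m * cotangent m)%type :=
  xget 0 [set r : (fib E m * cotangent m)%type |
    exists e, [/\ smooth_section e, e m = v &
                  r = curvature nu1 nu2 (inlB e) m]].

Definition ell (eps : forall m : M, dual (fib E m)) (x : E) : R :=
  eps (proj x) (vec x).

Definition sectionTE : Type := forall x : E, (tangent x * cotangent x)%type.

(* the curve t |-> x + t e in the fibre through [x] *)
Definition fibre_line (x : E) (e : fib E (proj x)) (t : R) : E :=
  Vec (vec x + t *: e : fib E (proj x)).

(* Since tau^up (x) depends on tau only through its value at [proj x], it is
   defined on elements of (E + T^*M)_(proj x). *)
Definition vlift_at (x : E)
    (t : (fib E (proj x) * cotangent (proj x))%type) :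
    (tangent x * cotangent x)%type :=
  (velocity (fibre_line t.1) x, (t.2 \o tmap proj x)%VF).

Definition vlift (tau : sectionB) : sectionTE :=
  fun x => vlift_at (tau (proj x)).

(* the section of TE + T^*E written with a tilde over phi *)
Definition core_section
    (phi : forall m : M, fib E m -> (fib E m * cotangent m)%type) : sectionTE :=
  fun x => vlift_at (phi (proj x) (vec x)).

(* The value does not depend on the section [e] through [x]. *)
Definition hor_lift (nu : sectionA) : sectionTE := fun x =>
  xget 0 [set s : (tangent x * cotangent x)%type |
    exists e, [/\ smooth_section e, e (proj x) = vec x &
      s = (tmap (to_total e) (proj x) (nu (proj x)).1 : tangent x,
           dfun (ell (fun m => (nu m).2)) x)
          - vlift_at (Delta nu (inlB e) (proj x))]].

End Bundle.

(* Main.v *)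
Require Import Defs.
From HB Require Import structures.
From mathcomp Require Import all_boot all_order all_algebra.
From mathcomp Require Import all_classical all_reals all_analysis.
From mathcomp Require Import ring.

Set Implicit Arguments.
Unset Strict Implicit.
Unset Printing Implicit Defensive.

Import Order.TTheory GRing.Theory Num.Theory.
Import numFieldNormedType.Exports.

Local Open Scope classical_set_scope.
Local Open Scope ring_scope.

(** The three identities are local on [E]. They are checked at a point [p] of [E]
    in the chart of [E] preferred at [p], which is a bundle chart [b] with
    coordinates z = (z1, z2) over a chart [c] of [M].

    The inputs of a Dorfman connection are global sections. Bump functions
    ([bump_manifold]) make it local in its second argument ([dorfman_local]) and
    turn the constant sections s_y, with fibre coordinates y, and the coordinate
    functions x_a of the chart into global objects that are unchanged near the
    point. A section tau = (e, theta) is near the point a combination of the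
    (s_j, 0) and the (0, d x_a), whose coefficients are functions. The Leibniz
    rule (b) and the rule (c) for exact forms then give [local_formula]: if X is
    the vector field underlying nu and if Gamma(y) and Lambda(y) denote the two
    components of Delta_nu (s_y, 0), then
      Delta_nu tau = (d e (X) + Gamma(e), Lambda(e) + L_X theta).

    Everything follows from this formula. Delta_nu (e, 0) and T e X contain the
    same derivative d e (X), so that the horizontal lift depends only on the
    value of e at the point ([hor_liftE]); the dual bracket exists because the
    derivatives of the components of tau cancel in its definition
    ([bracket_rhs]), and it is smooth ([smooth_bracket]). In the chart,
      sigma(nu) = ((X, - Gamma(z2)), d l_eps - Lambda(z2)),
      (e, theta)^up = ((0, e(z1)), theta(z1)),
    and the brackets become computations with derivatives.

    The first one vanishes as vertical lifts do not depend on z2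
    ([courant_vlift_vlift]); the second one is the local formula, because d l_eps
    is closed ([courant_hor_vlift]). For the third one, let e be a section
    through [p]. It computes both the curvature term and the lift of the dual
    bracket, and Delta along the dual bracket cancels between the two. What
    remains is the commutator of Delta_nu1 and Delta_nu2 on (e, 0), given by two
    applications of the local formula, and d l_eps for the dual bracket, where
    l_eps = d l_eps2 (V1) - Lambda1(z2)(X2) with V1 the vector field of
    sigma(nu1) ([near_ell_bracket]). The second derivatives of e and of l_eps1
    and l_eps2 are symmetric ([schwarz]), which closes the computation
    ([courant_hor_hor]). *)

(** * Smooth functions on normed spaces *)

Section Germs.
Variables (R : realType) (V W : normedModType R).
Implicit Types f g : V -> W.

Lemma near_is_diff f g df (x : V) :
  (\forall y \near x, f y = g y) -> is_diff x f df -> is_diff x g df.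
Proof.
move=> fg [fd <-].
have fgx : f x = g x := nbhs_singleton fg.
have [dfc fo] := (diff_locallyP _ _).1 fd.
have go : g \o shift x = cst (g x) + 'd f x +o_ 0 id.
  apply/eqaddoP => e e0; have /eqaddoP/(_ e e0) fe := fo.
  have fg0 : \forall y \near 0, f (y + x) = g (y + x).
    by move: fg; rewrite (near_shift 0) /= subr0.
  apply: filterS2 fe fg0 => y; rewrite !fctE /= fgx => fe fgy.
  by rewrite -fgy.
have E : 'd g x = 'd f x :> (V -> W) by apply: diff_unique.
apply: DiffDef; last exact: E.
by apply/diff_locallyP; rewrite E; split.
Qed.

Lemma near_differentiable f g (x : V) :
  (\forall y \near x, f y = g y) -> differentiable f x -> differentiable g x.
Proof. by move=> fg /differentiableP/(near_is_diff fg) []. Qed.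

Lemma near_diff f g (x : V) :
  (\forall y \near x, f y = g y) -> differentiable f x ->
  'd g x = 'd f x :> (V -> W).
Proof. by move=> fg /differentiableP/(near_is_diff fg) []. Qed.

Lemma near_derive_near f g (x v : V) :
  (\forall y \near x, f y = g y) -> \forall y \near x, 'D_v f y = 'D_v g y.
Proof.
move=> /near_join; apply: filterS => y; exact: near_eq_derive.
Qed.

Lemma near_continuous_at f g (x : V) :
  (\forall y \near x, f y = g y) -> {for x, continuous f} ->
  {for x, continuous g}.
Proof.
rewrite /prop_for /continuous_at => fg fc; rewrite -(nbhs_singleton fg).
apply: cvg_trans fc; apply: near_eq_cvg.
by apply: filterS fg => y ->.
Qed.

End Germs.

Section CkBasics.
Variables (R : realType) (V W : normedModType R).
Implicit Types (f g : V -> W) (U : set V) (j : nat).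

(** The clauses of [Ck] constrain [f] and its derivatives point by point, so that
    [Ck] can be checked one point at a time and depends on germs only. *)
Lemma CkP j U f : Ck j U f <-> forall x, U x -> Ck j [set x] f.
Proof.
elim: j U f => [|j IH] U f /=; split.
- by move=> h x Ux y ->; exact: h.
- by move=> h x Ux; apply: (h x Ux).
- move=> [h1 h2] x Ux; split=> [y ->|v]; first exact: h1.
  by apply: ((IH _ _).1 (h2 v)).
- move=> h; split=> [x Ux|v]; first by apply: (h x Ux).1.
  by apply/IH => x Ux; exact: (h x Ux).2.
Qed.

Lemma CkS j U f : Ck j.+1 U f -> Ck j U f.
Proof.
elim: j U f => [|j IH] U f /= [h1 h2].
  by move=> x Ux; apply/differentiable_continuous/h1.
by split=> // v; apply: IH; apply: h2.
Qed.

Lemma eq_Ck1 j f g x : (\forall y \near x, f y = g y) ->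
  Ck j [set x] f -> Ck j [set x] g.
Proof.
elim: j f g => [|j IH] f g /= fg.
  by move=> h y ->; apply/(near_continuous_at fg)/h.
move=> [h1 h2]; split=> [y ->|v]; first exact/(near_differentiable fg)/h1.
by apply: IH (h2 v); apply: near_derive_near.
Qed.

Lemma eq_Ck j U f g : open U -> (forall x, U x -> f x = g x) ->
  Ck j U f -> Ck j U g.
Proof.
move=> oU fg /CkP h; apply/CkP => x Ux; apply: eq_Ck1 (h x Ux).
by apply: filterS (open_nbhs_nbhs (conj oU Ux)).
Qed.

Lemma subset_Ck j U U' f : U' `<=` U -> Ck j U f -> Ck j U' f.
Proof. by move=> s /CkP h; apply/CkP => x /s; exact: h. Qed.

Lemma Ck_cst j U (w : W) : Ck j U (fun=> w).
Proof.
elim: j w => [|j IH] w /=; first by move=> x _; exact: cst_continuous.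
split=> [x _|v]; first exact: differentiable_cst.
rewrite (_ : 'D_v _ = (fun=> 0)) //.
by apply/funext => x; rewrite derive_cst.
Qed.

Lemma CkD j U f g : open U -> Ck j U f -> Ck j U g ->
  Ck j U (fun x => f x + g x).
Proof.
move=> oU; elim: j f g => [|j IH] f g /=.
  by move=> hf hg x Ux; apply: continuousD; [exact: hf|exact: hg].
move=> [f1 f2] [g1 g2]; split=> [x Ux|v].
  by apply: (@differentiableD _ _ _ f g); [exact: f1|exact: g1].
apply: (@eq_Ck _ _ (fun x => 'D_v f x + 'D_v g x)) (IH _ _ (f2 v) (g2 v)) => //.
move=> x Ux; rewrite -[RHS]/('D_v (f \+ g) x) deriveD//.
  by apply: diff_derivable; exact: f1.
by apply: diff_derivable; exact: g1.
Qed.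

Lemma Ck_linear j (f : {linear V -> W}) U : continuous f -> Ck j U f.
Proof.
move=> fc; case: j => [|j] /=; first by move=> x _; exact: fc.
split=> [x _|v]; first exact: linear_differentiable.
rewrite (_ : 'D_v f = (fun=> f v)); first exact: Ck_cst.
apply/funext => x; rewrite deriveE; last exact: linear_differentiable.
by rewrite diff_lin.
Qed.

End CkBasics.

Section ScaleBilinear.
Variables (R : realType) (W : normedModType R).

Definition scale_op (a : R^o) (w : W) : W := a *: w.

Fact scale_op_is_bilinear :
  bilinear_for (GRing.Scale.Law.clone _ _ *:%R _) (GRing.Scale.Law.clone _ _ *:%R _)
    scale_op.
Proof.
split=> [w|a] b x y /=; first by rewrite /scale_op scalerDl scalerA.
by rewrite /scale_op scalerDr !scalerA mulrC.
Qed.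

HB.instance Definition _ := bilinear_isBilinear.Build R R^o W W _ _
  scale_op scale_op_is_bilinear.

End ScaleBilinear.

Section Scale.
Variables (R : realType) (V W : normedModType R).
Implicit Types (k : V -> R^o) (g : V -> W) (x : V).

Lemma is_diff_scale k dk g dg x : is_diff x k dk -> is_diff x g dg ->
  is_diff x (fun y => k y *: g y) (fun v => k x *: dg v + dk v *: g x).
Proof.
move=> dkx dgx.
have c : continuous (fun p : R^o * W => @scale_op R W p.1 p.2).
  exact: scale_continuous.
have H : is_diff (k x, g x) (fun p : R^o * W => @scale_op R W p.1 p.2)
    (fun q => k x *: q.2 + q.1 *: g x).
  by split; [exact: differentiable_bilin|exact: diff_bilin].
have P := is_diff_pair dkx dgx.
exact: (is_diff_comp P H).
Qed.

Lemma Ck_scale j U k g : open U -> Ck j U k -> Ck j U g ->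
  Ck j U (fun x => k x *: g x).
Proof.
move=> oU; elim: j k g => [|j IH] k g /=.
  by move=> hf hg x Ux; apply: continuousZ; [exact: hf|exact: hg].
move=> [f1 f2] [g1 g2].
have D x : U x -> is_diff x (fun y => k y *: g y)
    (fun v => k x *: 'd g x v + 'd k x v *: g x).
  move=> Ux; apply: is_diff_scale; apply: differentiableP; [exact: f1|exact: g1].
split=> [x Ux|v]; first by case: (D x Ux).
have kj : Ck j U k by apply: CkS; split.
have gj : Ck j U g by apply: CkS; split.
apply: (@eq_Ck _ _ _ _ _ (fun x => k x *: 'D_v g x + 'D_v k x *: g x)) => //.
  move=> x Ux; have [d1 d2] := D x Ux.
  by rewrite [RHS]deriveE// d2 !deriveE//; [exact: f1|exact: g1].
apply: CkD => //; first exact: (IH _ _ kj (g2 v)).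
exact: (IH _ _ (f2 v) gj).
Qed.

End Scale.

Section Sum.
Variables (R : realType) (V W : normedModType R) (I : Type) (r : seq I).

Lemma Ck_sum j (U : set V) (f : I -> V -> W) : open U ->
  (forall i, Ck j U (f i)) -> Ck j U (fun x => \sum_(i <- r) f i x).
Proof.
move=> oU hf; elim: r => [|i s IH].
  by rewrite (_ : (fun _ => _) = fun=> 0); [exact: Ck_cst|apply/funext => x; rewrite big_nil].
rewrite (_ : (fun _ => _) = fun x => f i x + \sum_(i <- s) f i x).
  exact: CkD.
by apply/funext => x; rewrite big_cons.
Qed.

End Sum.

Lemma Ck_linear_comp (R : realType) (V W X : normedModType R) j (U : set V)
    (l : {linear X -> W}) (h : V -> X) : open U -> continuous l ->
  Ck j U h -> Ck j U (fun x => l (h x)).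
Proof.
move=> oU lc; elim: j h => [|j IH] h /=.
  by move=> hg x Ux; apply: (@continuous_comp _ _ _ h l); [exact: hg|exact: lc].
move=> [h1 h2].
have D x : U x -> is_diff x (fun y => l (h y)) (l \o 'd h x).
  move=> Ux; apply: (@is_diff_comp _ _ _ _ h _ l); first exact/differentiableP/h1.
  by split; [exact: linear_differentiable|exact: diff_lin].
split=> [x Ux|w]; first by case: (D x Ux).
apply: (@eq_Ck _ _ _ _ _ (fun x => l ('D_w h x))) (IH _ (h2 w)) => //.
move=> x Ux; have [d1 d2] := D x Ux.
by rewrite [RHS]deriveE // d2 /= deriveE//; exact: h1.
Qed.

(** The chain rule expresses the directional derivatives of a composite by finitely
    many partial derivatives of the outer function; this asks for coordinates on
    the space in the middle. *)
Definition finite_coords (R : realType) (X : normedModType R) : Prop :=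
  exists (n : nat) (e : 'I_n -> X) (l : 'I_n -> {linear X -> R^o}),
    (forall i, continuous (l i)) /\ forall x, x = \sum_i l i x *: e i.

Section Comp.
Variables (R : realType) (X V W : normedModType R).
Hypothesis fcX : finite_coords X.

(** D_v (f o g) is the sum over [i] of [l i (D_v g)] times [(D_(e i) f) o g], so the
    order of differentiability required of the factors drops by one. *)
Lemma Ck_comp j (U : set V) (U' : set X) (g : V -> X) (f : X -> W) :
  open U -> open U' -> (forall x, U x -> U' (g x)) ->
  Ck j U g -> Ck j U' f -> Ck j U (fun x => f (g x)).
Proof.
have [n [e [l [lc eX]]]] := fcX.
move=> oU oU' UU'; elim: j f g UU' => [|j IH] f g UU' /=.
  move=> hg hf x Ux; apply: (@continuous_comp _ _ _ g f); first exact: hg.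
  exact/hf/UU'.
move=> [g1 g2] [f1 f2].
have D x : U x -> is_diff x (fun y => f (g y)) ('d f (g x) \o 'd g x).
  move=> Ux; apply: (@is_diff_comp _ _ _ _ g _ f); apply: differentiableP.
    exact: g1.
  exact/f1/UU'.
split=> [x Ux|v]; first by case: (D x Ux).
apply: (@eq_Ck _ _ _ _ _ (fun x => \sum_i l i ('D_v g x) *: 'D_(e i) f (g x))) => //.
  move=> x Ux; have [d1 d2] := D x Ux.
  rewrite [RHS]deriveE// d2 /= -(deriveE v (g1 x Ux)).
  rewrite [in RHS](eX ('D_v g x)) linear_sum; apply: eq_bigr => i _.
  by rewrite linearZ /= (deriveE (e i) (f1 _ (UU' _ Ux))).
have gj : Ck j U g by apply: CkS; split.
apply: Ck_sum => // i; apply: Ck_scale => //; last first.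
  exact: (IH ('D_(e i) f) g UU' gj (f2 (e i))).
exact: (Ck_linear_comp _ _ (g2 v)).
Qed.

End Comp.

Section FiniteCoords.
Variable R : realType.

Lemma finite_coords_scalar : finite_coords (R^o : normedModType R).
Proof.
exists 1%N, (fun=> 1), (fun=> idfun); split=> [_ x|x]; first exact: cvg_id.
by rewrite big_ord1 /= /GRing.scale /= mulr1.
Qed.

Definition coord_lin n (i : 'I_n) (v : 'rV[R]_n) : R^o := v ord0 i.

Fact coord_lin_is_linear n i : linear (@coord_lin n i).
Proof. by move=> a u v; rewrite /coord_lin !mxE. Qed.

HB.instance Definition _ n i := GRing.isLinear.Build R 'rV[R]_n R^o _
  (@coord_lin n i) (@coord_lin_is_linear n i).

Lemma coord_lin_continuous n i : continuous (@coord_lin n i).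
Proof. exact: coord_continuous. Qed.

Lemma row_coords n (x : 'rV[R]_n) : x = \sum_i x ord0 i *: delta_mx ord0 i.
Proof. exact: row_sum_delta. Qed.

Lemma finite_coords_row n : finite_coords ('rV[R]_n : normedModType R).
Proof.
exists n, (fun i => delta_mx ord0 i), (fun i => @coord_lin n i : {linear _ -> _}); split.
  by move=> i; exact: coord_lin_continuous.
exact: row_coords.
Qed.

Lemma linear_row_continuous n (W : normedModType R) (f : {linear 'rV[R]_n -> W}) :
  continuous f.
Proof.
have -> : (f : _ -> _) = \sum_i (fun x : 'rV[R]_n => coord_lin i x *: f (delta_mx ord0 i)).
  apply/funext => x; rewrite fct_sumE [in LHS](row_coords x) linear_sum.
  by apply: eq_bigr => i _; rewrite linearZ.
apply: (big_ind (fun g : 'rV[R]_n -> W => continuous g)) => [x|g h gc hc x|i _ x].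
- exact: cst_continuous.
- by apply: continuousD; [exact: gc|exact: hc].
- by apply: continuousZ; [exact: coord_lin_continuous|exact: cst_continuous].
Qed.

End FiniteCoords.

(** * Smooth germs *)

(** Germs compose and restrict without keeping track of domains, and [smooth_on] an
    open set is smoothness of all germs ([smooth_onP]). *)
Definition smooth_at (R : realType) (V W : normedModType R) (f : V -> W) (x : V) :=
  exists2 U, open_nbhs x U & smooth_on U f.

Section SmoothAt.
Variables (R : realType) (V W : normedModType R).
Implicit Types (f g : V -> W) (x : V).

Lemma smooth_onP (U : set V) f : open U ->
  smooth_on U f <-> forall x, U x -> smooth_at f x.
Proof.
move=> oU; split=> [fU x Ux|h j]; first by exists U.
apply/CkP => x /h[U' [oU' U'x] /(_ j)/CkP]; exact.
Qed.

Lemma smooth_at_near f x : smooth_at f x -> \forall y \near x, smooth_at f y.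
Proof.
move=> [U oU fU]; apply: filterS (open_nbhs_nbhs oU) => y Uy.
by exists U => //; split=> //; case: oU.
Qed.

Lemma eq_smooth_at f g x : (\forall y \near x, f y = g y) ->
  smooth_at f x -> smooth_at g x.
Proof.
move=> fg [U oU fU].
have fgU : nbhs x (U `&` [set y | f y = g y]).
  by apply: filterI => //; exact: open_nbhs_nbhs.
exists (interior (U `&` [set y | f y = g y])).
  split; first exact: open_interior.
  exact: fgU.
move=> j; apply: (@eq_Ck _ _ _ j _ f) => [|y /interior_subset[]//|].
  exact: open_interior.
by apply: subset_Ck (fU j) => y /interior_subset[].
Qed.

Lemma smooth_at2 f g x : smooth_at f x -> smooth_at g x ->
  exists2 U, open_nbhs x U & smooth_on U f /\ smooth_on U g.
Proof.
move=> [U oU fU] [U' oU' gU']; exists (U `&` U'); first exact: open_nbhsI.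
by split=> j; [apply: subset_Ck (fU j)|apply: subset_Ck (gU' j)] => ? [].
Qed.

Lemma smooth_at_diff f x : smooth_at f x -> differentiable f x.
Proof. by move=> [U [_ Ux] /(_ 1%N) []] h _; exact: h. Qed.

Lemma smooth_at_cont f x : smooth_at f x -> {for x, continuous f}.
Proof. by move/smooth_at_diff/differentiable_continuous. Qed.

Lemma smooth_at_derive f x v : smooth_at f x -> smooth_at ('D_v f) x.
Proof. by move=> [U oU fU]; exists U => // j; have [_] := fU j.+1; apply. Qed.

Lemma smooth_at_cst (w : W) x : smooth_at (fun=> w) x.
Proof. by exists setT => [|j]; [exact: open_nbhsT|exact: Ck_cst]. Qed.

Lemma smooth_atD f g x : smooth_at f x -> smooth_at g x ->
  smooth_at (fun y => f y + g y) x.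
Proof.
move=> fx gx; have [U oU [fU gU]] := smooth_at2 fx gx.
by exists U => // j; apply: CkD; [case: oU|exact: fU|exact: gU].
Qed.

Lemma smooth_at_linear (f : {linear V -> W}) x : continuous f -> smooth_at f x.
Proof. by move=> fc; exists setT => [|j]; [exact: open_nbhsT|exact: Ck_linear]. Qed.

Lemma smooth_at_scale (k : V -> R^o) f x : smooth_at k x -> smooth_at f x ->
  smooth_at (fun y => k y *: f y) x.
Proof.
move=> [U oU fU] [U' oU' gU']; exists (U `&` U'); first exact: open_nbhsI.
move=> j; apply: Ck_scale; first by apply: openI; [case: oU|case: oU'].
  by apply: subset_Ck (fU j) => ? [].
by apply: subset_Ck (gU' j) => ? [].
Qed.

Lemma smooth_atZ (a : R) f x : smooth_at f x -> smooth_at (fun y => a *: f y) x.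
Proof. by move=> fx; apply: (@smooth_at_scale (fun=> a)) fx; exists setT => [|j]; [exact: open_nbhsT|exact: Ck_cst]. Qed.

Lemma smooth_atN f x : smooth_at f x -> smooth_at (fun y => - f y) x.
Proof.
move=> /(smooth_atZ (-1)); apply: eq_smooth_at; apply: nearW => y.
by rewrite scaleN1r.
Qed.

Lemma smooth_atB f g x : smooth_at f x -> smooth_at g x ->
  smooth_at (fun y => f y - g y) x.
Proof. by move=> fx gx; apply: smooth_atD => //; exact: smooth_atN. Qed.

Lemma smooth_at_sum (I : Type) (r : seq I) (F : I -> V -> W) x :
  (forall i, smooth_at (F i) x) -> smooth_at (fun y => \sum_(i <- r) F i y) x.
Proof.
move=> Fx; elim: r => [|i s IH].
  by apply: eq_smooth_at (smooth_at_cst 0 x); apply: nearW => y; rewrite big_nil.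
apply: eq_smooth_at (smooth_atD (Fx i) IH); apply: nearW => y.
by rewrite big_cons.
Qed.

End SmoothAt.

Section SmoothAtComp.
Variables (R : realType) (V X W : normedModType R).

Lemma smooth_at_comp (f : X -> W) (g : V -> X) (x : V) : finite_coords X ->
  smooth_at g x -> smooth_at f (g x) -> smooth_at (fun y => f (g y)) x.
Proof.
move=> fcX gx [U' [oU' U'x] fU'].
have gc := smooth_at_cont gx; have [U [oU Ux] gU] := gx.
have N : nbhs x (U `&` g @^-1` U').
  by apply: filterI; [exact: open_nbhs_nbhs|apply: gc; exact: open_nbhs_nbhs].
exists (interior (U `&` g @^-1` U')).
  split; first exact: open_interior.
  exact: N.
move=> j; apply: (@Ck_comp _ _ _ _ fcX j _ U') => //.
- exact: open_interior.
- by move=> y /interior_subset[].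
- by apply: subset_Ck (gU j) => y /interior_subset[].
Qed.

Lemma smooth_at_linear_comp (l : {linear X -> W}) (g : V -> X) (x : V) :
  continuous l -> smooth_at g x -> smooth_at (fun y => l (g y)) x.
Proof.
move=> lc [U oU gU]; exists U => // j; apply: Ck_linear_comp => //.
by case: oU.
Qed.

End SmoothAtComp.

Section SmoothAtDiff.
Variables (R : realType) (V W : normedModType R).

(** In coordinates this is a finite sum of products of components of [g] and partial
    derivatives of [f]. *)
Lemma smooth_at_diff_app (f : V -> W) (g : V -> V) (x : V) : finite_coords V ->
  smooth_at f x -> smooth_at g x -> smooth_at (fun y => 'd f y (g y)) x.
Proof.
move=> [n [e [l [lc eV]]]] fx gx.
have h : smooth_at (fun y => \sum_i l i (g y) *: 'D_(e i) f y) x.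
  apply: smooth_at_sum => i; apply: smooth_at_scale.
    exact: smooth_at_linear_comp.
  exact: smooth_at_derive.
apply: eq_smooth_at h; apply: filterS (smooth_at_near fx) => y fy.
rewrite [in RHS](eV (g y)) linear_sum; apply: eq_bigr => i _.
by rewrite linearZ /= (deriveE (e i) (smooth_at_diff fy)).
Qed.

End SmoothAtDiff.

Section SmoothAtRow.
Variables (R : realType) (V : normedModType R).

Lemma smooth_at_rowP n (f : V -> 'rV[R]_n) x :
  smooth_at f x <-> forall i, smooth_at (fun y => f y ord0 i : R^o) x.
Proof.
split=> [fx i|h].
  by apply: (smooth_at_linear_comp (l := @coord_lin R n i)) fx; exact: coord_lin_continuous.
have : smooth_at (fun y => \sum_i f y ord0 i *: (delta_mx ord0 i : 'rV[R]_n)) x.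
  apply: smooth_at_sum => i; apply: smooth_at_scale => //; exact: smooth_at_cst.
by apply: eq_smooth_at; apply: nearW => y; rewrite -row_coords.
Qed.

Lemma smooth_at_row_linear n (W : normedModType R) (l : {linear 'rV[R]_n -> W})
  (f : V -> 'rV[R]_n) x : smooth_at f x -> smooth_at (fun y => l (f y)) x.
Proof. by apply: smooth_at_linear_comp; exact: linear_row_continuous. Qed.

Lemma smooth_at_row_mx n k (f : V -> 'rV[R]_n) (g : V -> 'rV[R]_k) x :
  smooth_at f x -> smooth_at g x -> smooth_at (fun y => row_mx (f y) (g y)) x.
Proof.
move=> fx gx; apply/smooth_at_rowP => i; rewrite -(splitK i).
case: (fintype.split i) => j /=.
  have := (smooth_at_rowP _ _).1 fx j.
  by apply: eq_smooth_at; apply: nearW => y; rewrite row_mxEl.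
have := (smooth_at_rowP _ _).1 gx j.
by apply: eq_smooth_at; apply: nearW => y; rewrite row_mxEr.
Qed.

End SmoothAtRow.

Lemma is_diff_coord (R : realType) (V : normedModType R) N (f : V -> 'rV[R]_N) (x : V) i :
  differentiable f x ->
  is_diff x (fun y => f y ord0 i : R^o) (fun v => 'd f x v ord0 i).
Proof.
move=> df; have cc : continuous (@coord_lin R N i) by exact: coord_lin_continuous.
have H : is_diff (f x) (@coord_lin R N i) (@coord_lin R N i).
  by split; [exact: linear_differentiable|exact: diff_lin].
exact: (is_diff_comp (differentiableP df) H).
Qed.

Lemma linear_row_sum (R : realType) (N : nat) (W : lmodType R) (f : 'rV[R]_N -> W) (u : 'rV[R]_N) : linear f ->
  f u = \sum_i u ord0 i *: f (delta_mx ord0 i).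
Proof.
move=> fl; pose L := GRing.isLinear.Build _ _ _ _ f fl.
pose FL : {linear 'rV[R]_N -> W} := HB.pack f L.
rewrite -[f]/(FL : _ -> _) [in LHS](row_coords u) linear_sum.
by apply: eq_bigr => i _; rewrite linearZ.
Qed.

Section LinearFamily.
Variables (R : realType) (V W : normedModType R) (k : nat).
Variables (F : V -> 'rV[R]_k -> W) (g : V -> 'rV[R]_k) (x : V).
Hypothesis Flin : \forall y \near x, linear (F y).

Let Fexp : \forall y \near x, forall u,
  F y u = \sum_i (u ord0 i : R^o) *: F y (delta_mx ord0 i).
Proof. by apply: filterS Flin => y Fy u; exact: linear_row_sum. Qed.

Lemma smooth_at_linfam : (forall u, smooth_at (F ^~ u) x) -> smooth_at g x ->
  smooth_at (fun y => F y (g y)) x.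
Proof.
move=> Fx gx.
have h : smooth_at (fun y => \sum_i (g y ord0 i : R^o) *: F y (delta_mx ord0 i)) x.
  by apply: smooth_at_sum => i; apply: smooth_at_scale (Fx _); exact: ((smooth_at_rowP _ _).1 gx i).
by apply: eq_smooth_at h; apply: filterS Fexp => y ->.
Qed.

(** The product rule for x |-> F x (g x) when [F x] is linear: expanding [g] on the
    standard basis reduces it to products with scalar functions. The coordinate
    expressions of pairings, forms and Christoffel symbols all have this shape. *)
Lemma diff_linfam : (forall u, differentiable (F ^~ u) x) -> differentiable g x ->
  is_diff x (fun y => F y (g y)) (fun v => 'd (F ^~ (g x)) x v + F x ('d g x v)).
Proof.
move=> Fx gx.
have gi i := is_diff_coord i gx.
have D (h : V -> 'rV[R]_k) (dh : V -> 'rV[R]_k) :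
    (forall i, is_diff x (fun y => h y ord0 i : R^o) (fun v => dh v ord0 i)) ->
    is_diff x (fun y => F y (h y)) (fun v => \sum_i
      ((h x ord0 i : R^o) *: 'd (F ^~ (delta_mx ord0 i)) x v +
       (dh v ord0 i : R^o) *: F x (delta_mx ord0 i))).
  move=> hi.
  have Ds : forall r : seq 'I_k, is_diff x (fun y => \sum_(i <- r)
      (h y ord0 i : R^o) *: F y (delta_mx ord0 i)) (fun v => \sum_(i <- r)
      ((h x ord0 i : R^o) *: 'd (F ^~ (delta_mx ord0 i)) x v +
       (dh v ord0 i : R^o) *: F x (delta_mx ord0 i))).
    elim=> [|i r IH].
      rewrite [X in is_diff x X _](_ : _ = cst 0); last by apply/funext => y; rewrite big_nil.
      rewrite [X in is_diff x _ X](_ : _ = 0); last by apply/funext => y; rewrite big_nil.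
      exact: is_diff_cst.
    have Di := is_diff_scale (hi i) (differentiableP (Fx (delta_mx ord0 i))).
    have S := is_diffD Di IH.
    apply: is_diff_eq (near_is_diff _ S) _.
      by apply: nearW => y; rewrite big_cons.
    by apply/funext => v; rewrite big_cons.
  by apply: near_is_diff (Ds _); apply: filterS Fexp => y ->.
have D1 := D g _ gi.
have D0 : is_diff x (F ^~ (g x)) (fun v => \sum_i
      ((g x ord0 i : R^o) *: 'd (F ^~ (delta_mx ord0 i)) x v +
       0 *: F x (delta_mx ord0 i))).
  apply: is_diff_eq (D (fun=> g x) (fun=> 0) _) _; last first.
    by apply/funext => v; apply: eq_bigr => i _; rewrite mxE.
  move=> i; apply: is_diff_eq (is_diff_cst (g x ord0 i : R^o) x) _.
  by apply/funext => v; rewrite mxE.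
apply: is_diff_eq D1 _; apply/funext => v; have [_ ->] := D0.
rewrite (nbhs_singleton Fexp) -big_split /=; apply: eq_bigr => i _.
by rewrite scale0r addr0.
Qed.

End LinearFamily.

(** * Symmetry of second derivatives *)

Section Schwarz.
Variables (R : realType) (V : normedModType R).
Implicit Types (f : V -> R^o).

Lemma is_derive_line f (p v : V) (s : R) : differentiable f (p + s *: v) ->
  is_derive s (1 : R^o) (fun t : R^o => f (p + t *: v)) ('D_v f (p + s *: v)).
Proof.
move=> df.
have H1 : is_diff (s : R^o) (fun t : R^o => t *: v) (fun t : R^o => t *: v).
  exact: is_diff_scalel.
have H2 : is_diff (s : R^o) (fun t : R^o => p + t *: v) (fun t : R^o => t *: v).
  apply: is_diff_eq (is_diffD (is_diff_cst p (s : R^o)) H1) _.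
  by apply/funext => t; rewrite !fctE add0r.
have [d1 d2] := is_diff_comp H2 (differentiableP df).
apply: DeriveDef; first exact: diff_derivable.
rewrite [LHS](deriveE _ d1) [LHS](congr1 (@^~ (1 : R^o)) d2) /=.
by rewrite scale1r (deriveE _ df).
Qed.

Lemma mvt_line f (p v : V) (t : R) : 0 < t ->
  (forall s, 0 <= s <= t -> differentiable f (p + s *: v)) ->
  exists2 s, 0 < s < t & f (p + t *: v) - f p = 'D_v f (p + s *: v) * t.
Proof.
move=> t0 df.
have D s : 0 <= s <= t -> is_derive s (1 : R^o) (fun t : R^o => f (p + t *: v))
   ('D_v f (p + s *: v)) by move=> /df; exact: is_derive_line.
have [] := @MVT R (fun t => f (p + t *: v)) (fun s => 'D_v f (p + s *: v)) 0 t t0.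
- move=> s /andP[]; rewrite !bnd_simp => s0 st; apply: D.
  by rewrite !ltW.
- apply: derivable_within_continuous => s.
  rewrite in_itv /= => st; by have [] := D s st.
- move=> s; rewrite in_itv /= => st; rewrite scale0r addr0 subr0 => ->.
  by exists s.
Qed.

(** The mean value theorem along [v] for y |-> f (y + t w) - f y, followed by the mean
    value theorem along [w] for the derivative of [f] along [v]. *)
Lemma second_difference f (x v w : V) (t : R) (U : set V) : 0 < t ->
  smooth_on U f ->
  (forall a b, 0 <= a <= t -> 0 <= b <= t -> U (x + a *: v + b *: w)) ->
  exists a b, [/\ 0 < a < t, 0 < b < t &
    f (x + t *: v + t *: w) - f (x + t *: v) - f (x + t *: w) + f x =
    'D_w ('D_v f) (x + a *: v + b *: w) * t * t].
Proof.
move=> t0 fU Ut.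
have fd y : U y -> differentiable f y by have [h _] := fU 1%N; exact: h.
have dfd y : U y -> differentiable ('D_v f) y.
  by have [_ /(_ v) [h _]] := fU 2%N; exact: h.
have tt0 : 0 <= t <= t. by rewrite lexx (ltW t0).
have zt : 0 <= (0:R) <= t. by rewrite lexx (ltW t0).
pose g y := f (y + t *: w) - f y.
have shiftd y : differentiable f (y + t *: w) ->
    is_diff y (fun y => f (y + t *: w)) ('d f (y + t *: w)).
  move=> d; have H : is_diff y (fun y => y + t *: w) id.
    apply: is_diff_eq (is_diffD (is_diff_id y) (is_diff_cst (t *: w) y)) _.
    by apply/funext => z; rewrite !fctE addr0.
  exact: (is_diff_comp H (differentiableP d)).
have gd a : 0 <= a <= t -> is_diff (x + a *: v) g
    (('d f (x + a *: v + t *: w) : V -> R^o) - ('d f (x + a *: v) : V -> R^o)).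
  move=> lat; apply: is_diffB.
    by apply: shiftd; apply: fd; apply: Ut.
  by apply: differentiableP; apply: fd; have := Ut a 0 lat zt; rewrite scale0r addr0.
have [a lat E] := @mvt_line g x v t t0 (fun a h => let: DiffDef d _ := gd a h in d).
have at' : 0 <= a <= t by case/andP: lat => *; rewrite !ltW.
have [b bt F] := @mvt_line ('D_v f) (x + a *: v) w t t0 (fun b h => dfd _ (Ut _ _ at' h)).
exists a, b; split=> //; rewrite -F.
have [d1 d2] := gd a at'.
have Ua0 : U (x + a *: v) by have := Ut a 0 at' zt; rewrite scale0r addr0.
rewrite (deriveE v (fd _ (Ut _ _ at' tt0))) (deriveE v (fd _ Ua0)).
have -> : 'd f (x + a *: v + t *: w) v - 'd f (x + a *: v) v = 'd g (x + a *: v) v.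
  by rewrite [RHS](congr1 (@^~ v) d2).
rewrite -(deriveE v d1) -E /g opprB addrA.
by rewrite [RHS]addrAC.
Qed.

(** The second difference of [f] over the parallelogram spanned by [t v] and [t w] is
    symmetric in [v] and [w]. Divided by t^2 it is a value of either mixed derivative
    at a nearby point, and both are continuous. *)
Lemma schwarz f (x v w : V) : smooth_at f x -> 'D_v ('D_w f) x = 'D_w ('D_v f) x.
Proof.
move=> fx; have [U [oU Ux] fU] := fx.
apply/eqP; rewrite -subr_eq0 -normr_le0; apply/ler_addgt0Pl => e e0; rewrite addr0.
have c1 : {for x, continuous ('D_w ('D_v f))}.
  exact: smooth_at_cont (smooth_at_derive w (smooth_at_derive v fx)).
have c2 : {for x, continuous ('D_v ('D_w f))}.
  exact: smooth_at_cont (smooth_at_derive v (smooth_at_derive w fx)).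
have e2 : 0 < e / 2 by rewrite divr_gt0.
have /cvgrPdist_lt /(_ _ e2) n1 := c1.
have /cvgrPdist_lt /(_ _ e2) n2 := c2.
have n0 : nbhs x U by exact: open_nbhs_nbhs.
have [r r0 hr] := (nbhs_normP _ _).1 (filterI n0 (filterI n1 n2)).
pose q := `|v| + `|w| + 1.
have q0 : 0 < q by rewrite ltr_wpDl // addr_ge0.
pose t := r / 2 / q.
have t0 : 0 < t by rewrite !divr_gt0.
have B a b : 0 <= a <= t -> 0 <= b <= t -> ball_ Num.norm x r (x + a *: v + b *: w).
  move=> /andP[a0 lat] /andP[b0 bt]; rewrite /ball_ /= -addrA opprD addNKr normrN.
  apply: (le_lt_trans (ler_normD _ _)); rewrite !normrZ !ger0_norm//.
  apply: (@le_lt_trans _ _ (t * q)).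
    rewrite /q !mulrDr mulr1; apply: (@le_trans _ _ (t * `|v| + t * `|w|)).
      by apply: lerD; apply: ler_wpM2r.
    by rewrite lerDl ltW.
  by rewrite /t divfK ?gt_eqF// ltr_pdivrMr// ltr_pMr// ltr1n.
have [a [b [ha hb E1]]] := @second_difference f x v w t U t0 fU
  (fun s s' h1 h2 => (hr _ (B s s' h1 h2)).1).
have {ha} /andP[a0 lat] := ha; have {hb} /andP[b0 bt] := hb.
have B' s s' : 0 <= s <= t -> 0 <= s' <= t -> ball_ Num.norm x r (x + s *: w + s' *: v).
  by move=> h1 h2; rewrite addrAC; exact: B.
have [c [d [hc hd E2]]] := @second_difference f x w v t U t0 fU
  (fun s s' h1 h2 => (hr _ (B' s s' h1 h2)).1).
have {hc} /andP[c0 ct] := hc; have {hd} /andP[d0 dt] := hd.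
have F1 : `|'D_w ('D_v f) x - 'D_w ('D_v f) (x + a *: v + b *: w)| < e / 2.
  have Ha : 0 <= a <= t. by rewrite !ltW.
  have Hb : 0 <= b <= t. by rewrite !ltW.
  exact: (hr _ (B a b Ha Hb)).2.1.
have F2 : `|'D_v ('D_w f) x - 'D_v ('D_w f) (x + c *: w + d *: v)| < e / 2.
  have Hc : 0 <= c <= t. by rewrite !ltW.
  have Hd : 0 <= d <= t. by rewrite !ltW.
  exact: (hr _ (B' c d Hc Hd)).2.2.
move: E1 E2 F1 F2; set A := 'D_w _ (_ + _); set B0 := 'D_v _ (_ + _).
clearbody A B0; move: ('D_w _ x) ('D_v _ x) => A1 B1 E1 E2 F1 F2.
have E : A = B0.
  have tn0 : t != 0 by rewrite gt_eqF.
  apply: (@mulIf R t tn0); apply: (@mulIf R t tn0).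
  apply: etrans (esym E1) _; apply: etrans E2.
  rewrite [x + t *: w + _]addrAC; congr (_ + _); exact: addrAC.
have -> : B1 - A1 = (B1 - B0) - (A1 - A).
  by rewrite E opprB addrA addrNK.
apply: (le_trans (ler_normB _ _)); rewrite (splitr e).
by apply/ltW/ltrD; [exact: F2|exact: F1].
Qed.

End Schwarz.

(** * Bump functions on row vectors *)

Section Flat.
Variable R : realType.

(** The functions t^-n exp (-1/t) contain exp (-1/t), and the derivative of each of
    them is a linear combination of two others; this is what the induction on the
    order of smoothness needs. *)
Definition flat (n : nat) (t : R^o) : R^o :=
  if 0 < t then t^-1 ^+ n * expR (- t^-1) else 0.

Lemma flat_le0 n t : t <= 0 -> flat n t = 0.
Proof. by rewrite /flat ltNge => ->. Qed.

Lemma flat_ge0 n t : 0 <= flat n t.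
Proof.
rewrite /flat; case: ifPn => // t0.
by rewrite mulr_ge0 ?expR_ge0 // exprn_ge0 // invr_ge0 ltW.
Qed.

(** From exp u >= u^(n+2) / (n+2)! at u = 1/t. A quadratic bound makes the function
    differentiable at 0 with derivative 0. *)
Lemma flat_bound n t : `|flat n t| <= n.+2`!%:R * `|t| ^+ 2.
Proof.
rewrite ger0_norm ?flat_ge0 // /flat; case: ifPn => [t0|_]; last first.
  by rewrite mulr_ge0.
have u0 : 0 < t^-1 by rewrite invr_gt0.
have h : t^-1 ^+ n.+2 / n.+2`!%:R <= expR t^-1.
  by apply: le_trans (expR_ge1Dxn n.+1 (ltW u0)); rewrite lerDr.
rewrite expRN (ger0_norm (ltW t0)) ler_pdivrMr ?expR_gt0 //.
rewrite -ler_pdivrMl ?mulr_gt0 ?exprn_gt0 ?ltr0n ?fact_gt0 //.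
apply: le_trans h.
by rewrite invfM -exprVn -mulrA -exprD add2n mulrC.
Qed.

Lemma is_diff_flat n t :
  is_diff t (flat n) (fun v => v *: (flat n.+2 t - n%:R * flat n.+1 t)).
Proof.
have [t0|t0|->] := ltgtP t (0 : R).
- apply: (@near_is_diff _ _ _ (cst 0)).
    by apply: filterS (lt_nbhsl t0) => y y0; rewrite flat_le0// ltW.
  apply: is_diff_eq (is_diff_cst _ _) _; apply/funext => v.
  by rewrite !flat_le0 ?ltW// mulr0 subr0 scaler0.
- apply: (@near_is_diff _ _ _ (fun t : R^o => t^-1 ^+ n * expR (- t^-1) : R^o)).
    by apply: filterS (lt_nbhsr t0) => y y0; rewrite /flat y0.
  have tn0 : t != 0 by rewrite gt_eqF.
  have DV : is_derive t (1:R) (fun t : R => t^-1 : R) (- t^-1 ^+ 2).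
    apply: is_derive_eq (@is_deriveV R id t 1 1 tn0 _) _.
    by rewrite /GRing.scale /= mulr1 exprVn.
  have DN : is_derive t (1:R) (fun t : R => - t^-1 : R) (t^-1 ^+ 2).
    by apply: is_derive_eq (is_deriveN DV) _; rewrite opprK.
  have DE : is_derive t (1:R) (fun t : R => expR (- t^-1) : R) (expR (- t^-1) * t^-1 ^+ 2).
    exact: (is_derive1_comp (is_derive_expR _) DN).
  have DX : is_derive t (1:R) (fun t : R => t^-1 ^+ n : R) ((n%:R * t^-1 ^+ n.-1) *: (- t^-1 ^+ 2)).
    have := is_deriveX n DV; by rewrite exprfctE.
  have [d1 d2] := is_deriveM DX DE.
  have D : differentiable (fun t : R => t^-1 ^+ n * expR (- t^-1)) t by exact/derivable1_diffP.
  apply: DiffDef; first exact: D.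
  apply/funext => v.
  rewrite -[v in LHS]mulr1 -[v * 1]/(v *: (1:R)) linearZ /= -(deriveE _ D).
  have -> : 'D_1 (fun t : R => t^-1 ^+ n * expR (- t^-1)) t = (t^-1 ^+ n * expR (- t^-1)) * t^-1 ^+ 2 -
     n%:R * t^-1 ^+ n.-1 * t^-1 ^+ 2 * expR (- t^-1) :> R.
    rewrite [LHS]d2 /GRing.scale /=. rewrite mulrN mulrA. congr (_ + _).
    by rewrite mulrN mulrC.
  rewrite /flat t0; congr (v *: _).
  rewrite mulrAC -exprD addn2; congr (_ - _).
  case: n {DX d1 d2 D} => [|n]; first by rewrite !mul0r.
  by rewrite [n.+1.-1]/= -(mulrA n.+1%:R) -exprD addn2 -mulrA.
- have D0 : flat n \o shift 0 = cst (flat n 0) + 0 +o_ (0 : R^o) id.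
    apply/eqaddoP => e e0.
    have c0 : 0 < n.+2`!%:R :> R by rewrite ltr0n fact_gt0.
    have : \forall y \near (0 : R^o), `|y| <= e / n.+2`!%:R.
      apply/nbhs_normP; exists (e / n.+2`!%:R); first by rewrite /= divr_gt0.
      by move=> y; rewrite /ball_ /= sub0r normrN => /ltW.
    apply: filterS => y hy; rewrite !fctE /= !addr0 (@flat_le0 _ 0)// subr0.
    apply: le_trans (flat_bound n y) _.
    by rewrite expr2 mulrA ler_wpM2r// mulrC -ler_pdivlMr.
  pose z : {linear R^o -> R^o} := 'd (cst (0 : R^o)) (0 : R^o).
  have z0 : z = 0 :> (R^o -> R^o) by rewrite /z diff_cst.
  have dc : continuous z by rewrite z0; exact: cst_continuous.
  have E : 'd (flat n) 0 = z :> (R^o -> R^o).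
    by apply: diff_unique => //; rewrite z0.
  have f0 m : flat m 0 = 0 by apply: flat_le0.
  rewrite !f0 mulr0 subr0.
  apply: DiffDef.
    by apply/diff_locallyP; rewrite E z0; split => //; exact: cst_continuous.
  by rewrite E z0; apply/funext => v; rewrite scaler0.
Qed.

Lemma Ck_flat j n (U : set R^o) : open U -> Ck j U (flat n).
Proof.
move=> oU; elim: j n => [|j IH] n /=.
  move=> x _; apply: differentiable_continuous; by case: (is_diff_flat n x).
split=> [x _|v]; first by case: (is_diff_flat n x).
have -> : 'D_v (flat n) = fun t => v *: (flat n.+2 t + (- n%:R) *: flat n.+1 t).
  apply/funext => t; have [d1 d2] := is_diff_flat n t.
  by rewrite deriveE // d2 /= /GRing.scale /= mulNr.
apply: Ck_scale => //; first exact: Ck_cst.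
apply: CkD => //; apply: Ck_scale => //; exact: Ck_cst.
Qed.

Lemma flat0_homo (s t : R^o) : s <= t -> flat 0 s <= flat 0 t.
Proof.
move=> st; have [s0|s0] := leP s 0; first by rewrite (flat_le0 _ s0) flat_ge0.
have t0 : 0 < t := lt_le_trans s0 st.
by rewrite /flat s0 t0 !expr0 !mul1r ler_expR lerN2 lef_pV2.
Qed.

Lemma flat_gt0 n (t : R^o) : 0 < t -> 0 < flat n t.
Proof. by move=> t0; rewrite /flat t0 mulr_gt0 ?expR_gt0// exprn_gt0// invr_gt0. Qed.

(** Nesting [flat 0] yields a step without dividing functions: the argument of the outer
    function is nonpositive for t <= 0 and constant for t >= 1. *)
Definition smooth_step (t : R^o) : R^o :=
  (flat 0 (flat 0 1))^-1 *: flat 0 (flat 0 1 - flat 0 (1 - t)).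

Lemma smooth_step_le0 t : t <= 0 -> smooth_step t = 0.
Proof.
move=> t0; rewrite /smooth_step (@flat_le0 0 (_ - _)) ?scaler0// subr_le0.
by apply: flat0_homo; rewrite lerBrDr gerDl.
Qed.

Lemma smooth_step_ge1 t : 1 <= t -> smooth_step t = 1.
Proof.
move=> t1; rewrite /smooth_step (@flat_le0 0 (1 - t)) ?subr_le0// subr0.
by rewrite /GRing.scale /= mulVf // gt_eqF// !flat_gt0.
Qed.

Lemma smooth_at_flat n t : smooth_at (flat n) t.
Proof. by exists setT => [|j]; [exact: open_nbhsT|apply: Ck_flat; exact: openT]. Qed.

Lemma smooth_at_smooth_step t : smooth_at smooth_step t.
Proof.
have fc := finite_coords_scalar R.
have S0 : smooth_at (fun s : R^o => 1 - s : R^o) t.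
  apply: smooth_atB; first exact: smooth_at_cst.
  by apply: (@smooth_at_linear _ _ _ idfun) => x; exact: cvg_id.
have S1 := smooth_at_comp fc S0 (smooth_at_flat 0 _).
have S2 := smooth_atB (smooth_at_cst (flat 0 1) t) S1.
exact: (smooth_atZ _ (smooth_at_comp fc S2 (smooth_at_flat 0 _))).
Qed.

End Flat.

Section Bump.
Variables (R : realType) (n : nat).

Lemma smooth_at_prod (V : normedModType R) (I : Type) (r : seq I) (F : I -> V -> R^o) x :
  (forall i, smooth_at (F i) x) -> smooth_at (fun y => \prod_(i <- r) F i y : R^o) x.
Proof.
move=> Fx; elim: r => [|i s IH].
  by apply: eq_smooth_at (smooth_at_cst (1 : R^o) x); apply: nearW => y; rewrite big_nil.
apply: eq_smooth_at (smooth_at_scale (Fx i) IH); apply: nearW => y.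
by rewrite big_cons.
Qed.

(** The norm of a row vector is the maximum of its entries, so a product of steps in the
    single coordinates works. With q = (x_i - a_i) / r the argument 2 - 4 q^2 is at
    least 1 for |q| <= 1/2 and negative for |q| >= 1. *)
Lemma bump_row (a : 'rV[R]_n) (r : R) : 0 < r -> exists chi : 'rV[R]_n -> R^o,
  [/\ forall x, smooth_at chi x,
      forall x, `|x - a| <= r / 2 -> chi x = 1 &
      forall x, r <= `|x - a| -> chi x = 0].
Proof.
move=> r0.
pose q (i : 'I_n) (x : 'rV[R]_n) : R^o := r^-1 *: (x ord0 i - a ord0 i).
pose chi x : R^o := \prod_i smooth_step (2 - 4 *: (q i x * q i x)).
exists chi; split=> x.
- apply: smooth_at_prod => i.
  have si : smooth_at (q i) x.
    apply: smooth_atZ; apply: smooth_atB; last exact: smooth_at_cst.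
    by apply: (@smooth_at_linear _ _ _ (@coord_lin R n i)); exact: coord_lin_continuous.
  have S := smooth_atB (smooth_at_cst (2 : R^o) x) (smooth_atZ 4 (smooth_at_scale si si)).
  exact: (smooth_at_comp (finite_coords_scalar R) S (smooth_at_smooth_step _)).
- move=> xr; rewrite /chi big1 // => i _; apply: smooth_step_ge1.
  have h : `|q i x| <= 2^-1.
    rewrite /q normrZ gtr0_norm ?invr_gt0// ler_pdivrMl//.
    apply: le_trans xr.
    have := @le_bigmax _ _ _ 0 (fun i : 'I_1 * 'I_n => `|(x - a) i.1 i.2|) (ord0, i).
    by rewrite [`|x - a|]mx_normrE /= !mxE.
  have h2 : q i x * q i x <= 4^-1.
    move: (q i x : R) h => z h.
    rewrite -[z * z]expr2 -real_normK ?num_real// expr2.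
    rewrite (_ : 4^-1 = 2^-1 * 2^-1 :> R); first exact: ler_pM.
    by rewrite -invfM -natrM.
  rewrite lerBrDr -lerBrDl (_ : 2 - 1 = 4 * 4^-1 :> R).
    by apply: ler_wpM2l.
  by rewrite mulfV // -[2]/(1 + 1 : R) addrK.
- move=> rx; have : [exists i, r <= `|x ord0 i - a ord0 i|].
    apply: contraLR rx; rewrite negb_exists => /forallP h.
    rewrite -ltNge [`|x - a|]mx_normrE; apply: bigmax_lt => //= -[j i] _ /=.
    by rewrite (ord1 j) !mxE ltNge; exact: h.
  move=> /existsP[i ri]; rewrite /chi (bigD1 i) //= smooth_step_le0 ?mul0r //.
  have h : 1 <= `|q i x|.
    by rewrite /q normrZ gtr0_norm ?invr_gt0// mulrC ler_pdivlMr// mul1r.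
  have h2 : 1 <= q i x * q i x.
    move: (q i x : R) h => z h.
    rewrite -[z * z]expr2 -real_normK ?num_real// expr2.
    by rewrite -[leLHS]mulr1 ler_pM.
  rewrite subr_le0; apply: (@le_trans _ _ (4 * 1)).
    by rewrite mulr1 ler_nat.
  by apply: ler_wpM2l.
Qed.

End Bump.

(** * Tangent vectors and forms in charts *)

Lemma near_all (T : topologicalType) (x : T) (P : T -> Prop) :
  (forall y, P y) -> \forall y \near x, P y.
Proof. by move=> h; apply: nearW. Qed.

Section Charts.
Variables (R : realType) (n : nat) (M : manifold R n).
Implicit Types (c a b : chart R M n) (p q : M) (W : normedModType R).

Lemma chart_at_atlas p : atlas (chart_at p).
Proof. exact: schart_at_atlas. Qed.

Lemma chart_at_dom p : cdom (chart_at p) p.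
Proof. exact: schart_at_dom (mstruct M) p. Qed.

Lemma atlas_smooth_chart c : atlas c -> smooth_chart c.
Proof. by move=> ac c' ac'; split; apply: (@satlas_smooth _ _ _ (mstruct M)). Qed.

Lemma chart_at_smooth p : smooth_chart (chart_at p).
Proof. exact/atlas_smooth_chart/chart_at_atlas. Qed.

Lemma near_cdom c p : cdom c p -> \forall q \near p, cdom c q.
Proof.
move=> cp; apply: (@open_nbhs_nbhs M p (cdom c)); split; last exact: cp.
exact: open_cdom.
Qed.

Lemma near_cimg c x : cimg c x -> \forall y \near x, cimg c y.
Proof.
move=> cp; apply: (@open_nbhs_nbhs _ x (cimg c)); split; last exact: cp.
exact: open_cimg.
Qed.

Lemma near_cinv c p (P : M -> Prop) : cdom c p ->
  (\forall q \near p, P q) -> \forall x \near c p, P (cinv c x).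
Proof.
move=> cp Pp; have := cinv_continuous (cfun_img cp).
by rewrite /prop_for /continuous_at (cfunK cp) => h; exact: (h P Pp).
Qed.

Lemma near_cfun c p (P : 'rV[R]_n -> Prop) : cdom c p ->
  (\forall x \near c p, P x) -> \forall q \near p, P (c q).
Proof. by move=> cp Pp; have h := cfun_continuous cp; exact: (h P Pp). Qed.

Lemma open_transition c c' : open (cimg c `&` cinv c @^-1` cdom c').
Proof.
rewrite openE => x [cx c'x].
rewrite /interior; apply: filterI; first exact: near_cimg.
have h := @cinv_continuous _ _ _ c x cx.
exact: (h _ (near_cdom c'x)).
Qed.

Lemma smooth_at_transition_atlas c c' p : smooth_transition c c' ->
  cdom c p -> cdom c' p -> smooth_at (c' \o cinv c) (c p).
Proof.
move=> cc' cp c'p.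
apply: ((smooth_onP _ (@open_transition c c')).1 cc' (c p)); split.
  exact: cfun_img.
by rewrite /preimage /= cfunK.
Qed.

(** Near the point, F o a^-1 = (F o c^-1) o (c o a^-1). *)
Lemma smooth_at_compat W (F : M -> W) a c p : cdom a p -> cdom c p ->
  smooth_at (c \o cinv a) (a p) ->
  smooth_at (F \o cinv c) (c p) -> smooth_at (F \o cinv a) (a p).
Proof.
move=> ap cp ca Fc.
have h : smooth_at (fun x => (F \o cinv c) ((c \o cinv a) x)) (a p).
  apply: smooth_at_comp ca _; first exact: finite_coords_row.
  by rewrite /= (cfunK ap).
apply: eq_smooth_at h; have := near_cinv ap (near_cdom cp).
by apply: filterS => x cx /=; rewrite cfunK.
Qed.

Lemma smooth_at_transition c c' p : smooth_chart c -> smooth_chart c' ->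
  cdom c p -> cdom c' p -> smooth_at (c' \o cinv c) (c p).
Proof.
move=> sc sc' cp c'p.
have [_ ac'] := sc' _ (chart_at_atlas p); have [ca _] := sc _ (chart_at_atlas p).
apply: (smooth_at_compat cp (chart_at_dom p)).
  exact: smooth_at_transition_atlas (chart_at_dom p).
exact: smooth_at_transition_atlas (chart_at_dom p) _.
Qed.

Lemma smooth_at_change W (F : M -> W) a c p : smooth_chart a -> smooth_chart c ->
  cdom a p -> cdom c p ->
  smooth_at (F \o cinv c) (c p) -> smooth_at (F \o cinv a) (a p).
Proof.
move=> sa sc ap cp; apply: smooth_at_compat => //.
exact: smooth_at_transition.
Qed.

Lemma is_diff_change W (F : M -> W) a c p : smooth_chart a -> smooth_chart c ->
  cdom a p -> cdom c p -> differentiable (F \o cinv c) (c p) ->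
  is_diff (a p) (F \o cinv a) ('d (F \o cinv c) (c p) \o 'd (c \o cinv a) (a p)).
Proof.
move=> sa sc ap cp dF.
have dca := differentiableP (smooth_at_diff (smooth_at_transition sa sc ap cp)).
have dF' : is_diff ((c \o cinv a) (a p)) (F \o cinv c) ('d (F \o cinv c) (c p)).
  by rewrite /= (cfunK ap); exact: differentiableP.
apply: near_is_diff (is_diff_comp dca dF').
by have := near_cinv ap (near_cdom cp); apply: filterS => x cx /=; rewrite cfunK.
Qed.

Lemma diff_change W (F : M -> W) a c p (v : 'rV[R]_n) :
  smooth_chart a -> smooth_chart c ->
  cdom a p -> cdom c p -> differentiable (F \o cinv c) (c p) ->
  'd (F \o cinv a) (a p) v = 'd (F \o cinv c) (c p) ('d (c \o cinv a) (a p) v).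
Proof.
move=> sa sc ap cp dF; have [_ E] := is_diff_change sa sc ap cp dF.
exact: (congr1 (@^~ v) E).
Qed.

Lemma diff_chart_id c p (v : 'rV[R]_n) : cdom c p -> 'd (c \o cinv c) (c p) v = v.
Proof.
move=> cp; have H : is_diff (c p) (c \o cinv c) id.
  apply: near_is_diff (is_diff_id (c p : 'rV[R]_n)).
  by apply: filterS (near_cimg (cfun_img cp)) => x cx /=; rewrite cinvK.
by have [_ ->] := H.
Qed.

Lemma tcoordK c p : smooth_chart c -> cdom c p ->
  cancel (@tcoord _ _ M c p) (tvec c p).
Proof.
move=> sc cp v; have da := chart_at_dom p; have sa := chart_at_smooth p.
rewrite /tcoord /tvec -(diff_change v sa sc da cp).
  exact: (diff_chart_id _ da).
exact: smooth_at_diff (smooth_at_transition sc sa cp da).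
Qed.

Lemma tvecK c p : smooth_chart c -> cdom c p ->
  cancel (@tvec _ _ M c p) (@tcoord _ _ M c p).
Proof.
move=> sc cp v; have da := chart_at_dom p; have sa := chart_at_smooth p.
rewrite /tcoord /tvec -(diff_change v sc sa cp da).
  exact: (diff_chart_id _ cp).
exact: smooth_at_diff (smooth_at_transition sa sc da cp).
Qed.

Lemma tcoord_change a c p v : smooth_chart a -> smooth_chart c ->
  cdom a p -> cdom c p -> @tcoord _ _ M c p v = 'd (c \o cinv a) (a p) (tcoord a v).
Proof.
move=> sa sc ap cp; have d := smooth_at_diff (smooth_at_transition sa sc ap cp).
exact: (diff_change v (chart_at_smooth p) sa (chart_at_dom p) ap d).
Qed.

Lemma tvec_change a c p w : smooth_chart a -> smooth_chart c ->
  cdom a p -> cdom c p -> @tvec _ _ M c p w = tvec a p ('d (a \o cinv c) (c p) w).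
Proof.
move=> sa sc ap cp.
have d := smooth_at_diff (smooth_at_transition sa (chart_at_smooth p) ap (chart_at_dom p)).
exact: (diff_change w sc sa cp ap d).
Qed.

Lemma tcoord_chart_at p v : @tcoord _ _ M (chart_at p) p v = v.
Proof. by rewrite /tcoord diff_chart_id //; exact: chart_at_dom. Qed.

Lemma tvec_chart_at p v : @tvec _ _ M (chart_at p) p v = v.
Proof. by rewrite /tvec diff_chart_id //; exact: chart_at_dom. Qed.

Lemma tvec_linear c p : linear (@tvec _ _ M c p).
Proof. by move=> a u v; rewrite /tvec linearP. Qed.

Lemma tcoord_linear c p : linear (@tcoord _ _ M c p).
Proof. by move=> a u v; rewrite /tcoord linearP. Qed.

Lemma fcoord_at c (theta : forall p, cotangent p) p w : cdom c p ->
  @fcoord _ _ M c theta (c p) w = theta p (tvec c p w).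
Proof.
by rewrite /fcoord => cp; move: (cfunK cp); move: (cinv c (c p)) => q ->.
Qed.

Lemma fcoordE c (theta : forall p, cotangent p) p v :
  smooth_chart c -> cdom c p -> @fcoord _ _ M c theta (c p) (tcoord c v) = theta p v.
Proof.
by move=> sc cp; rewrite fcoord_at // tcoordK.
Qed.

Lemma fcoord_linear c (theta : forall p, cotangent p) x : linear (@fcoord _ _ M c theta x).
Proof. by move=> a u v; rewrite /fcoord tvec_linear linearP. Qed.

Lemma vcoordE c (X : forall p, tangent p) p :
  cdom c p -> @vcoord _ _ M c X (c p) = tcoord c (X p).
Proof. by move=> cp; rewrite /vcoord cfunK. Qed.

(** Components change by the derivative of the transition map, itself a smooth function of
    the point. *)
Lemma smooth_at_vcoord_change (X : forall p : M, tangent p) a c p :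
  smooth_chart a -> smooth_chart c -> cdom a p -> cdom c p ->
  smooth_at (vcoord a X) (a p) -> smooth_at (vcoord c X) (c p).
Proof.
move=> sa sc ap cp Xa.
have tr := smooth_at_transition sa sc ap cp.
have h : smooth_at (fun y => 'd (c \o cinv a) y (vcoord a X y)) (a p).
  by apply: smooth_at_diff_app => //; exact: finite_coords_row.
have h2 : smooth_at (fun x => (fun y => 'd (c \o cinv a) y (vcoord a X y))
    ((a \o cinv c) x)) (c p).
  have tr' := smooth_at_transition sc sa cp ap.
  apply: (smooth_at_comp (f := fun y => 'd (c \o cinv a) y (vcoord a X y))
    (@finite_coords_row R n) tr').
  by rewrite /= (cfunK cp).
apply: eq_smooth_at h2.
have := near_cinv cp (near_cdom ap); have := near_cinv cp (near_cdom cp).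
apply: filterS2 => x cx ax /=.
by rewrite vcoordE // -tcoord_change.
Qed.

Lemma smooth_at_fcoord_change (theta : forall p : M, cotangent p) a c p :
  smooth_chart a -> smooth_chart c -> cdom a p -> cdom c p ->
  (forall w, smooth_at (fcoord a theta ^~ w) (a p)) ->
  forall w, smooth_at (fcoord c theta ^~ w) (c p).
Proof.
move=> sa sc ap cp Xa w.
have tr := smooth_at_transition sc sa cp ap.
have FL : \forall x \near c p, linear (fcoord a theta ((a \o cinv c) x)).
  by apply: near_all => x; exact: fcoord_linear.
have h : smooth_at (fun x => fcoord a theta ((a \o cinv c) x) ('d (a \o cinv c) x w)) (c p).
  apply: (smooth_at_linfam FL) => [u|].
    apply: (smooth_at_comp (f := fcoord a theta ^~ u) (@finite_coords_row R n) tr).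
    by rewrite /= cfunK.
  apply: smooth_at_diff_app tr _; first exact: finite_coords_row.
  exact: smooth_at_cst.
apply: eq_smooth_at h.
have := near_cinv cp (near_cdom ap); have := near_cinv cp (near_cdom cp).
have := near_cimg (cfun_img cp).
apply: filterS3 => x ix cx ax /=.
rewrite (fcoord_at _ _ ax) /fcoord (tvec_change w sa sc ax cx).
by rewrite (cinvK ix).
Qed.

(** [smooth_fun] tests the charts of the atlas, while the base chart of a bundle chart is
    only compatible with them. Hence one smooth chart around each point must suffice,
    and any other smooth chart may be used ([smooth_fun_at]); the same holds for vector
    fields and forms below. *)
Lemma smooth_funP (f : M -> R) :
  smooth_fun f <-> forall p, exists c, [/\ smooth_chart c, cdom c p &
    smooth_at (f \o cinv c : _ -> R^o) (c p)].
Proof.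
split=> [sf p|h c ac].
  exists (chart_at p); split; [exact: chart_at_smooth|exact: chart_at_dom|].
  apply: ((smooth_onP _ _).1 (sf _ (chart_at_atlas p))); first exact: open_cimg.
  exact/cfun_img/chart_at_dom.
apply/smooth_onP; first exact: open_cimg.
move=> x cx; have [a [sa ap]] := h (cinv c x).
have ca := atlas_smooth_chart ac.
move=> /(@smooth_at_change _ _ c a _ ca sa (cinv_dom cx) ap).
by rewrite cinvK.
Qed.

Lemma smooth_fun_at (f : M -> R) c p : smooth_fun f -> smooth_chart c -> cdom c p ->
  smooth_at (f \o cinv c : _ -> R^o) (c p).
Proof.
move=> /smooth_funP/(_ p)[a [sa ap fa]] sc cp.
exact: (@smooth_at_change _ (f : M -> R^o) c a).
Qed.

Lemma smooth_vfieldP (X : forall p : M, tangent p) :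
  smooth_vfield X <-> forall p, exists c, [/\ smooth_chart c, cdom c p &
    smooth_at (vcoord c X) (c p)].
Proof.
split=> [sf p|h c ac].
  exists (chart_at p); split; [exact: chart_at_smooth|exact: chart_at_dom|].
  apply: ((smooth_onP _ _).1 (sf _ (chart_at_atlas p))); first exact: open_cimg.
  exact/cfun_img/chart_at_dom.
apply/smooth_onP; first exact: open_cimg.
move=> x cx; have [a [sa ap]] := h (cinv c x).
have ca := atlas_smooth_chart ac.
move=> /(smooth_at_vcoord_change sa ca ap (cinv_dom cx)).
by rewrite cinvK.
Qed.

Lemma smooth_vfield_at (X : forall p : M, tangent p) c p :
  smooth_vfield X -> smooth_chart c -> cdom c p -> smooth_at (vcoord c X) (c p).
Proof.
move=> /smooth_vfieldP/(_ p)[a [sa ap fa]] sc cp.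
exact: (@smooth_at_vcoord_change _ a c).
Qed.

Lemma smooth_formP (theta : forall p : M, cotangent p) :
  smooth_form theta <-> forall p, exists c, [/\ smooth_chart c, cdom c p &
    forall w, smooth_at (fcoord c theta ^~ w) (c p)].
Proof.
split=> [sf p|h c ac w].
  exists (chart_at p); split; [exact: chart_at_smooth|exact: chart_at_dom|] => w.
  apply: ((smooth_onP _ _).1 (sf _ (chart_at_atlas p) w)); first exact: open_cimg.
  exact/cfun_img/chart_at_dom.
apply/smooth_onP; first exact: open_cimg.
move=> x cx; have [a [sa ap]] := h (cinv c x).
have ca := atlas_smooth_chart ac.
move=> /(smooth_at_fcoord_change sa ca ap (cinv_dom cx))/(_ w).
by rewrite cinvK.
Qed.

Lemma smooth_form_at (theta : forall p : M, cotangent p) c p w :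
  smooth_form theta -> smooth_chart c -> cdom c p -> smooth_at (fcoord c theta ^~ w) (c p).
Proof.
move=> /smooth_formP/(_ p)[a [sa ap fa]] sc cp.
exact: (@smooth_at_fcoord_change _ a c).
Qed.

Lemma dfunE (f : M -> R) c p v : smooth_chart c -> cdom c p ->
  differentiable (f \o cinv c : _ -> R^o) (c p) ->
  dfun f p v = 'd (f \o cinv c : _ -> R^o) (c p) (tcoord c v).
Proof.
move=> sc cp df; rewrite /dfun lfunE /=.
exact: (@diff_change _ (f : M -> R^o) _ c p v (chart_at_smooth p) sc (chart_at_dom p) cp df).
Qed.

Lemma velocityE (gamma : R -> M) c p : smooth_chart c -> cdom c p -> gamma 0 = p ->
  differentiable (c \o gamma : R^o -> _) 0 -> {for 0, continuous gamma} ->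
  tcoord c (velocity gamma p) = 'd (c \o gamma : R^o -> _) 0 1.
Proof.
move=> sc cp g0 dg cg; have sa := chart_at_smooth p; have da := chart_at_dom p.
have tr := smooth_at_diff (smooth_at_transition sc sa cp da).
have H : is_diff (0 : R^o) (chart_at p \o gamma : R^o -> _)
    ('d (chart_at p \o cinv c) (c p) \o 'd (c \o gamma : R^o -> _) 0).
  have H2 : is_diff ((c \o gamma) 0) (chart_at p \o cinv c) ('d (chart_at p \o cinv c) (c p)).
    by rewrite /= g0; exact: differentiableP.
  apply: near_is_diff (is_diff_comp (differentiableP dg) H2).
  have : \forall t \near (0 : R^o), cdom c (gamma t).
    by apply: cg; rewrite g0; exact: near_cdom.
  by apply: filterS => t ct /=; rewrite cfunK.
have [d1 d2] := H.
have E : velocity gamma p = tvec c p ('d (c \o gamma : R^o -> _) 0 1).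
  exact: etrans (derive1E' d1) (congr1 (@^~ (1 : R^o)) d2).
by rewrite E; exact: tvecK.
Qed.

End Charts.

Section Tmap.
Variables (R : realType) (n n' : nat) (M : manifold R n) (N : manifold R n').

Lemma tmapE (f : M -> N) (c : chart R M n) (b : chart R N n') p v :
  smooth_chart c -> smooth_chart b -> cdom c p -> cdom b (f p) ->
  {for p, continuous f} -> differentiable (b \o f \o cinv c) (c p) ->
  tcoord b (tmap f p v) = 'd (b \o f \o cinv c) (c p) (tcoord c v).
Proof.
move=> sc sb cp bfp fc df.
have sa := chart_at_smooth (f p); have da := chart_at_dom (f p).
have tr := smooth_at_diff (smooth_at_transition sb sa bfp da).
have H : is_diff (c p) ((chart_at (f p) \o f) \o cinv c)
    ('d (chart_at (f p) \o cinv b) (b (f p)) \o 'd (b \o f \o cinv c) (c p)).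
  have H2 : is_diff ((b \o f \o cinv c) (c p)) (chart_at (f p) \o cinv b)
      ('d (chart_at (f p) \o cinv b) (b (f p))).
    by rewrite /= (cfunK cp); exact: differentiableP.
  apply: near_is_diff (is_diff_comp (differentiableP df) H2).
  have : \forall q \near p, cdom b (f q) by apply: fc; exact: near_cdom.
  by move=> /(near_cinv cp); apply: filterS => t ct /=; rewrite cfunK.
have [d1 d2] := H.
have E : tmap f p v = tvec b (f p) ('d (b \o f \o cinv c) (c p) (tcoord c v)).
  rewrite /tmap lfunE /=.
  apply: etrans (diff_change v (chart_at_smooth p) sc (chart_at_dom p) cp d1) _.
  exact: (congr1 (@^~ (tcoord c v)) d2).
by rewrite E; exact: (tvecK sb bfp).
Qed.

End Tmap.

(** * Cut-off functions on a manifold *)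

Section Bump.
Variables (R : realType) (n : nat) (M : manifold R n).
Implicit Types (c : chart R M n) (p q : M).

(** The support is controlled by a closed set inside [U]; vanishing outside [U] would not
    make extensions by zero smooth at the boundary of [U]. *)
Definition cutoff (U : set M) (chi : M -> R) :=
  smooth_fun chi /\ exists2 K : set M, closed K /\ K `<=` U &
    forall q, ~ K q -> chi q = 0.

(** The function of [bump_row], read in the chart. Its support lies in the image of a closed
    ball, which is compact and hence closed, [M] being Hausdorff. *)
Lemma bump_manifold c p (U : set M) : smooth_chart c -> cdom c p -> nbhs p U ->
  exists2 chi, cutoff (cdom c `&` U) chi & \forall q \near p, chi q = 1.
Proof.
move=> sc cp Up.
have V : \forall x \near c p, cimg c x /\ U (cinv c x).
  apply: filterI; first exact: near_cimg (cfun_img cp).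
  exact: near_cinv.
have [r r0 hr] := (nbhs_normP _ _).1 V.
have r20 : 0 < r / 2 by rewrite divr_gt0.
have [chi [chis chi1 chi0]] := bump_row (c p) r20.
pose B := [set x : 'rV[R]_n | `|x - c p| <= r / 2].
have Bsub x : B x -> cimg c x /\ U (cinv c x).
  move=> Bx; apply: hr; rewrite /ball_ /= distrC; apply: le_lt_trans Bx _.
  by rewrite ltr_pdivrMr // ltr_pMr // ltr1n.
have Bcl : closed B.
  rewrite (_ : B = closed_ball (c p : 'rV[R]_n) (r / 2)); first exact: closed_ball_closed.
  by rewrite closed_ballE //; apply/seteqP; split=> x; rewrite /B /closed_ball_ /= distrC.
have Bbd : bounded_set B.
  exists (`|c p| + r / 2); split; first exact: num_real.
  move=> y yr x Bx; apply: ltW; apply: le_lt_trans yr.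
  rewrite -[x](subrK (c p)) addrC; apply: le_trans (ler_normD _ _) _.
  by rewrite lerD2l.
have Bco : compact B by exact: bounded_closed_compact.
pose K := cinv c @` B.
have Kco : compact K.
  apply: continuous_compact => //; apply: continuous_in_subspaceT => x.
  by rewrite inE => /Bsub[cx _]; exact: cinv_continuous.
have Kcl : closed K by apply: compact_closed Kco; exact: mfd_hausdorff.
pose f q : R := if pselect (cdom c q) then chi (c q) else 0.
have fc q : cdom c q -> f q = chi (c q) by rewrite /f; case: pselect.
have fK q : ~ K q -> f q = 0.
  rewrite /f; case: pselect => // cq Kq; apply: chi0.
  rewrite leNgt; apply/negP => h; apply: Kq; exists (c q); last exact: cfunK.
  exact: ltW.
exists f; last first.
  have : \forall x \near c p, `|x - c p| <= r / 2 / 2.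
    apply/nbhs_normP; exists (r / 2 / 2); first by rewrite /= divr_gt0.
    by move=> x; rewrite /ball_ /= distrC => /ltW.
  move=> /(near_cfun cp) h; have := near_cdom cp; move: h; apply: filterS2 => q h cq.
  by rewrite fc // chi1.
split; last first.
  exists K => //; split=> // _ [x Bx <-]; have [cx Ux] := Bsub x Bx.
  by split => //; exact: cinv_dom.
apply/smooth_funP => q; have [cq|ncq] := pselect (cdom c q).
  exists c; split=> //; apply: eq_smooth_at (chis (c q)).
  by apply: filterS (near_cimg (cfun_img cq)) => x cx /=; rewrite fc ?cinvK //; exact: cinv_dom.
exists (chart_at q); split; [exact: chart_at_smooth|exact: chart_at_dom|].
apply: eq_smooth_at (smooth_at_cst 0 _).
have Kq : ~ K q by case=> x /Bsub[cx _] xq; apply: ncq; rewrite -xq; exact: cinv_dom.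
have : \forall q' \near q, ~ K q'.
  apply: (@open_nbhs_nbhs M q (~` K)); split; last exact: Kq.
  exact: closed_openC.
by move=> /(near_cinv (chart_at_dom q)); apply: filterS => x /fK.
Qed.

End Bump.

Section CutOff.
Variables (R : realType) (n : nat) (M : manifold R n).
Implicit Types (c : chart R M n) (p q : M).

Lemma cutoff_near (U : set M) chi q : cutoff U chi -> ~ U q ->
  \forall q' \near q, chi q' = 0.
Proof.
move=> [_ [K [Kcl KU] K0]] Uq.
have : \forall q' \near q, ~ K q'.
  apply: (@open_nbhs_nbhs M q (~` K)); split; first exact: closed_openC.
  by move=> /KU.
by apply: filterS => q' /K0.
Qed.

(** Extension by zero: since the support is closed, the product vanishes near every point
    outside the domain of the chart. *)
Lemma cutoff_mul c chi (F : M -> R) : smooth_chart c -> cutoff (cdom c) chi ->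
  (forall q, cdom c q -> smooth_at (F \o cinv c : _ -> R^o) (c q)) ->
  smooth_fun (fun q => chi q * F q).
Proof.
move=> sc chiU sF; apply/smooth_funP => q; have [cq|ncq] := pselect (cdom c q).
  exists c; split=> //.
  exact: (smooth_at_scale (smooth_fun_at chiU.1 sc cq) (sF q cq)).
exists (chart_at q); split; [exact: chart_at_smooth|exact: chart_at_dom|].
apply: eq_smooth_at (smooth_at_cst 0 _).
have := near_cinv (chart_at_dom q) (cutoff_near chiU ncq).
by apply: filterS => x /= ->; rewrite mul0r.
Qed.

End CutOff.

(** * Vector bundle charts *)

Section VB.
Variables (R : realType) (n k : nat) (M : manifold R n) (E : vbundle k M).

(** Equal elements of the total space have vectors that are equal up to transport along a
    proof of m = m, and such a proof is unique. *)
Lemma Vec_inj (m : M) (v w : fib E m) : Vec v = Vec w :> E -> v = w.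
Proof.
move=> H.
have : forall y : E, (Vec v : E) = y -> forall e : m = base y,
    eq_rect m (fun m => fib E m) v _ e = vec y.
  by move=> y <- /= e; rewrite (Prop_irrelevance e erefl).
by move=> /(_ _ H erefl).
Qed.

Definition vb_over (b : chart R E (n + k)) (c : chart R M n) : Prop :=
  [/\ smooth_chart c,
      cdom b = [set x : E | cdom c (base x)],
      cimg b = [set z | cimg c (lsubmx z)],
      forall x : E, cdom b x -> lsubmx (b x) = c (base x) &
      forall m, cdom c m ->
          linear (fun v : fib E m => rsubmx (b (Vec v : E)) : 'rV[R]_k)].

Lemma atlas_vb_over (b : chart R E (n + k)) : atlas b -> exists c, vb_over b c.
Proof. by move=> /tot_vb_chart [c [h1 h2 h3 h4 h5]]; exists c; split. Qed.

Definition fibre_coord (b : chart R E (n + k)) (m : M) (v : fib E m) : 'rV[R]_k :=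
  rsubmx (b (Vec v : E)).

(** The inverse of [fibre_coord], which is bijective over the domain of the chart by
    [fibre_coord_inj] and [fibre_coord_surj]. *)
Definition fibre_vec (b : chart R E (n + k)) (m : M) (y : 'rV[R]_k) : fib E m :=
  xget 0 [set v : fib E m | fibre_coord b v = y].

Section InChart.
Variables (b : chart R E (n + k)) (c : chart R M n).
Hypothesis Hb : vb_over b c.

Lemma vb_smooth : smooth_chart c. Proof. by case: Hb. Qed.

Lemma vb_dom m (v : fib E m) : cdom c m -> cdom b (Vec v : E).
Proof. by case: Hb => _ -> _ _ _. Qed.

Lemma vb_domE (x : E) : cdom b x = cdom c (base x).
Proof. by case: Hb => _ -> _ _ _. Qed.

Lemma vb_imgE z : cimg b z = cimg c (lsubmx z).
Proof. by case: Hb => _ _ -> _ _. Qed.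

Lemma vb_img x y : cimg c x -> cimg b (row_mx x y).
Proof. by case: Hb => _ _ -> _ _ /=; rewrite row_mxKl. Qed.

Lemma fibre_coord_linear m : cdom c m -> linear (@fibre_coord b m).
Proof. by case: Hb => _ _ _ _; apply. Qed.

Lemma vb_row m (v : fib E m) : cdom c m -> b (Vec v : E) = row_mx (c m) (fibre_coord b v).
Proof.
move=> cm; rewrite -[LHS]hsubmxK; congr row_mx.
by case: Hb => _ _ _ h _; rewrite h //; exact: vb_dom.
Qed.

Lemma cinv_vb m (v : fib E m) : cdom c m -> cinv b (row_mx (c m) (fibre_coord b v)) = Vec v.
Proof. by move=> cm; rewrite -vb_row // cfunK //; exact: vb_dom. Qed.

Lemma fibre_coord_inj m : cdom c m -> injective (@fibre_coord b m).
Proof.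
by move=> cm v w vw; apply: Vec_inj; rewrite -(cinv_vb v cm) -(cinv_vb w cm) vw.
Qed.

Lemma base_cinv z : cimg b z -> base (cinv b z) = cinv c (lsubmx z).
Proof.
case: Hb => _ db _ lb _ bz; have := lb _ (cinv_dom bz); rewrite (cinvK bz) => ->.
by rewrite cfunK //; have := cinv_dom bz; rewrite db.
Qed.

Lemma fibre_coord_surj m y : cdom c m -> exists v : fib E m, fibre_coord b v = y.
Proof.
move=> cm; have bz : cimg b (row_mx (c m) y) by apply: vb_img; exact: cfun_img.
have := base_cinv bz; rewrite row_mxKl (cfunK cm).
have : rsubmx (b (cinv b (row_mx (c m) y))) = y by rewrite cinvK // row_mxKr.
case: (cinv b _) => m' v /= h mm'; rewrite /= in mm'; subst m'.
by exists v.
Qed.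

Lemma fibre_vecK m y : cdom c m -> fibre_coord b (fibre_vec b m y) = y.
Proof.
move=> cm; rewrite /fibre_vec; case: xgetP => [v _ //|h].
by have [v vy] := fibre_coord_surj y cm; case: (h v).
Qed.

Lemma fibre_coordK m (v : fib E m) : cdom c m -> fibre_vec b m (fibre_coord b v) = v.
Proof. by move=> cm; apply: (fibre_coord_inj cm); rewrite fibre_vecK. Qed.

Lemma fibre_vec_linear m : cdom c m -> linear (fibre_vec b m).
Proof.
by move=> cm a u v; apply: (fibre_coord_inj cm); rewrite fibre_coord_linear // !fibre_vecK.
Qed.

Lemma cinv_fibre_vec m y : cdom c m -> cinv b (row_mx (c m) y) = Vec (fibre_vec b m y).
Proof. by move=> cm; rewrite -[in LHS](fibre_vecK y cm) cinv_vb. Qed.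

Lemma fibre_coordD m (v w : fib E m) : cdom c m -> fibre_coord b (v + w) = fibre_coord b v + fibre_coord b w.
Proof. by move=> cm; have := fibre_coord_linear cm 1 v w; rewrite !scale1r. Qed.

Lemma fibre_coord0 m : cdom c m -> fibre_coord b (0 : fib E m) = 0.
Proof.
move=> cm; apply: (addrI (fibre_coord b (0 : fib E m))).
by rewrite -(fibre_coordD _ _ cm) !addr0.
Qed.

Lemma fibre_coordZ m a (v : fib E m) : cdom c m -> fibre_coord b (a *: v) = a *: fibre_coord b v.
Proof. by move=> cm; have := fibre_coord_linear cm a v 0; rewrite !addr0 fibre_coord0 // addr0. Qed.

End InChart.

Definition section_rep (b : chart R E (n + k)) (c : chart R M n)
    (e : forall m, fib E m) (x : 'rV[R]_n) : 'rV[R]_k := fibre_coord b (e (cinv c x)).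

Section Sections.
Variables (b : chart R E (n + k)) (c : chart R M n).
Hypothesis Hb : vb_over b c.
Hypothesis ab : atlas b.

Lemma near_section_rep (e : forall m, fib E m) m : cdom c m ->
  \forall x \near c m, (b \o to_total e \o cinv c) x = row_mx x (section_rep b c e x).
Proof.
move=> cm; have := near_cinv cm (near_cdom cm); have := near_cimg (cfun_img cm).
by apply: filterS2 => x ix cx; rewrite /= (vb_row Hb _ cx) cinvK.
Qed.

Lemma smooth_section_at (e : forall m, fib E m) m : smooth_section e -> cdom c m ->
  smooth_at (section_rep b c e) (c m).
Proof.
move=> [ce se] cm; have sc := vb_smooth Hb.
have am := chart_at_dom m.
have bm : cdom b (to_total e m) by exact: (vb_dom Hb).
have O : open (cimg (chart_at m) `&` (to_total e \o cinv (chart_at m)) @^-1` cdom b).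
  rewrite openE => x [ax bx]; rewrite /interior; apply: filterI; first exact: near_cimg.
  have nb : \forall q \near cinv (chart_at m) x, cdom b (to_total e q).
    by apply: (ce (cinv (chart_at m) x)); exact: near_cdom.
  have := near_cinv (cinv_dom ax) nb; by rewrite cinvK.
have s1 : smooth_at (b \o to_total e \o cinv (chart_at m)) (chart_at m m).
  apply: ((smooth_onP _ O).1 (se _ _ (chart_at_atlas m) ab)); split.
    exact: cfun_img.
  by rewrite /= cfunK.
have s2 : smooth_at ((b \o to_total e) \o cinv c) (c m).
  exact: (@smooth_at_change _ _ _ _ (b \o to_total e) c (chart_at m) m sc (chart_at_smooth m)).
have s3 := smooth_at_row_linear (@rsubmx R 1 n k : {linear _ -> _}) s2.
apply: eq_smooth_at s3; apply: filterS (near_section_rep e cm) => x /= ->.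
by rewrite row_mxKr.
Qed.

End Sections.

(** In a bundle chart a section reads x |-> (x, coordinates), and the expressions in other
    charts arise from this one by smooth transition maps. *)
Lemma smooth_sectionP (e : forall m, fib E m) :
  (forall m, exists b c, [/\ atlas b, vb_over b c, cdom c m & smooth_at (section_rep b c e) (c m)]) ->
  smooth_section e.
Proof.
move=> h.
have ce : continuous (to_total e).
  move=> m; have [b [c [ab Hb cm sm]]] := h m.
  have nE : \forall q \near m, cinv b (row_mx (c q) (section_rep b c e (c q))) = to_total e q.
    by apply: filterS (near_cdom cm) => q cq; rewrite /section_rep (cfunK cq) (cinv_vb Hb _ cq).
  move=> A Ae; have Ab : \forall z \near row_mx (c m) (section_rep b c e (c m)), A (cinv b z).
    rewrite /section_rep (cfunK cm) -(vb_row Hb _ cm); apply: near_cinv => //.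
    exact: (vb_dom Hb).
  have rc : {for (c m : 'rV[R]_n), continuous (fun x => row_mx x (section_rep b c e x))}.
    apply: smooth_at_cont; apply: smooth_at_row_mx sm.
    exact: (@smooth_at_linear _ _ _ idfun _ (fun y => cvg_id)).
  have := near_cfun cm (rc _ Ab).
  by move: nE; apply: filterS2 => q; rewrite /= => ->.
split=> // c' b' ac' ab'.
apply/smooth_onP.
  rewrite openE => x [ax bx]; rewrite /interior; apply: filterI; first exact: near_cimg.
  have nb : \forall q \near cinv c' x, cdom b' (to_total e q).
    by apply: (ce (cinv c' x)); exact: near_cdom.
  have := near_cinv (cinv_dom ax) nb; by rewrite cinvK.
move=> x [ax bx]; have [b [c [ab Hb cm sm]]] := h (cinv c' x).
have sc := vb_smooth Hb; have c'm := cinv_dom ax.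
have bm : cdom b (to_total e (cinv c' x)) by exact: (vb_dom Hb).
have s1 : smooth_at (b \o to_total e \o cinv c) (c (cinv c' x)).
  apply: (@eq_smooth_at _ _ _ (fun x => row_mx x (section_rep b c e x))).
    by apply: filterS (near_section_rep Hb e cm) => z ->.
  apply: smooth_at_row_mx sm.
  exact: (@smooth_at_linear _ _ _ idfun _ (fun y => cvg_id)).
have tr := smooth_at_transition (atlas_smooth_chart ab) (atlas_smooth_chart ab') bm bx.
have s2 : smooth_at (fun y => (b' \o cinv b) ((b \o to_total e \o cinv c) y)) (c (cinv c' x)).
  apply: (smooth_at_comp (@finite_coords_row R (n + k)) s1).
  by rewrite /= (cfunK cm).
have s3 : smooth_at ((b' \o to_total e) \o cinv c) (c (cinv c' x)).
  apply: eq_smooth_at s2.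
  have nb : \forall q \near cinv c' x, cdom b (to_total e q).
    by apply: (ce (cinv c' x)); exact: near_cdom.
  by have := near_cinv cm nb; apply: filterS => y cby /=; rewrite cfunK.
have := @smooth_at_change _ _ _ _ (b' \o to_total e) c' c _ (atlas_smooth_chart ac') sc c'm cm s3.
by rewrite cinvK.
Qed.

End VB.

(** * Operations on smooth sections *)

Section FormClosure.
Variables (R : realType) (n : nat) (M : manifold R n).
Implicit Types (theta : forall p : M, cotangent p).

Lemma smooth_form_lin (a : R) theta theta' : smooth_form theta -> smooth_form theta' ->
  smooth_form (fun p => a *: theta p + theta' p).
Proof.
move=> s s'; apply/smooth_formP => p; have sa := chart_at_smooth p.
have da := chart_at_dom p.
exists (chart_at p); split=> // w.
have h := smooth_atD (smooth_atZ a (smooth_form_at w s sa da)) (smooth_form_at w s' sa da).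
by apply: eq_smooth_at h; apply: near_all => x; rewrite /fcoord lfunE /= lfunE.
Qed.

Lemma smooth_form_scale (f : M -> R) theta : smooth_fun f -> smooth_form theta ->
  smooth_form (fun p => f p *: theta p).
Proof.
move=> sf s; apply/smooth_formP => p; have sa := chart_at_smooth p.
have da := chart_at_dom p.
exists (chart_at p); split=> // w.
have h := smooth_at_scale (smooth_fun_at sf sa da) (smooth_form_at w s sa da).
by apply: eq_smooth_at h; apply: near_all => x; rewrite /fcoord lfunE.
Qed.

Lemma smooth_form0 : smooth_form (fun p : M => 0 : cotangent p).
Proof.
move=> c ac w; apply/smooth_onP; first exact: open_cimg.
move=> x _; apply: eq_smooth_at (smooth_at_cst 0 x).
by apply: near_all => y; rewrite /fcoord lfunE.
Qed.

Lemma near_fcoord_dfun (f : M -> R) c p w : smooth_fun f -> smooth_chart c -> cdom c p ->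
  \forall x \near c p, fcoord c (dfun f) x w = 'd (f \o cinv c : _ -> R^o) x w.
Proof.
move=> sf sc cp; have := near_cinv cp (near_cdom cp); have := near_cimg (cfun_img cp).
apply: filterS2 => x ix cx; rewrite /fcoord.
have d := smooth_at_diff (smooth_fun_at sf sc cx).
by rewrite (dfunE _ sc cx d) (tvecK sc cx) (cinvK ix).
Qed.

Lemma smooth_form_dfun (f : M -> R) : smooth_fun f -> smooth_form (dfun f).
Proof.
move=> sf; apply/smooth_formP => p; have sa := chart_at_smooth p.
have da := chart_at_dom p.
exists (chart_at p); split=> // w.
have h := smooth_at_diff_app (@finite_coords_row R n) (smooth_fun_at sf sa da)
  (smooth_at_cst w _).
by apply: eq_smooth_at h; apply: filterS (near_fcoord_dfun w sf sa da) => x ->.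
Qed.

End FormClosure.

Section SectionClosure.
Variables (R : realType) (n k : nat) (M : manifold R n) (E : vbundle k M).
Implicit Types (e : forall m, fib E m).

Lemma vb_around (m : M) : exists b c, [/\ atlas b, @vb_over R n k M E b c & cdom c m].
Proof.
pose b := chart_at (Vec (0 : fib E m) : E); have ab : atlas b by exact: chart_at_atlas.
have [c Hb] := atlas_vb_over ab; exists b, c; split=> //.
by have := chart_at_dom (Vec (0 : fib E m) : E); rewrite (vb_domE Hb).
Qed.

Lemma smooth_section_lin (a : R) e e' : smooth_section e -> smooth_section e' ->
  smooth_section (fun p => a *: e p + e' p).
Proof.
move=> s s'; apply: smooth_sectionP => m; have [b [c [ab Hb cm]]] := vb_around m.
exists b, c; split=> //.
have h := smooth_atD (smooth_atZ a (smooth_section_at Hb ab s cm)) (smooth_section_at Hb ab s' cm).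
apply: eq_smooth_at h; have := near_cinv cm (near_cdom cm).
by apply: filterS => x cx; rewrite /section_rep (fibre_coord_linear Hb).
Qed.

Lemma smooth_section_scale (f : M -> R) e : smooth_fun f -> smooth_section e ->
  smooth_section (fun p => f p *: e p).
Proof.
move=> sf s; apply: smooth_sectionP => m; have [b [c [ab Hb cm]]] := vb_around m.
exists b, c; split=> //.
have h := smooth_at_scale (smooth_fun_at sf (vb_smooth Hb) cm) (smooth_section_at Hb ab s cm).
apply: eq_smooth_at h; have := near_cinv cm (near_cdom cm).
by apply: filterS => x cx; rewrite /section_rep (fibre_coordZ Hb).
Qed.

Lemma smooth_section0 : smooth_section (fun m => 0 : fib E m).
Proof.
apply: smooth_sectionP => m; have [b [c [ab Hb cm]]] := vb_around m.
exists b, c; split=> //; apply: eq_smooth_at (smooth_at_cst 0 _).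
have := near_cinv cm (near_cdom cm).
by apply: filterS => x cx; rewrite /section_rep (fibre_coord0 Hb).
Qed.

Lemma smoothB_lin (a : R) (tau tau' : sectionB E) : smoothB tau -> smoothB tau' ->
  smoothB (fun p => a *: tau p + tau' p).
Proof.
move=> [s1 s2] [t1 t2]; split; first exact: smooth_section_lin.
exact: smooth_form_lin.
Qed.

Lemma smoothB_scale (f : M -> R) (tau : sectionB E) : smooth_fun f -> smoothB tau ->
  smoothB (fun p => f p *: tau p).
Proof.
move=> sf [s1 s2]; split; first exact: smooth_section_scale.
exact: smooth_form_scale.
Qed.

Lemma smoothB0 : smoothB (fun m => 0 : (fib E m * cotangent m)%type).
Proof. by split; [exact: smooth_section0|exact: smooth_form0]. Qed.

Lemma smoothB_inl e : smooth_section e -> smoothB (inlB e).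
Proof. by move=> s; split=> //; exact: smooth_form0. Qed.

Lemma smoothB_exact (f : M -> R) : smooth_fun f -> smoothB (exactB E f).
Proof. by move=> s; split; [exact: smooth_section0|exact: smooth_form_dfun]. Qed.

Lemma smoothB_sum (I : Type) (r : seq I) (f : I -> M -> R) (tau : I -> sectionB E) :
  (forall i, smooth_fun (f i)) -> (forall i, smoothB (tau i)) ->
  smoothB (fun p => \sum_(i <- r) f i p *: tau i p).
Proof.
move=> sf st; elim: r => [|i r IH].
  rewrite (_ : (fun p => _) = fun m => 0 : (fib E m * cotangent m)%type).
    exact: smoothB0.
  by apply/functional_extensionality_dep => p; rewrite big_nil.
rewrite (_ : (fun p => _) = fun p => 1 *: (f i p *: tau i p) + \sum_(j <- r) f j p *: tau j p).
  by apply: smoothB_lin => //; exact: smoothB_scale.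
by apply/functional_extensionality_dep => p; rewrite big_cons scale1r.
Qed.

(** Where [chi] is 1 these sections have constant coordinates; elsewhere the junk values of
    [fibre_vec] are multiplied by 0. *)
Definition frame (b : chart R E (n + k)) (chi : M -> R) (y : 'rV[R]_k) (m : M) : fib E m :=
  chi m *: fibre_vec b m y.

Lemma smooth_frame b c chi y : atlas b -> vb_over b c -> cutoff (cdom c) chi ->
  smooth_section (@frame b chi y).
Proof.
move=> ab Hb ch; apply: smooth_sectionP => m; have [cm|ncm] := pselect (cdom c m).
  exists b, c; split=> //.
  have h := smooth_at_scale (smooth_fun_at ch.1 (vb_smooth Hb) cm) (smooth_at_cst y (c m)).
  apply: eq_smooth_at h; have := near_cinv cm (near_cdom cm).
  by apply: filterS => x cx; rewrite /section_rep (fibre_coordZ Hb) // (fibre_vecK Hb).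
have [b' [c' [ab' Hb' cm']]] := vb_around m.
exists b', c'; split=> //; apply: eq_smooth_at (smooth_at_cst 0 _).
have := near_cinv cm' (near_cdom cm'); have := near_cinv cm' (cutoff_near ch ncm).
by apply: filterS2 => x x0 cx; rewrite /section_rep /frame x0 scale0r (fibre_coord0 Hb').
Qed.

End SectionClosure.

(** * Dorfman connections in coordinates *)

Section Dorfman.
Variables (R : realType) (n k : nat) (M : manifold R n) (E : vbundle k M).
Variable Delta : sectionA E -> sectionB E -> sectionB E.
Hypothesis HDelta : dorfman_connection Delta.

Lemma dorfman0 nu m : smoothA nu -> Delta nu (fun _ => 0) m = 0.
Proof.
(* The zero section is 1 *: 0 + 0, so that its image is twice itself. *)
move=> snu; have := dorfman_linearr HDelta 1 m snu (smoothB0 E) (smoothB0 E).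
rewrite (_ : (fun p => _) = (fun _ => 0) :> sectionB E); last first.
  by apply/functional_extensionality_dep => p; rewrite scale1r addr0.
by rewrite scale1r => /(canLR (addrK _)) <-; rewrite subrr.
Qed.

Lemma dorfman_sum nu (I : Type) (r : seq I) (f : I -> M -> R) (tau : I -> sectionB E) m :
  smoothA nu -> (forall i, smooth_fun (f i)) -> (forall i, smoothB (tau i)) ->
  Delta nu (fun p => \sum_(i <- r) f i p *: tau i p) m =
  \sum_(i <- r) (f i m *: Delta nu (tau i) m + anchor_der nu (f i) m *: tau i m).
Proof.
move=> snu sf st; elim: r => [|i r IH].
  rewrite (_ : (fun p => _) = (fun _ => 0) :> sectionB E) ?big_nil ?dorfman0 //.
  by apply/functional_extensionality_dep => p; rewrite big_nil.
rewrite (_ : (fun p => _) = (fun p => 1 *: (f i p *: tau i p) +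
    \sum_(j <- r) f j p *: tau j p) :> sectionB E).
  rewrite (dorfman_linearr HDelta) //; first last.
  - exact: smoothB_sum.
  - exact: smoothB_scale.
  by rewrite big_cons scale1r IH (dorfman_scaler HDelta).
by apply/functional_extensionality_dep => p; rewrite big_cons scale1r.
Qed.

(** A bump function chi at [m] with support where [tau] and [tau'] agree annihilates their
    difference d. At [m], then, 0 = Delta (chi d) = chi Delta d + X(chi) d = Delta d,
    because chi is 1 and d is 0 there. *)
Lemma dorfman_local nu tau tau' m : smoothA nu -> smoothB tau -> smoothB tau' ->
  (\forall q \near m, tau q = tau' q) -> Delta nu tau m = Delta nu tau' m.
Proof.
move=> snu st st' tt'.
pose d : sectionB E := fun p => (-1) *: tau' p + tau p.
have sd : smoothB d by exact: smoothB_lin.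
have [chi chiU chi1] := bump_manifold (chart_at_smooth m) (chart_at_dom m) tt'.
have d0 : (fun p => chi p *: d p) = (fun _ => 0) :> sectionB E.
  apply/functional_extensionality_dep => p.
  have [tp|ntp] := pselect (tau p = tau' p).
    by rewrite /d tp scaleN1r addNr scaler0.
  have [_ [K [_ KU] K0]] := chiU; rewrite K0 ?scale0r // => /KU[_]; exact: ntp.
have := dorfman_scaler HDelta m chiU.1 snu sd.
rewrite d0 dorfman0 // (nbhs_singleton chi1) scale1r {2}/d.
rewrite (nbhs_singleton tt') scaleN1r addNr scaler0 addr0 /d.
rewrite (dorfman_linearr HDelta) // scaleN1r => /esym/eqP.
by rewrite addrC subr_eq0 => /eqP.
Qed.

End Dorfman.

Lemma pair_ext (A B : Type) (u v : A * B) : u.1 = v.1 -> u.2 = v.2 -> u = v.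
Proof. by case: u v => a a' [b b'] /= -> ->. Qed.

Section Anchor.
Variables (R : realType) (n k : nat) (M : manifold R n) (E : vbundle k M).

Lemma near_anchor_der (nu : sectionA E) (f : M -> R) c p :
  smooth_fun f -> smooth_chart c -> cdom c p ->
  \forall x \near c p, (anchor_der nu f \o cinv c) x =
    'd (f \o cinv c : _ -> R^o) x (vcoord c (fun m => (nu m).1) x).
Proof.
move=> sf sc cp; have := near_cinv cp (near_cdom cp); have := near_cimg (cfun_img cp).
apply: filterS2 => x ix cx /=.
have d := smooth_at_diff (smooth_fun_at sf sc cx).
apply: etrans (dfunE (nu (cinv c x)).1 sc cx d) _.
by rewrite (cinvK ix).
Qed.

Lemma smooth_anchor_der (nu : sectionA E) (f : M -> R) :
  smoothA nu -> smooth_fun f -> smooth_fun (anchor_der nu f).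
Proof.
move=> [sX _] sf; apply/smooth_funP => p; have sa := chart_at_smooth p.
have da := chart_at_dom p; exists (chart_at p); split=> //.
have h := smooth_at_diff_app (@finite_coords_row R n) (smooth_fun_at sf sa da)
  (smooth_vfield_at sX sa da).
by apply: eq_smooth_at h; apply: filterS (near_anchor_der nu sf sa da) => x ->.
Qed.

End Anchor.

Section Local.
Variables (R : realType) (n k : nat) (M : manifold R n) (E : vbundle k M).
Variable Delta : sectionA E -> sectionB E -> sectionB E.
Hypothesis HDelta : dorfman_connection Delta.
Variables (b : chart R E (n + k)) (c : chart R M n).
Hypotheses (ab : atlas b) (Hb : vb_over b c).
Variables (chi : M -> R) (p0 : M).
Hypotheses (chiC : cutoff (cdom c) chi) (cp0 : cdom c p0).
Hypothesis chi1 : \forall q \near p0, chi q = 1.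
Implicit Types (nu : sectionA E) (tau : sectionB E) (m : M) (x w : 'rV[R]_n) (y : 'rV[R]_k).

Definition vect_rep nu := vcoord c (fun m => (nu m).1).
Definition fibre_rep tau := section_rep b c (fun m => (tau m).1).
Definition form_rep tau := fcoord c (fun m => (tau m).2).
Definition frameB y : sectionB E := inlB (frame b chi y).
(** [Gamma] and [Lambda] are the Christoffel symbols of [Delta]. As [Delta] is not tensorial
    in its first argument, they depend on the section [nu] and not only on its value. *)
Definition Gamma nu x y : 'rV[R]_k := fibre_rep (Delta nu (frameB y)) x.
Definition Lambda nu x y w : R^o := form_rep (Delta nu (frameB y)) x w.

Let sc : smooth_chart c := vb_smooth Hb.

Lemma smooth_frameB y : smoothB (frameB y).
Proof. exact: (smoothB_inl (smooth_frame y ab Hb chiC)). Qed.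

Lemma smooth_vect_rep nu m : smoothA nu -> cdom c m -> smooth_at (vect_rep nu) (c m).
Proof. by move=> [s _] cm; exact: (smooth_vfield_at s sc cm). Qed.

Lemma smooth_fibre_rep tau m : smoothB tau -> cdom c m -> smooth_at (fibre_rep tau) (c m).
Proof. by move=> [s _] cm; exact: (smooth_section_at Hb ab s cm). Qed.

Lemma smooth_form_rep tau m w : smoothB tau -> cdom c m -> smooth_at (form_rep tau ^~ w) (c m).
Proof. by move=> [_ s] cm; exact: (smooth_form_at w s sc cm). Qed.

Lemma smooth_Gamma nu m y : smoothA nu -> cdom c m -> smooth_at (Gamma nu ^~ y) (c m).
Proof.
by move=> snu cm; exact: (smooth_fibre_rep (dorfman_smooth HDelta snu (smooth_frameB y)) cm).
Qed.

Lemma smooth_Lambda nu m y w : smoothA nu -> cdom c m -> smooth_at (fun x => Lambda nu x y w) (c m).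
Proof.
by move=> snu cm; exact: (smooth_form_rep w (dorfman_smooth HDelta snu (smooth_frameB y)) cm).
Qed.

Lemma frameB_lin a y y' : frameB (a *: y + y') = (fun p => a *: frameB y p + frameB y' p).
Proof.
apply/functional_extensionality_dep => p; rewrite /frameB /inlB.
have -> : frame b chi (a *: y + y') p = a *: frame b chi y p + frame b chi y' p.
  rewrite /frame; have [cp|ncp] := pselect (cdom c p).
    by rewrite (fibre_vec_linear Hb) // scalerDr !scalerA mulrC.
  have [_ [K [_ KU] K0]] := chiC; rewrite K0 => [|/KU//].
  by rewrite !scale0r scaler0 addr0.
rewrite -[RHS]/(a *: frame b chi y p + frame b chi y' p, a *: 0 + 0).
by rewrite scaler0 addr0.
Qed.

Lemma Delta_frameB_lin nu m a y y' : smoothA nu ->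
  Delta nu (frameB (a *: y + y')) m = a *: Delta nu (frameB y) m + Delta nu (frameB y') m.
Proof. by move=> s; rewrite frameB_lin; exact: (dorfman_linearr HDelta a m s (smooth_frameB y) (smooth_frameB y')). Qed.

Lemma Gamma_lin nu m : smoothA nu -> cdom c m -> linear (Gamma nu (c m)).
Proof.
move=> s cm a y y'; rewrite /Gamma /fibre_rep /section_rep Delta_frameB_lin //= (fibre_coord_linear Hb) //.
by rewrite cfunK.
Qed.

Lemma Lambda_lin nu x w : smoothA nu -> linear (Lambda nu x ^~ w).
Proof. by move=> s a y y'; rewrite /Lambda /form_rep /fcoord Delta_frameB_lin //= !lfunE /= lfunE. Qed.

Lemma Lambda_linr nu x y : linear (Lambda nu x y).
Proof. exact: fcoord_linear. Qed.

Lemma form_rep_lin tau x : linear (form_rep tau x).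
Proof. exact: fcoord_linear. Qed.

(** Where [chi] is 1 the differential of such a function has constant components, so that
    these differentials play the part of the forms d x_a. *)
Definition chart_fun (a : 'I_n) (m : M) : R := chi m * c m ord0 a.

Lemma smooth_chart_fun a : smooth_fun (chart_fun a).
Proof.
apply: (cutoff_mul sc chiC) => q cq.
apply: (@eq_smooth_at _ _ _ (@coord_lin R n a)).
  by apply: filterS (near_cimg (cfun_img cq)) => x cx; rewrite /= cinvK.
by apply: smooth_at_linear; exact: coord_lin_continuous.
Qed.

Lemma near_chart m (P : M -> Prop) : cdom c m -> (\forall q \near m, P q) ->
  \forall x \near c m, cimg c x /\ cdom c (cinv c x) /\ P (cinv c x).
Proof.
move=> cm Pm; have N1 := near_cinv cm Pm; have N2 := near_cinv cm (near_cdom cm).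
by have N3 := near_cimg (cfun_img cm); move: N3 N2 N1; apply: filterS3.
Qed.

Lemma dfun_chart_fun a m : cdom c m -> (\forall q \near m, chi q = 1) ->
  forall v, dfun (chart_fun a) m v = tcoord c v ord0 a.
Proof.
move=> cm h v.
have N : \forall x \near c m, @coord_lin R n a x = (chart_fun a \o cinv c) x.
  have := near_chart cm h; apply: filterS => x [ix [cx hx]].
  by rewrite /= /chart_fun hx mul1r cinvK.
have D := smooth_at_diff (smooth_fun_at (smooth_chart_fun a) sc cm).
have cc : continuous (@coord_lin R n a) by exact: coord_lin_continuous.
have d := linear_differentiable (c m) cc.
rewrite (dfunE v sc cm D).
apply: etrans (congr1 (@^~ (tcoord c v)) (near_diff N d)) _.
by rewrite (congr1 (@^~ (tcoord c v)) (diff_lin _ cc)).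
Qed.

Definition fibre_comp tau (j : 'I_k) m : R := chi m * fibre_rep tau (c m) ord0 j.
Definition form_comp tau (a : 'I_n) m : R := chi m * form_rep tau (c m) (delta_mx ord0 a).

Lemma smooth_fibre_comp tau j : smoothB tau -> smooth_fun (fibre_comp tau j).
Proof.
move=> st; apply: (cutoff_mul sc chiC) => q cq.
apply: eq_smooth_at ((smooth_at_rowP _ _).1 (smooth_fibre_rep st cq) j).
by apply: filterS (near_cimg (cfun_img cq)) => x cx; rewrite /= cinvK.
Qed.

Lemma smooth_form_comp tau a : smoothB tau -> smooth_fun (form_comp tau a).
Proof.
move=> st; apply: (cutoff_mul sc chiC) => q cq.
apply: eq_smooth_at (smooth_form_rep (delta_mx ord0 a) st cq).
by apply: filterS (near_cimg (cfun_img cq)) => x cx; rewrite /= cinvK.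
Qed.

Definition frame_sum tau : sectionB E :=
  fun p => \sum_(j <- index_enum 'I_k) fibre_comp tau j p *: frameB (delta_mx ord0 j) p.
Definition coframe_sum tau : sectionB E :=
  fun p => \sum_(a <- index_enum 'I_n) form_comp tau a p *: exactB E (chart_fun a) p.

Lemma sum_fst I (r : seq I) m (F : I -> (fib E m * cotangent m)%type) :
  (\sum_(i <- r) F i).1 = \sum_(i <- r) (F i).1.
Proof. by elim: r => [|i r IH]; rewrite ?big_nil ?big_cons //= IH. Qed.

Lemma sum_snd I (r : seq I) m (F : I -> (fib E m * cotangent m)%type) :
  (\sum_(i <- r) F i).2 = \sum_(i <- r) (F i).2.
Proof. by elim: r => [|i r IH]; rewrite ?big_nil ?big_cons //= IH. Qed.

Lemma frame_decomp tau m : cdom c m -> (\forall q \near m, chi q = 1) ->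
  tau m = 1 *: frame_sum tau m + coframe_sum tau m.
Proof.
move=> cm h; have h1 := nbhs_singleton h; rewrite scale1r.
apply: pair_ext.
- rewrite -[RHS]/((frame_sum tau m).1 + (coframe_sum tau m).1) /frame_sum /coframe_sum !sum_fst.
  rewrite [X in _ + X]big1 ?addr0 => [|a _]; last by rewrite /= scaler0.
  rewrite -[LHS](fibre_coordK Hb _ cm) (linear_row_sum _ (fibre_vec_linear Hb cm)).
  apply: eq_bigr => j _; rewrite /= /frame h1 scale1r; congr (_ *: _).
  by rewrite /fibre_comp h1 mul1r /fibre_rep /section_rep (cfunK cm).
- rewrite -[RHS]/((frame_sum tau m).2 + (coframe_sum tau m).2) /frame_sum /coframe_sum !sum_snd.
  rewrite [X in X + _]big1 ?add0r => [|a _]; last by rewrite /= scaler0.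
  apply/lfunP => v; rewrite sum_lfunE -(fcoordE (fun m => (tau m).2) v sc cm).
  rewrite (linear_row_sum _ (fcoord_linear c (fun m => (tau m).2) (c m))).
  apply: eq_bigr => a _; rewrite /= lfunE /= (dfun_chart_fun a cm h) /form_comp h1 mul1r.
  by rewrite /GRing.scale /= mulrC.
Qed.

Lemma smooth_frame_sum tau : smoothB tau -> smoothB (frame_sum tau).
Proof.
by move=> st; apply: smoothB_sum => j; [exact: smooth_fibre_comp|exact: smooth_frameB].
Qed.

Lemma smooth_coframe_sum tau : smoothB tau -> smoothB (coframe_sum tau).
Proof.
move=> st; apply: smoothB_sum => a; first exact: smooth_form_comp.
exact/smoothB_exact/smooth_chart_fun.
Qed.

Lemma anchor_derE nu (f : M -> R) m : smooth_fun f -> cdom c m ->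
  anchor_der nu f m = 'd (f \o cinv c : _ -> R^o) (c m) (vect_rep nu (c m)).
Proof.
move=> sf cm; rewrite /anchor_der /vect_rep (vcoordE _ cm).
exact: (dfunE _ sc cm (smooth_at_diff (smooth_fun_at sf sc cm))).
Qed.

(** By locality [tau] may be replaced by its expansion on the frame; the Leibniz rule applies
    to the coefficients, and the axiom on exact forms to the d x_a. *)
Lemma Delta_decomp nu tau m : smoothA nu -> smoothB tau ->
  cdom c m -> (\forall q \near m, chi q = 1) ->
  Delta nu tau m =
    \sum_j (fibre_comp tau j m *: Delta nu (frameB (delta_mx ord0 j)) m
             + anchor_der nu (fibre_comp tau j) m *: frameB (delta_mx ord0 j) m)
    + \sum_a (form_comp tau a m *: exactB E (anchor_der nu (chart_fun a)) m
             + anchor_der nu (form_comp tau a) m *: exactB E (chart_fun a) m).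
Proof.
move=> snu st cm h.
have hh : \forall q \near m, tau q = 1 *: frame_sum tau q + coframe_sum tau q.
  have := near_join h; have := near_cdom cm; apply: filterS2 => q cq hq.
  exact: frame_decomp.
have se := smooth_frame_sum st; have sts := smooth_coframe_sum st.
rewrite (dorfman_local HDelta snu st (smoothB_lin 1 se sts) hh).
rewrite (dorfman_linearr HDelta 1 m snu se sts) scale1r; congr (_ + _).
  rewrite (dorfman_sum HDelta _ m snu) => [//|j|j]; [exact: smooth_fibre_comp|exact: smooth_frameB].
rewrite (dorfman_sum HDelta _ m snu) => [|j|j]; last first.
- exact/smoothB_exact/smooth_chart_fun.
- exact: smooth_form_comp.
apply: eq_bigr => a _; rewrite (dorfman_exact HDelta m (smooth_chart_fun a) snu).
by [].
Qed.

(** Applied to the coefficients, the Leibniz rule yields the derivative of e along X and the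
    part d theta (X) of the Lie derivative of theta. Its other part theta (d X) comes from
    Delta_nu (0, d x_a) = (0, d X_a), and the constant sections contribute the
    Christoffel symbols. *)
Lemma local_formula nu tau m : smoothA nu -> smoothB tau ->
  cdom c m -> (\forall q \near m, chi q = 1) ->
  fibre_rep (Delta nu tau) (c m) =
    'd (fibre_rep tau) (c m) (vect_rep nu (c m)) + Gamma nu (c m) (fibre_rep tau (c m)) /\
  forall w, form_rep (Delta nu tau) (c m) w =
    Lambda nu (c m) (fibre_rep tau (c m)) w + 'd (form_rep tau ^~ w) (c m) (vect_rep nu (c m))
    + form_rep tau (c m) ('d (vect_rep nu) (c m) w).
Proof.
move=> snu st cm h; have h1 := nbhs_singleton h.
have D := Delta_decomp snu st cm h.
have De := smooth_at_diff (smooth_fibre_rep st cm).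
have Xe j : anchor_der nu (fibre_comp tau j) m = 'd (fibre_rep tau) (c m) (vect_rep nu (c m)) ord0 j.
  rewrite (anchor_derE nu (smooth_fibre_comp j st) cm).
  have N : \forall x \near c m, fibre_rep tau x ord0 j = (fibre_comp tau j \o cinv c) x.
    have := near_chart cm h; apply: filterS => x [ix [cx hx]].
    by rewrite /= /fibre_comp hx mul1r cinvK.
  have [_ E1] := near_is_diff N (is_diff_coord j De).
  exact: (congr1 (@^~ _) E1).
have Xt a : anchor_der nu (form_comp tau a) m =
    'd (form_rep tau ^~ (delta_mx ord0 a)) (c m) (vect_rep nu (c m)).
  rewrite (anchor_derE nu (smooth_form_comp a st) cm).
  have N : \forall x \near c m, form_rep tau x (delta_mx ord0 a) = (form_comp tau a \o cinv c) x.
    have := near_chart cm h; apply: filterS => x [ix [cx hx]].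
    by rewrite /= /form_comp hx mul1r cinvK.
  have Dt := smooth_at_diff (smooth_form_rep (delta_mx ord0 a) st cm).
  exact: (congr1 (@^~ _) (near_diff N Dt)).
split=> [|w].
- pose FLM := GRing.isLinear.Build _ _ _ _ _ (fibre_coord_linear Hb cm).
  pose FL : {linear fib E m -> 'rV[R]_k} := HB.pack (@fibre_coord _ _ _ _ _ b m) FLM.
  have L0 : fibre_rep (Delta nu tau) (c m) = fibre_coord b (Delta nu tau m).1.
    by rewrite /fibre_rep /section_rep (cfunK cm).
  rewrite L0 D -[(_ + _).1]/(_.1 + _.1) !sum_fst.
  rewrite [X in _ + X]big1 ?addr0 => [|a _]; last by rewrite /= !scaler0 addr0.
  rewrite -[fibre_coord b _]/(FL _) linear_sum.
  rewrite (row_coords ('d _ _ _)) (linear_row_sum _ (Gamma_lin snu cm)) -big_split /=.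
  apply: eq_bigr => j _; rewrite Xe /FL /= (fibre_coordD Hb _ _ cm) !(fibre_coordZ Hb _ _ cm).
  rewrite addrC /frame h1 scale1r (fibre_vecK Hb) //; congr (_ *: _ + _ *: _).
    by rewrite /fibre_comp h1 mul1r /fibre_rep /section_rep cfunK.
  by rewrite /Gamma /fibre_rep /section_rep cfunK.
- have L1 : form_rep (Delta nu tau) (c m) w = (Delta nu tau m).2 (tvec c m w).
    by rewrite /form_rep (fcoord_at _ _ cm).
  rewrite L1 D -[(_ + _).2]/(_.2 + _.2) !sum_snd.
  rewrite add_lfunE !sum_lfunE -addrA; congr (_ + _).
    rewrite (linear_row_sum _ (Lambda_lin (c m) w snu)); apply: eq_bigr => j _.
    rewrite -[(_ + _).2]/(_ *: (Delta nu (frameB (delta_mx ord0 j)) m).2 + _ *: 0) scaler0 addr0.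
    rewrite scale_lfunE /fibre_comp h1 mul1r [in RHS]/Lambda /form_rep.
    by rewrite [in RHS](fcoord_at _ _ cm).
  have tl : linear (fun w => 'd (form_rep tau ^~ w) (c m) (vect_rep nu (c m))).
    move=> a u v.
    have Du := smooth_at_diff (smooth_form_rep u st cm).
    have Dv := smooth_at_diff (smooth_form_rep v st cm).
    have H := is_diffD (is_diffZ a (differentiableP Du)) (differentiableP Dv).
    have N : \forall x \near c m, (a *: (form_rep tau ^~ u) + (form_rep tau ^~ v)) x = form_rep tau x (a *: u + v).
      by apply: near_all => x; rewrite form_rep_lin.
    have [_ E1] := near_is_diff N H.
    exact: (congr1 (@^~ _) E1).
  rewrite (linear_row_sum w tl) (linear_row_sum _ (form_rep_lin tau (c m))) -big_split.
  apply: eq_bigr => a _.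
  rewrite -[(_ + _).2]/(form_comp tau a m *: dfun (anchor_der nu (chart_fun a)) m
    + anchor_der nu (form_comp tau a) m *: dfun (chart_fun a) m).
  rewrite add_lfunE.
  apply: etrans (congr2 (fun u v => u + v) (scale_lfunE _ _ _) (scale_lfunE _ _ _)) _.
  rewrite [X in _ + _ *: X = _](dfun_chart_fun a cm h).
  rewrite (tvecK sc cm w) [X in _ + X *: _ = _]Xt.
  have -> : form_comp tau a m = form_rep tau (c m) (delta_mx ord0 a).
    by rewrite /form_comp h1 mul1r.
  have sco := smooth_anchor_der snu (smooth_chart_fun a).
  rewrite [X in _ *: X + _ = _](dfunE _ sc cm (smooth_at_diff (smooth_fun_at sco sc cm))).
  rewrite (tvecK sc cm w).
  have N : \forall x \near c m, vect_rep nu x ord0 a = (anchor_der nu (chart_fun a) \o cinv c) x.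
    have := near_chart cm (near_join h); apply: filterS => x [ix [cx hx]].
    by rewrite /= /anchor_der (dfun_chart_fun a cx hx).
  have [_ E1] := near_is_diff N (is_diff_coord a (smooth_at_diff (smooth_vect_rep snu cm))).
  have E2 := congr1 (@^~ w) E1; rewrite /= in E2.
  rewrite [X in _ *: X + _ = _]E2.
  move: (form_rep _ _ _ : R) ('d (form_rep _ ^~ _) _ _ : R) ('d (vect_rep _) _ _) => z z' u.
  by rewrite /GRing.scale /= addrC [z * _]mulrC [z' * _]mulrC.
Qed.

End Local.

(** * The dual bracket *)

Lemma diff_param_lin (R : realType) (V W : normedModType R) (N : nat)
    (F : V -> 'rV[R]_N -> W) (x v : V) :
  (\forall y \near x, linear (F y)) -> (forall u, differentiable (F ^~ u) x) ->
  linear (fun u => 'd (F ^~ u) x v).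
Proof.
move=> Fl Fd a u w.
have H := is_diffD (is_diffZ a (differentiableP (Fd u))) (differentiableP (Fd w)).
have N0 : \forall y \near x, (a *: (F ^~ u) + (F ^~ w)) y = F y (a *: u + w).
  by apply: filterS Fl => y ->.
have [_ E1] := near_is_diff N0 H.
exact: (congr1 (@^~ v) E1).
Qed.

Section Dual.
Variables (R : realType) (n k : nat) (M : manifold R n) (E : vbundle k M).
Implicit Types (nu : sectionA E) (tau : sectionB E) (m : M) (x w : 'rV[R]_n) (y : 'rV[R]_k).

(** The components of the dual part are encoded by the function l_eps in the bundle chart:
    both [smooth_dual_section] and [ell] are about this function. *)
Definition dual_rep (b : chart R E (n + k)) nu x y : R^o :=
  ell (fun m => (nu m).2) (cinv b (row_mx x y) : E).

Section Chart.
Variables (b : chart R E (n + k)) (c : chart R M n).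
Hypotheses (ab : atlas b) (Hb : vb_over b c).
Let sc : smooth_chart c := vb_smooth Hb.

Lemma dual_repE nu m y : cdom c m -> dual_rep b nu (c m) y = (nu m).2 (fibre_vec b m y).
Proof. by move=> cm; rewrite /dual_rep (cinv_fibre_vec Hb y cm). Qed.

Lemma dual_rep_lin nu m : cdom c m -> linear (dual_rep b nu (c m)).
Proof. by move=> cm a y y'; rewrite !dual_repE // (fibre_vec_linear Hb cm) linearP. Qed.

Lemma near_dual_rep_lin nu m : cdom c m -> \forall x \near c m, linear (dual_rep b nu x).
Proof.
move=> cm; have := near_cinv cm (near_cdom cm); have := near_cimg (cfun_img cm).
by apply: filterS2 => x ix cx; rewrite -(cinvK ix); exact: dual_rep_lin.
Qed.

Lemma smooth_dual_rep nu m y : smoothA nu -> cdom c m -> smooth_at (dual_rep b nu ^~ y) (c m).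
Proof.
move=> [_ s] cm; have := s b ab y.
have O : open [set x | cimg b (row_mx x y)].
  rewrite (_ : [set x | _] = cimg c); first exact: open_cimg.
  by apply/funext => x /=; rewrite (vb_imgE Hb) row_mxKl.
move=> /(smooth_onP _ O); apply.
by rewrite /= (vb_imgE Hb) row_mxKl; exact: cfun_img.
Qed.

Lemma pairingE nu tau m : cdom c m ->
  pairing (nu m) (tau m) = dual_rep b nu (c m) (fibre_rep b c tau (c m)) + form_rep c tau (c m) (vect_rep c nu (c m)).
Proof.
move=> cm; rewrite (dual_repE _ _ cm) /fibre_rep /section_rep /form_rep /vect_rep (vcoordE _ cm).
by rewrite (fcoordE (fun m => (tau m).2) _ sc cm) (cfunK cm) (fibre_coordK Hb _ cm).
Qed.

Lemma near_pairing nu tau m : cdom c m -> \forall x \near c m,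
  dual_rep b nu x (fibre_rep b c tau x) + form_rep c tau x (vect_rep c nu x) =
  ((fun p => pairing (nu p) (tau p)) \o cinv c) x.
Proof.
move=> cm; have := near_cinv cm (near_cdom cm); have := near_cimg (cfun_img cm).
by apply: filterS2 => x ix cx; rewrite /= pairingE // cinvK.
Qed.

Lemma smooth_at_pairing nu tau m : smoothA nu -> smoothB tau -> cdom c m ->
  smooth_at ((fun p => pairing (nu p) (tau p) : R^o) \o cinv c) (c m).
Proof.
move=> sn st cm; apply: eq_smooth_at (near_pairing nu tau cm) _.
apply: smooth_atD.
  apply: (smooth_at_linfam (near_dual_rep_lin nu cm)); last exact: (smooth_fibre_rep ab Hb st cm).
  by move=> u; exact: (smooth_dual_rep u sn cm).
have FL : \forall x \near c m, linear (form_rep c tau x).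
  by apply: near_all => x; exact: form_rep_lin.
apply: (smooth_at_linfam FL); last exact: (smooth_vect_rep Hb sn cm).
by move=> u; exact: (smooth_form_rep Hb u st cm).
Qed.

Lemma diff_pairing nu tau m v : smoothA nu -> smoothB tau -> cdom c m ->
  'd ((fun p => pairing (nu p) (tau p) : R^o) \o cinv c) (c m) v =
  'd (dual_rep b nu ^~ (fibre_rep b c tau (c m))) (c m) v + dual_rep b nu (c m) ('d (fibre_rep b c tau) (c m) v)
  + ('d (form_rep c tau ^~ (vect_rep c nu (c m))) (c m) v + form_rep c tau (c m) ('d (vect_rep c nu) (c m) v)).
Proof.
move=> sn st cm.
have FL : \forall x \near c m, linear (form_rep c tau x).
  by apply: near_all => x; exact: form_rep_lin.
have H1 := diff_linfam (near_dual_rep_lin nu cm) (fun u => smooth_at_diff (smooth_dual_rep u sn cm))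
  (smooth_at_diff (smooth_fibre_rep ab Hb st cm)).
have H2 := diff_linfam FL (fun u => smooth_at_diff (smooth_form_rep Hb u st cm))
  (smooth_at_diff (smooth_vect_rep Hb sn cm)).
have [_ E1] := near_is_diff (near_pairing nu tau cm) (is_diffD H1 H2).
exact: (congr1 (@^~ v) E1).
Qed.

End Chart.

Lemma smooth_pairing nu tau : smoothA nu -> smoothB tau ->
  smooth_fun (fun p => pairing (nu p) (tau p)).
Proof.
move=> sn st; apply/smooth_funP => m; have [b [c [ab Hb cm]]] := vb_around E m.
by exists c; split=> //; [exact: vb_smooth Hb|exact: (smooth_at_pairing ab Hb sn st cm)].
Qed.

End Dual.

Section Bracket.
Variables (R : realType) (n k : nat) (M : manifold R n) (E : vbundle k M).
Variable Delta : sectionA E -> sectionB E -> sectionB E.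
Hypothesis HDelta : dorfman_connection Delta.
Implicit Types (nu : sectionA E) (tau : sectionB E) (m : M) (x w : 'rV[R]_n) (y : 'rV[R]_k).

Section Chart.
Variables (b : chart R E (n + k)) (c : chart R M n).
Hypotheses (ab : atlas b) (Hb : vb_over b c).
Variables (chi : M -> R).
Hypotheses (chiC : cutoff (cdom c) chi).
Let sc : smooth_chart c := vb_smooth Hb.

Local Notation Xr := (vect_rep c).
Local Notation er := (fibre_rep b c).
Local Notation tr := (form_rep c).
Local Notation ar := (dual_rep b).
Local Notation Ga := (Gamma Delta b c chi).
Local Notation La := (Lambda Delta b c chi).

Definition bracket_vect nu1 nu2 x : 'rV[R]_n := 'd (Xr nu2) x (Xr nu1 x) - 'd (Xr nu1) x (Xr nu2 x).
Definition bracket_dual nu1 nu2 x y : R^o :=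
  'd (ar nu2 ^~ y) x (Xr nu1 x) - ar nu2 x (Ga nu1 x y) - La nu1 x y (Xr nu2 x).

(** In the formula defining the dual bracket the derivatives of the components of [tau] cancel
    against those in [local_formula]. The right-hand side depends only on the value of
    [tau], which is why the bracket exists. *)
Lemma bracket_rhs nu1 nu2 tau m : smoothA nu1 -> smoothA nu2 -> smoothB tau ->
  cdom c m -> (\forall q \near m, chi q = 1) ->
  anchor_der nu1 (fun p => pairing (nu2 p) (tau p)) m - pairing (nu2 m) (Delta nu1 tau m)
  = bracket_dual nu1 nu2 (c m) (er tau (c m)) + tr tau (c m) (bracket_vect nu1 nu2 (c m)).
Proof.
move=> s1 s2 st cm h.
have [F1 F2] := local_formula HDelta ab Hb chiC s1 st cm h.
have aD u v : ar nu2 (c m) (u + v) = ar nu2 (c m) u + ar nu2 (c m) v.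
  by have := dual_rep_lin Hb nu2 cm 1 u v; rewrite !scale1r.
have tD u v : tr tau (c m) (u - v) = tr tau (c m) u - tr tau (c m) v.
  have := form_rep_lin c tau (c m) (-1) v u; rewrite scaleN1r [- v + u]addrC => ->.
  by rewrite scaleN1r addrC.
rewrite (anchor_derE Hb nu1 (smooth_pairing s2 st) cm) (diff_pairing ab Hb _ s2 st cm).
rewrite (pairingE Hb nu2 _ cm) F1 F2 aD /bracket_dual /bracket_vect tD.
have H (B1 B2 B3 B4 B5 B6 B7 : R) : B1 + B2 + (B3 + B4) - (B2 + B5 + (B6 + B3 + B7))
  = B1 - B5 - B6 + (B4 - B7) by ring.
exact: H.
Qed.

Lemma bracket_dual_lin nu1 nu2 m : smoothA nu1 -> smoothA nu2 -> cdom c m ->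
  linear (bracket_dual nu1 nu2 (c m)).
Proof.
move=> s1 s2 cm a u v; rewrite /bracket_dual.
rewrite (diff_param_lin (Xr nu1 (c m)) (near_dual_rep_lin Hb nu2 cm)
  (fun u => smooth_at_diff (smooth_dual_rep ab Hb u s2 cm)) a u v).
rewrite (Gamma_lin HDelta ab Hb chiC s1 cm a u v) (dual_rep_lin Hb nu2 cm a).
rewrite (Lambda_lin HDelta ab Hb chiC (c m) (Xr nu2 (c m)) s1 a u v).
have H (B1 B2 B3 B4 B5 B6 r : R) : r * B1 + B3 - (r * B2 + B4) - (r * B5 + B6) =
  r * (B1 - B2 - B5) + (B3 - B4 - B6) by ring.
exact: H.
Qed.

Lemma bracket_exists nu1 nu2 m : smoothA nu1 -> smoothA nu2 ->
  cdom c m -> (\forall q \near m, chi q = 1) ->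
  exists B : (tangent m * dual (fib E m))%type, forall tau, smoothB tau ->
    pairing B (tau m) = anchor_der nu1 (fun p => pairing (nu2 p) (tau p)) m
      - pairing (nu2 m) (Delta nu1 tau m).
Proof.
move=> s1 s2 cm h.
have L : linear (fun v : fib E m => bracket_dual nu1 nu2 (c m) (fibre_coord b v) : R^o).
  by move=> a u v; rewrite (fibre_coord_linear Hb cm) (bracket_dual_lin s1 s2 cm).
pose FLM := GRing.isLinear.Build _ _ _ _ _ L.
pose FL : {linear fib E m -> R^o} :=
  HB.pack (fun v : fib E m => bracket_dual nu1 nu2 (c m) (fibre_coord b v) : R^o) FLM.
exists (tvec c m (bracket_vect nu1 nu2 (c m)), linfun FL) => tau st.
rewrite (bracket_rhs s1 s2 st cm h).
rewrite -[LHS]/(linfun FL (tau m).1 + (tau m).2 (tvec c m (bracket_vect nu1 nu2 (c m)))).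
rewrite (lfunE FL) /form_rep (fcoord_at _ _ cm); congr (_ + _).
by rewrite /FL /= /fibre_rep /section_rep (cfunK cm).
Qed.

End Chart.

Lemma dual_bracketP nu1 nu2 tau m : smoothA nu1 -> smoothA nu2 -> smoothB tau ->
  pairing (dual_bracket Delta nu1 nu2 m) (tau m) =
  anchor_der nu1 (fun p => pairing (nu2 p) (tau p)) m
      - pairing (nu2 m) (Delta nu1 tau m).
Proof.
move=> s1 s2 st; have [b [c [ab Hb cm]]] := vb_around E m.
have [chi chiU chi1] := bump_manifold (vb_smooth Hb) cm (near_cdom cm).
rewrite setIid in chiU.
have [B HB] := bracket_exists ab Hb chiU s1 s2 cm chi1.
rewrite /dual_bracket; case: xgetP => [B' _ HB'|h]; first exact: HB'.
by case: (h B).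
Qed.

Section Chart2.
Variables (b : chart R E (n + k)) (c : chart R M n).
Hypotheses (ab : atlas b) (Hb : vb_over b c).
Variables (chi : M -> R).
Hypotheses (chiC : cutoff (cdom c) chi).
Let sc : smooth_chart c := vb_smooth Hb.

Lemma fibre_rep_frameB y m : cdom c m -> chi m = 1 -> fibre_rep b c (frameB b chi y) (c m) = y.
Proof. by move=> cm h; rewrite /fibre_rep /section_rep (cfunK cm) /= /frame h scale1r (fibre_vecK Hb). Qed.

Lemma form_rep_frameB y x w : form_rep c (frameB b chi y) x w = 0.
Proof. by rewrite /form_rep /fcoord /= zero_lfunE. Qed.

Lemma dual_rep_bracket nu1 nu2 m y : smoothA nu1 -> smoothA nu2 ->
  cdom c m -> (\forall q \near m, chi q = 1) ->
  dual_rep b (dual_bracket Delta nu1 nu2) (c m) y = bracket_dual b c chi nu1 nu2 (c m) y.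
Proof.
move=> s1 s2 cm h; have h1 := nbhs_singleton h.
have sf := smooth_frameB ab Hb chiC y.
have := dual_bracketP m s1 s2 sf; rewrite (bracket_rhs ab Hb chiC s1 s2 sf cm h).
by rewrite (pairingE Hb _ _ cm) !form_rep_frameB !addr0 !fibre_rep_frameB.
Qed.

(** Pairing with (0, d x_a) reads off the a-th component; the vector part is the Lie bracket of
    the vector parts. *)
Lemma vect_rep_bracket nu1 nu2 m : smoothA nu1 -> smoothA nu2 ->
  cdom c m -> (\forall q \near m, chi q = 1) ->
  vect_rep c (dual_bracket Delta nu1 nu2) (c m) = bracket_vect c nu1 nu2 (c m).
Proof.
move=> s1 s2 cm h; have h1 := nbhs_singleton h.
apply/rowP => a.
have sf := smoothB_exact E (smooth_chart_fun Hb chiC a).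
have := dual_bracketP m s1 s2 sf; rewrite (bracket_rhs ab Hb chiC s1 s2 sf cm h).
have T w : form_rep c (exactB E (chart_fun c chi a)) (c m) w = w ord0 a.
  by rewrite /form_rep (fcoord_at _ _ cm) /= (dfun_chart_fun Hb chiC a cm h) (tvecK sc cm).
have E0 : fibre_rep b c (exactB E (chart_fun c chi a)) (c m) = 0.
  by rewrite /fibre_rep /section_rep (cfunK cm) /= (fibre_coord0 Hb cm).
rewrite (pairingE Hb _ _ cm) !T E0.
have -> : dual_rep b (dual_bracket Delta nu1 nu2) (c m) 0 = 0.
  have := dual_rep_lin Hb (dual_bracket Delta nu1 nu2) cm 1 0 0.
  by rewrite !scale1r addr0 => /(canLR (addrK _)) <-; rewrite subrr.
have -> : bracket_dual b c chi nu1 nu2 (c m) 0 = 0.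
  have := bracket_dual_lin ab Hb chiC s1 s2 cm 1 0 0.
  by rewrite !scale1r addr0 => /(canLR (addrK _)) <-; rewrite subrr.
by rewrite !add0r.
Qed.

Lemma near_bracket nu1 nu2 m : smoothA nu1 -> smoothA nu2 ->
  cdom c m -> (\forall q \near m, chi q = 1) -> \forall x \near c m,
  bracket_vect c nu1 nu2 x = vect_rep c (dual_bracket Delta nu1 nu2) x /\
  forall y, bracket_dual b c chi nu1 nu2 x y = dual_rep b (dual_bracket Delta nu1 nu2) x y.
Proof.
move=> s1 s2 cm h; have := near_chart cm (near_join h).
apply: filterS => x [ix [cx hx]].
split=> [|y].
  by have := vect_rep_bracket s1 s2 cx hx; rewrite (cinvK ix) => ->.
by have := dual_rep_bracket y s1 s2 cx hx; rewrite (cinvK ix) => ->.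
Qed.

Lemma smooth_bracket_vect nu1 nu2 m : smoothA nu1 -> smoothA nu2 -> cdom c m ->
  smooth_at (bracket_vect c nu1 nu2) (c m).
Proof.
move=> s1 s2 cm; have X1 := smooth_vect_rep Hb s1 cm; have X2 := smooth_vect_rep Hb s2 cm.
have fc := @finite_coords_row R n.
exact: (smooth_atB (smooth_at_diff_app fc X2 X1) (smooth_at_diff_app fc X1 X2)).
Qed.

Lemma smooth_bracket_dual nu1 nu2 m y : smoothA nu1 -> smoothA nu2 -> cdom c m ->
  smooth_at (bracket_dual b c chi nu1 nu2 ^~ y) (c m).
Proof.
move=> s1 s2 cm; have X1 := smooth_vect_rep Hb s1 cm; have X2 := smooth_vect_rep Hb s2 cm.
have fc := @finite_coords_row R n.
apply: smooth_atB; first apply: smooth_atB.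
- exact: (smooth_at_diff_app fc (smooth_dual_rep ab Hb y s2 cm) X1).
- apply: (smooth_at_linfam (near_dual_rep_lin Hb nu2 cm)).
    by move=> u; exact: (smooth_dual_rep ab Hb u s2 cm).
  exact: (smooth_Gamma HDelta ab Hb chiC y s1 cm).
- have FL : \forall x \near c m, linear (Lambda Delta b c chi nu1 x y).
    by apply: near_all => x; exact: Lambda_linr.
  apply: (smooth_at_linfam FL) X2 => u.
  exact: (smooth_Lambda HDelta ab Hb chiC y u s1 cm).
Qed.

End Chart2.

(** [Delta] is constrained on smooth sections only, so this must precede any statement about
    [Delta] along a dual bracket. *)
Lemma smooth_bracket nu1 nu2 : smoothA nu1 -> smoothA nu2 ->
  smoothA (dual_bracket Delta nu1 nu2).
Proof.
move=> s1 s2; split.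
- apply/smooth_vfieldP => m; have [b [c [ab Hb cm]]] := vb_around E m.
  have [chi chiU chi1] := bump_manifold (vb_smooth Hb) cm (near_cdom cm).
  rewrite setIid in chiU.
  exists c; split=> //; first exact: vb_smooth Hb.
  apply: eq_smooth_at (smooth_bracket_vect Hb s1 s2 cm).
  by apply: filterS (near_bracket ab Hb chiU s1 s2 cm chi1) => x [].
- move=> b ab y; have [c Hb] := atlas_vb_over ab.
  have EU : [set x | cimg b (row_mx x y)] = cimg c.
    by apply/funext => x /=; rewrite (vb_imgE Hb) row_mxKl.
  rewrite EU; apply/smooth_onP; first exact: open_cimg.
  move=> x ix; have cm := cinv_dom ix.
  have [chi chiU chi1] := bump_manifold (vb_smooth Hb) cm (near_cdom cm).
  rewrite setIid in chiU.
  have := smooth_bracket_dual ab Hb chiU y s1 s2 cm; rewrite (cinvK ix).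
  apply: eq_smooth_at.
  have := near_bracket ab Hb chiU s1 s2 cm chi1; rewrite (cinvK ix).
  by apply: filterS => z [_ ->].
Qed.

End Bracket.

(** * The Courant-Dorfman bracket in coordinates *)

Lemma add_lin_comb (R : pzRingType) (W : lmodType R) (a : R) (u u' v v' : W) :
  a *: u + v + (a *: u' + v') = a *: (u + u') + (v + v').
Proof. by rewrite scalerDr addrACA. Qed.

Lemma sub_lin_comb (R : pzRingType) (W : lmodType R) (a : R) (u u' v v' : W) :
  a *: u + v - (a *: u' + v') = a *: (u - u') + (v - v').
Proof. by rewrite scalerBr opprD addrACA. Qed.

Section CourantCoord.
Variables (R : realType) (n : nat) (N : manifold R n) (p : N).
Variables s t : forall q : N, (tangent q * cotangent q)%type.
Let b := chart_at p.
Variables (VX VY : 'rV[R]_n -> 'rV[R]_n) (TS TY : 'rV[R]_n -> 'rV[R]_n -> R^o).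
Hypotheses (sVX : smooth_at VX (b p)) (sVY : smooth_at VY (b p)).
Hypotheses (sTS : forall w, smooth_at (TS ^~ w) (b p)) (sTY : forall w, smooth_at (TY ^~ w) (b p)).
Hypotheses (eX : \forall z \near b p, VX z = vcoord b (fun q => (s q).1) z)
  (eS : \forall z \near b p, forall w, TS z w = fcoord b (fun q => (s q).2) z w)
  (eY : \forall z \near b p, VY z = vcoord b (fun q => (t q).1) z)
  (eT : \forall z \near b p, forall w, TY z w = fcoord b (fun q => (t q).2) z w).

Let X0 : VX (b p) = (s p).1.
Proof.
rewrite (nbhs_singleton eX) vcoordE; last exact: chart_at_dom.
exact: tcoord_chart_at.
Qed.

Let Y0 : VY (b p) = (t p).1.
Proof.
rewrite (nbhs_singleton eY) vcoordE; last exact: chart_at_dom.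
exact: tcoord_chart_at.
Qed.

Let linTS : \forall z \near b p, linear (TS z).
Proof.
by apply: filterS eS => z e a u v; rewrite !e fcoord_linear.
Qed.

Let linTY : \forall z \near b p, linear (TY z).
Proof.
by apply: filterS eT => z e a u v; rewrite !e fcoord_linear.
Qed.

Lemma courant_bracket_fst : (courant_bracket s t p).1 =
  'd VY (b p) (VX (b p)) - 'd VX (b p) (VY (b p)).
Proof.
have H1 : 'd (vcoord b (fun q => (t q).1)) (b p) (s p).1 = 'd VY (b p) (VX (b p)).
  by rewrite X0; exact: (congr1 (@^~ _) (near_diff eY (smooth_at_diff sVY))).
have H2 : 'd (vcoord b (fun q => (s q).1)) (b p) (t p).1 = 'd VX (b p) (VY (b p)).
  by rewrite Y0; exact: (congr1 (@^~ _) (near_diff eX (smooth_at_diff sVX))).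
exact: (congr2 (fun u v => u - v) H1 H2).
Qed.

Let dS w : 'd (fcoord b (fun q => (s q).2) ^~ w) (b p) = 'd (TS ^~ w) (b p) :> (_ -> _).
Proof.
have e : \forall z \near b p, TS z w = fcoord b (fun q => (s q).2) z w.
  by apply: filterS eS.
exact: (near_diff e (smooth_at_diff (sTS w))).
Qed.

Let dT w : 'd (fcoord b (fun q => (t q).2) ^~ w) (b p) = 'd (TY ^~ w) (b p) :> (_ -> _).
Proof.
have e : \forall z \near b p, TY z w = fcoord b (fun q => (t q).2) z w.
  by apply: filterS eT.
exact: (near_diff e (smooth_at_diff (sTY w))).
Qed.

(** [lie_derivative] and [interior_d] pass their defining expressions to [linfun], which keeps
    the values of linear functions only. Linearity in [w] comes from the linearity of
    forms and from the differentiability of their coefficients. *)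
Lemma courant_bracket_snd w : (courant_bracket s t p).2 w =
  'd (TY ^~ w) (b p) (VX (b p)) + TY (b p) ('d VX (b p) w)
  - ('d (TS ^~ w) (b p) (VY (b p)) - 'd (TS ^~ (VY (b p))) (b p) w).
Proof.
pose f (w : 'rV[R]_n) : R^o := 'd (TY ^~ w) (b p) (VX (b p)) + TY (b p) ('d VX (b p) w).
pose g (w : 'rV[R]_n) : R^o := 'd (TS ^~ w) (b p) (VY (b p)) - 'd (TS ^~ (VY (b p))) (b p) w.
have lf : linear f.
  move=> a u v.
  have e1 := diff_param_lin (VX (b p)) linTY (fun u => smooth_at_diff (sTY u)) a u v.
  have e2 := linearP ('d VX (b p)) a u v.
  have e3 := nbhs_singleton linTY a ('d VX (b p) u) ('d VX (b p) v).
  apply: etrans (congr2 (fun u v => u + v) e1 (etrans (congr1 (TY (b p)) e2) e3)) _.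
  exact: add_lin_comb.
have lg : linear g.
  move=> a u v.
  have e1 := diff_param_lin (VY (b p)) linTS (fun u => smooth_at_diff (sTS u)) a u v.
  have e2 := linearP ('d (TS ^~ (VY (b p))) (b p)) a u v.
  apply: etrans (congr2 (fun u v => u - v) e1 e2) _.
  exact: sub_lin_comb.
pose FM := GRing.isLinear.Build _ _ _ _ _ lf.
pose F : {linear 'rV[R]_n -> R^o} := HB.pack f FM.
pose GM := GRing.isLinear.Build _ _ _ _ _ lg.
pose G : {linear 'rV[R]_n -> R^o} := HB.pack g GM.
have EF : lie_derivative (fun q => (s q).1) (fun q => (t q).2) p = linfun F.
  apply: (congr1 (fun h => linfun h)); apply/funext => u.
  have dp := chart_at_dom p.
  have H1 : 'd (fcoord b (fun q => (t q).2) ^~ u) (b p) (s p).1 = 'd (TY ^~ u) (b p) (VX (b p)).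
    by rewrite X0; exact: (congr1 (@^~ _) (dT u)).
  have H2 : (t p).2 ('d (vcoord b (fun q => (s q).1)) (b p) u) = TY (b p) ('d VX (b p) u).
    rewrite (nbhs_singleton eT) (fcoord_at _ _ dp) tvec_chart_at.
    exact: (congr1 (fun z => (t p).2 (z u)) (near_diff eX (smooth_at_diff sVX))).
  exact: (congr2 (fun u v => u + v) H1 H2).
have EG : interior_d (fun q => (t q).1) (fun q => (s q).2) p = linfun G.
  apply: (congr1 (fun h => linfun h)); apply/funext => u.
  have H1 : 'd (fcoord b (fun q => (s q).2) ^~ u) (b p) (t p).1 = 'd (TS ^~ u) (b p) (VY (b p)).
    by rewrite Y0; exact: (congr1 (@^~ _) (dS u)).
  have H2 : 'd (fcoord b (fun q => (s q).2) ^~ ((t p).1 : 'rV[R]_n)) (b p) u =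
      'd (TS ^~ (VY (b p))) (b p) u.
    by rewrite Y0; exact: (congr1 (@^~ _) (dS _)).
  exact: (congr2 (fun u v => u - v) H1 H2).
have E : (courant_bracket s t p).2 w = (linfun F : cotangent p) w - (linfun G : cotangent p) w.
  rewrite -EF -EG; set u1 := lie_derivative _ _ _; set u2 := interior_d _ _ _.
  rewrite -[LHS]/((u1 - u2) w); clearbody u1 u2.
  by rewrite add_lfunE opp_lfunE.
by rewrite E; exact: (congr2 (fun u v : R => u - v) (lfunE F w) (lfunE G w)).
Qed.

End CourantCoord.

Section CourantChart.
Variables (R : realType) (n : nat) (N : manifold R n) (p : N) (b : chart R N n).
Hypothesis eb : b = chart_at p.
Variables s t : forall q : N, (tangent q * cotangent q)%type.
Variables (VX VY : 'rV[R]_n -> 'rV[R]_n) (TS TY : 'rV[R]_n -> 'rV[R]_n -> R^o).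

Lemma courant_fst : smooth_at VX (b p) -> smooth_at VY (b p) ->
  (\forall z \near b p, VX z = vcoord b (fun q => (s q).1) z) ->
  (\forall z \near b p, VY z = vcoord b (fun q => (t q).1) z) ->
  (courant_bracket s t p).1 = 'd VY (b p) (VX (b p)) - 'd VX (b p) (VY (b p)).
Proof. by rewrite eb; exact: courant_bracket_fst. Qed.

Lemma courant_snd w : smooth_at VX (b p) ->
  (forall w, smooth_at (TS ^~ w) (b p)) -> (forall w, smooth_at (TY ^~ w) (b p)) ->
  (\forall z \near b p, VX z = vcoord b (fun q => (s q).1) z) ->
  (\forall z \near b p, forall w, TS z w = fcoord b (fun q => (s q).2) z w) ->
  (\forall z \near b p, VY z = vcoord b (fun q => (t q).1) z) ->
  (\forall z \near b p, forall w, TY z w = fcoord b (fun q => (t q).2) z w) ->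
  (courant_bracket s t p).2 w =
  'd (TY ^~ w) (b p) (VX (b p)) + TY (b p) ('d VX (b p) w)
  - ('d (TS ^~ w) (b p) (VY (b p)) - 'd (TS ^~ (VY (b p))) (b p) w).
Proof. by rewrite eb => ? ? ? ? ? ? ?; exact: courant_bracket_snd. Qed.

End CourantChart.

(** * Lifts in coordinates *)

Section RowMx.
Variables (R : realType) (V : normedModType R) (n k : nat).

Lemma is_diff_row_mx (f df : V -> 'rV[R]_n) (g dg : V -> 'rV[R]_k) x :
  is_diff x f df -> is_diff x g dg ->
  is_diff x (fun y => row_mx (f y) (g y)) (fun v => row_mx (df v) (dg v)).
Proof.
move=> hf hg.
have Ll : linear (fun u : 'rV[R]_n => row_mx u (0 : 'rV[R]_k)).
  by move=> a u v; rewrite scale_row_mx add_row_mx scaler0 addr0.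
have Lr : linear (fun u : 'rV[R]_k => row_mx (0 : 'rV[R]_n) u).
  by move=> a u v; rewrite scale_row_mx add_row_mx scaler0 addr0.
pose lM := GRing.isLinear.Build _ _ _ _ _ Ll.
pose l : {linear 'rV[R]_n -> 'rV[R]_(n + k)} := HB.pack (fun u : 'rV[R]_n => row_mx u (0 : 'rV[R]_k)) lM.
pose rM := GRing.isLinear.Build _ _ _ _ _ Lr.
pose r : {linear 'rV[R]_k -> 'rV[R]_(n + k)} := HB.pack (fun u : 'rV[R]_k => row_mx (0 : 'rV[R]_n) u) rM.
have cl : continuous l by exact: linear_row_continuous.
have cr : continuous r by exact: linear_row_continuous.
have Hl : is_diff (f x) l l by split; [exact: linear_differentiable|exact: diff_lin].
have Hr : is_diff (g x) r r by split; [exact: linear_differentiable|exact: diff_lin].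
have H := is_diffD (is_diff_comp hf Hl) (is_diff_comp hg Hr).
have N : \forall y \near x, ((l \o f) + (r \o g)) y = row_mx (f y) (g y).
  by apply: nearW => y; rewrite !fctE /= add_row_mx addr0 add0r.
apply: is_diff_eq (near_is_diff N H) _; apply/funext => v.
by rewrite !fctE /= add_row_mx addr0 add0r.
Qed.

End RowMx.

Section LiftCoord.
Variables (R : realType) (n k : nat) (M : manifold R n) (E : vbundle k M).
Variables (b : chart R E (n + k)) (c : chart R M n).
Hypotheses (ab : atlas b) (Hb : vb_over b c).
Let sc : smooth_chart c := vb_smooth Hb.
Let sb : smooth_chart b := atlas_smooth_chart ab.

Lemma near_proj (x : E) : cdom b x -> \forall z \near b x,
  lsubmx z = (c \o @Defs.proj _ _ _ _ E \o cinv b) z.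
Proof.
move=> bx; apply: filterS (near_cimg (cfun_img bx)) => z bz.
rewrite /= /Defs.proj (base_cinv Hb bz) cinvK //.
by rewrite -(vb_imgE Hb).
Qed.

Lemma vb_proj_continuous (x : E) : cdom b x -> {for x, continuous (@Defs.proj _ _ _ _ E)}.
Proof.
move=> bx; have cx : cdom c (base x) by rewrite -(vb_domE Hb).
have bxE : lsubmx (b x) = c (base x) by case: Hb => _ _ _ h _; exact: h.
move=> A Ax.
have A1 : \forall z \near lsubmx (b x), A (cinv c z).
  by rewrite bxE; exact: (near_cinv cx Ax).
have A2 : \forall z \near b x, A (cinv c (lsubmx z)).
  exact: (@continuous_lsubmx R 1 n k (b x) _ A1).
have := near_cfun bx A2; have := near_cdom bx; apply: filterS2 => y cby /=.
case: Hb => _ db _ h _; rewrite (h _ cby) cfunK //.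
by move: cby; rewrite db.
Qed.

Lemma lsubmx_diff (z : 'rV[R]_(n + k)) :
  is_diff z (lsubmx : 'rV[R]_(n + k) -> 'rV[R]_n) (lsubmx : 'rV[R]_(n + k) -> 'rV[R]_n).
Proof.
have cl : continuous (@lsubmx R 1 n k) by exact: continuous_lsubmx.
by split; [exact: differentiable_lsubmx|exact: diff_lin].
Qed.

Lemma rsubmx_diff (z : 'rV[R]_(n + k)) :
  is_diff z (rsubmx : 'rV[R]_(n + k) -> 'rV[R]_k) (rsubmx : 'rV[R]_(n + k) -> 'rV[R]_k).
Proof.
have cl : continuous (@rsubmx R 1 n k) by exact: continuous_rsubmx.
by split; [exact: differentiable_rsubmx|exact: diff_lin].
Qed.

Lemma tmap_projE (x : E) (v : tangent x) : cdom b x ->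
  tmap (@Defs.proj _ _ _ _ E) x v = tvec c (base x) (lsubmx (tcoord b v)).
Proof.
move=> bx; have cx : cdom c (base x) by rewrite -(vb_domE Hb).
have [d1 d2] := near_is_diff (near_proj bx) (lsubmx_diff (b x)).
apply: etrans (esym (tcoordK sc cx _)) _; congr tvec.
apply: etrans (tmapE v sb sc bx cx (vb_proj_continuous bx) d1) _.
exact: (congr1 (@^~ (tcoord b v)) d2).
Qed.

(** A bundle chart is linear on fibres, so it maps the line through [x] to an affine line. *)
Lemma tcoord_vlift (x : E) (t : (fib E (base x) * cotangent (base x))%type) :
  cdom b x -> tcoord b (vlift_at t).1 = row_mx 0 (fibre_coord b t.1).
Proof.
move=> bx; have cx : cdom c (base x) by rewrite -(vb_domE Hb).
pose u : 'rV[R]_(n + k) := row_mx 0 (fibre_coord b t.1).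
have line s : b (fibre_line t.1 s) = b x + s *: u.
  rewrite (vb_row Hb _ cx) (fibre_coordD Hb _ _ cx) (fibre_coordZ Hb _ _ cx).
  have -> : b x = row_mx (c (base x)) (fibre_coord b (vec x)).
    by rewrite -(vb_row Hb _ cx); case: (x).
  by rewrite scale_row_mx add_row_mx scaler0 addr0.
have H : is_diff (0 : R^o) (b \o fibre_line t.1 : R^o -> _) (fun s : R^o => s *: u).
  have H1 : is_diff (0 : R^o) (fun t : R^o => t *: u) (fun t : R^o => t *: u).
    exact: is_diff_scalel.
  have N : \forall s \near (0 : R^o), (cst (b x) + (fun t : R^o => t *: u)) s =
      (b \o fibre_line t.1) s by apply: near_all => s; rewrite /= line.
  apply: is_diff_eq (near_is_diff N (is_diffD (is_diff_cst (b x) (0 : R^o)) H1)) _.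
  by apply/funext => s; rewrite !fctE add0r.
have g0 : fibre_line t.1 0 = x.
  by rewrite /fibre_line scale0r addr0; case: (x).
have [d1 d2] := H.
have cg : {for (0 : R), continuous (fibre_line t.1)}.
  move=> A; rewrite g0 => Ax.
  have cb : {for (0 : R^o), continuous (b \o fibre_line t.1 : R^o -> _)}.
    exact: differentiable_continuous.
  have Ab : \forall z \near (b \o fibre_line t.1) 0, A (cinv b z).
    by rewrite /= g0; exact: near_cinv.
  have Ab' : \forall s \near (0 : R^o), A (cinv b ((b \o fibre_line t.1) s)) := cb _ Ab.
  have EE : (fun s => cinv b ((b \o fibre_line t.1) s)) = fibre_line t.1.
    by apply/funext => s; rewrite /= cfunK // (vb_domE Hb); exact: cx.
  exact: (eq_ind _ (fun f => nbhs (0 : R^o) (fun s => A (f s))) Ab' _ EE).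
apply: etrans (velocityE sb bx g0 d1 cg) _.
by rewrite (congr1 (@^~ (1 : R^o)) d2) scale1r.
Qed.

Lemma vlift_sndE (x : E) (t : (fib E (base x) * cotangent (base x))%type) v :
  cdom b x -> (vlift_at t).2 v = t.2 (tvec c (base x) (lsubmx (tcoord b v))).
Proof.
move=> bx; rewrite -(tmap_projE v bx) -[LHS]/((t.2 \o tmap (@Defs.proj _ _ _ _ E) x)%VF v).
by rewrite comp_lfunE.
Qed.

Definition TE_vect (s : sectionTE E) := vcoord b (fun x => (s x).1).
Definition TE_form (s : sectionTE E) := fcoord b (fun x => (s x).2).

Lemma near_E (x : E) (P : E -> Prop) : cdom b x -> (\forall y \near x, P y) ->
  \forall z \near b x, cimg b z /\ cdom b (cinv b z) /\ P (cinv b z).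
Proof.
move=> bx Px; have N1 := near_cinv bx Px; have N2 := near_cinv bx (near_cdom bx).
by have N3 := near_cimg (cfun_img bx); move: N3 N2 N1; apply: filterS3.
Qed.

Lemma TE_vect_at (s : sectionTE E) x : cdom b x -> TE_vect s (b x) = tcoord b (s x).1.
Proof. by move=> bx; rewrite /TE_vect vcoordE. Qed.

Lemma TE_form_at (s : sectionTE E) x w : cdom b x -> TE_form s (b x) w = (s x).2 (tvec b x w).
Proof. by move=> bx; rewrite /TE_form (fcoord_at _ _ bx). Qed.

Lemma b_base (x : E) : cdom b x -> lsubmx (b x) = c (base x).
Proof. by case: Hb => _ _ _ h _; exact: h. Qed.

Lemma TE_vect_vlift tau x : cdom b x ->
  TE_vect (vlift tau) (b x) = row_mx 0 (fibre_rep b c tau (lsubmx (b x))).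
Proof.
move=> bx; have cx : cdom c (base x) by rewrite -(vb_domE Hb).
by rewrite (TE_vect_at _ bx) (b_base bx) (tcoord_vlift _ bx) /fibre_rep /section_rep (cfunK cx).
Qed.

Lemma TE_form_vlift tau x w : cdom b x ->
  TE_form (vlift tau) (b x) w = form_rep c tau (lsubmx (b x)) (lsubmx w).
Proof.
move=> bx; have cx : cdom c (base x) by rewrite -(vb_domE Hb).
rewrite (TE_form_at _ _ bx) (b_base bx) (vlift_sndE _ _ bx) (tvecK sb bx).
by rewrite /form_rep (fcoord_at _ _ cx).
Qed.

End LiftCoord.

Section HorLift.
Variables (R : realType) (n k : nat) (M : manifold R n) (E : vbundle k M).
Variable Delta : sectionA E -> sectionB E -> sectionB E.
Hypothesis HDelta : dorfman_connection Delta.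
Variables (b : chart R E (n + k)) (c : chart R M n).
Hypotheses (ab : atlas b) (Hb : vb_over b c).
Variables (chi : M -> R).
Hypotheses (chiC : cutoff (cdom c) chi).
Let sc : smooth_chart c := vb_smooth Hb.
Let sb : smooth_chart b := atlas_smooth_chart ab.
Implicit Types (nu : sectionA E) (tau : sectionB E) (z : 'rV[R]_(n + k)).

Definition hor_lift_along nu (e : forall m, fib E m) (x : E) : (tangent x * cotangent x)%type :=
  (tmap (to_total e) (base x) (nu (base x)).1 : tangent x,
   dfun (ell (fun m => (nu m).2)) x)
  - vlift_at (Delta nu (inlB e) (base x)).

Definition ell_rep nu z : R^o := dual_rep b nu (lsubmx z) (rsubmx z).
Definition hor_vect nu z : 'rV[R]_(n + k) :=
  row_mx (vect_rep c nu (lsubmx z)) (- Gamma Delta b c chi nu (lsubmx z) (rsubmx z)).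
Definition hor_form nu z (v : 'rV[R]_(n + k)) : R^o :=
  'd (ell_rep nu) z v - Lambda Delta b c chi nu (lsubmx z) (rsubmx z) (lsubmx v).

Lemma ell_repE nu : ell_rep nu = ell (fun m => (nu m).2) \o cinv b.
Proof. by apply/funext => z; rewrite /ell_rep /dual_rep hsubmxK. Qed.

Lemma smooth_ell_rep nu x : smoothA nu -> cdom b x -> smooth_at (ell_rep nu) (b x).
Proof.
move=> s bx; have cx : cdom c (base x) by rewrite -(vb_domE Hb).
have bxE := b_base Hb bx.
have sl : smooth_at (lsubmx : 'rV[R]_(n + k) -> 'rV[R]_n) (b x).
  by apply: smooth_at_linear; exact: continuous_lsubmx.
have sr : smooth_at (rsubmx : 'rV[R]_(n + k) -> 'rV[R]_k) (b x).
  by apply: smooth_at_linear; exact: continuous_rsubmx.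
have Fl : \forall z \near b x, linear (dual_rep b nu (lsubmx z)).
  have N1 := near_dual_rep_lin Hb nu cx; rewrite -bxE in N1.
  exact: (@continuous_lsubmx R 1 n k (b x) _ N1).
apply: (smooth_at_linfam Fl) sr => u.
apply: (smooth_at_comp (f := dual_rep b nu ^~ u) (@finite_coords_row R n) sl).
by rewrite bxE; exact: (smooth_dual_rep ab Hb u s cx).
Qed.

Lemma to_total_base (e : forall m, fib E m) (x : E) : e (base x) = vec x ->
  to_total e (base x) = x.
Proof. by rewrite /to_total => ->; case: (x). Qed.

Lemma tcoord_eq (p q : E) (v : 'rV[R]_(n + k)) : p = q ->
  @tcoord _ _ E b p v = @tcoord _ _ E b q v.
Proof. by move=> ->. Qed.

Lemma section_derivative (e : forall m, fib E m) m v : smooth_section e -> cdom c m ->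
  'd (b \o to_total e \o cinv c) (c m) v = row_mx v ('d (section_rep b c e) (c m) v).
Proof.
move=> se cm.
have D := smooth_at_diff (smooth_section_at Hb ab se cm).
have N : \forall x \near c m, row_mx x (section_rep b c e x) = (b \o to_total e \o cinv c) x.
  by apply: filterS (near_section_rep Hb e cm) => x ->.
have [_ d2] := near_is_diff N (is_diff_row_mx (is_diff_id (c m : 'rV[R]_n)) (differentiableP D)).
exact: (congr1 (@^~ v) d2).
Qed.

Lemma tcoord_tmap_section (e : forall m, fib E m) (x : E) (v : tangent (base x)) :
  smooth_section e -> e (base x) = vec x -> cdom b x ->
  @tcoord _ _ E b x (tmap (to_total e) (base x) v) =
  row_mx (tcoord c v) ('d (section_rep b c e) (c (base x)) (tcoord c v)).
Proof.
move=> se ex bx; have cx : cdom c (base x) by rewrite -(vb_domE Hb).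
rewrite -(tcoord_eq _ (to_total_base ex)) -(section_derivative _ se cx).
have be : cdom b (to_total e (base x)) by rewrite (to_total_base ex).
have D : differentiable (b \o to_total e \o cinv c) (c (base x)).
  have Ds := smooth_at_diff (smooth_section_at Hb ab se cx).
  have N : \forall x' \near c (base x), row_mx x' (section_rep b c e x') = (b \o to_total e \o cinv c) x'.
    by apply: filterS (near_section_rep Hb e cx) => x' ->.
  by case: (near_is_diff N (is_diff_row_mx (is_diff_id (c (base x) : 'rV[R]_n)) (differentiableP Ds))).
exact: (tmapE v sc sb cx be (se.1 (base x)) D).
Qed.

Lemma Delta_inl nu (e : forall m, fib E m) (x : E) : smoothA nu -> smooth_section e ->
  e (base x) = vec x -> cdom b x -> (\forall q \near base x, chi q = 1) ->
  fibre_rep b c (Delta nu (inlB e)) (c (base x)) =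
    'd (section_rep b c e) (c (base x)) (vect_rep c nu (c (base x))) + Gamma Delta b c chi nu (c (base x)) (rsubmx (b x))
  /\ forall w, form_rep c (Delta nu (inlB e)) (c (base x)) w =
    Lambda Delta b c chi nu (c (base x)) (rsubmx (b x)) w.
Proof.
move=> s se ex bx h; have cx : cdom c (base x) by rewrite -(vb_domE Hb).
have [F1 F2] := local_formula HDelta ab Hb chiC s (smoothB_inl se) cx h.
have e0 : fibre_rep b c (inlB e) (c (base x)) = rsubmx (b x).
  by rewrite /fibre_rep /section_rep (cfunK cx) /= ex /fibre_coord; case: (x).
split; first by rewrite F1 e0.
move=> w; rewrite F2 e0.
have t0 w' : form_rep c (inlB e) ^~ w' = cst 0.
  by apply/funext => y; rewrite /form_rep /fcoord /= zero_lfunE.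
have D0 : 'd (form_rep c (inlB e) ^~ w) (c (base x)) (vect_rep c nu (c (base x))) = 0.
  by rewrite t0; exact: (congr1 (@^~ _) (diff_cst (0 : R^o) (c (base x)))).
rewrite D0 (congr1 (@^~ (c (base x))) (t0 _)).
by rewrite !addr0.
Qed.

Lemma tcoordB (x : E) (u v : tangent x) : tcoord b (u - v) = tcoord b u - tcoord b v.
Proof.
have := tcoord_linear b (-1) v u; rewrite scaleN1r [- v + u]addrC => ->.
by rewrite scaleN1r addrC.
Qed.

(** The tangent map of [e] and [Delta nu (inlB e)] contain the same derivative of [e] along X.
    After cancellation only the value of [e] at the point is left. *)
Lemma hor_lift_along_fst nu e (x : E) : smoothA nu -> smooth_section e ->
  e (base x) = vec x -> cdom b x -> (\forall q \near base x, chi q = 1) ->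
  tcoord b (hor_lift_along nu e x).1 = hor_vect nu (b x).
Proof.
move=> s se ex bx h; have cx : cdom c (base x) by rewrite -(vb_domE Hb).
rewrite -[(hor_lift_along nu e x).1]/((tmap (to_total e) (base x) (nu (base x)).1 : tangent x)
  - (vlift_at (Delta nu (inlB e) (base x))).1).
rewrite tcoordB (tcoord_tmap_section _ se ex bx) (tcoord_vlift ab Hb _ bx).
have [F1 _] := Delta_inl s se ex bx h.
rewrite {1}/fibre_rep /section_rep (cfunK cx) in F1.
rewrite F1 /hor_vect (b_base Hb bx) /vect_rep (vcoordE _ cx).
by rewrite opp_row_mx add_row_mx subr0 opprD addrA subrr add0r.
Qed.

Lemma hor_lift_along_snd nu e (x : E) v : smoothA nu -> smooth_section e ->
  e (base x) = vec x -> cdom b x -> (\forall q \near base x, chi q = 1) ->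
  (hor_lift_along nu e x).2 v = hor_form nu (b x) (tcoord b v).
Proof.
move=> s se ex bx h; have cx : cdom c (base x) by rewrite -(vb_domE Hb).
rewrite -[(hor_lift_along nu e x).2]/(dfun (ell (fun m => (nu m).2)) x
  - (vlift_at (Delta nu (inlB e) (base x))).2).
rewrite add_lfunE opp_lfunE (vlift_sndE ab Hb _ _ bx) /hor_form.
have [_ F2] := Delta_inl s se ex bx h.
have F3 := F2 (lsubmx (tcoord b v)); rewrite {1}/form_rep (fcoord_at _ _ cx) in F3.
rewrite F3 (b_base Hb bx); congr (_ - _).
have D := smooth_at_diff (smooth_ell_rep s bx); rewrite ell_repE in D *.
exact: (dfunE v sb bx D).
Qed.

Lemma hor_lift_along_indep nu e e' (x : E) : smoothA nu -> smooth_section e -> smooth_section e' ->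
  e (base x) = vec x -> e' (base x) = vec x ->
  cdom b x -> (\forall q \near base x, chi q = 1) -> hor_lift_along nu e x = hor_lift_along nu e' x.
Proof.
move=> s se se' ex ex' bx h; apply: pair_ext.
  apply: (can_inj (tcoordK sb bx)).
  exact: etrans (hor_lift_along_fst s se ex bx h) (esym (hor_lift_along_fst s se' ex' bx h)).
apply/lfunP => v.
exact: etrans (hor_lift_along_snd v s se ex bx h) (esym (hor_lift_along_snd v s se' ex' bx h)).
Qed.

Lemma section_through (x : E) : cdom b x -> (\forall q \near base x, chi q = 1) ->
  exists2 e, smooth_section e & e (base x) = vec x.
Proof.
move=> bx h; have cx : cdom c (base x) by rewrite -(vb_domE Hb).
exists (frame b chi (fibre_coord b (vec x))); first exact: smooth_frame ab Hb chiC.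
by rewrite /frame (nbhs_singleton h) scale1r (fibre_coordK Hb).
Qed.

Lemma hor_liftE nu e (x : E) : smoothA nu -> smooth_section e -> e (base x) = vec x ->
  cdom b x -> (\forall q \near base x, chi q = 1) -> hor_lift Delta nu x = hor_lift_along nu e x.
Proof.
move=> s se ex bx h; rewrite /hor_lift; case: xgetP => [r _ [e' [se' ex' ->]]|no].
  exact: hor_lift_along_indep.
case: (no (hor_lift_along nu e x)); by exists e.
Qed.

Lemma TE_vect_hor nu (x : E) : smoothA nu -> cdom b x -> (\forall q \near base x, chi q = 1) ->
  TE_vect b (hor_lift Delta nu) (b x) = hor_vect nu (b x).
Proof.
move=> s bx h; have [e se ex] := section_through bx h.
by rewrite (TE_vect_at _ bx) (hor_liftE s se ex bx h) (hor_lift_along_fst s se ex bx h).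
Qed.

Lemma TE_form_hor nu (x : E) w : smoothA nu -> cdom b x -> (\forall q \near base x, chi q = 1) ->
  TE_form b (hor_lift Delta nu) (b x) w = hor_form nu (b x) w.
Proof.
move=> s bx h; have [e se ex] := section_through bx h.
rewrite (TE_form_at _ _ bx) (hor_liftE s se ex bx h) (hor_lift_along_snd _ s se ex bx h).
by rewrite (tvecK sb bx).
Qed.

End HorLift.

(** * Derivatives of the lifts *)

Section SecondDerivative.
Variables (R : realType) (V : normedModType R).
Hypothesis fcV : finite_coords V.

Lemma diff_diff_sym (f : V -> R^o) (x u v : V) : smooth_at f x ->
  'd (fun y => 'd f y v) x u = 'd (fun y => 'd f y u) x v.
Proof.
move=> sf.
have N w : \forall y \near x, 'D_w f y = 'd f y w.
  by apply: filterS (smooth_at_near sf) => y sy; exact: (deriveE w (smooth_at_diff sy)).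
have d w : differentiable ('D_w f) x by exact: (smooth_at_diff (smooth_at_derive w sf)).
have E1 w w' : 'd (fun y => 'd f y w) x w' = 'D_w' ('D_w f) x.
  rewrite (deriveE w' (d w)).
  exact: (congr1 (@^~ w') (near_diff (N w) (d w))).
by rewrite E1 [RHS]E1; exact: schwarz.
Qed.

(** Second differentials are compared entry by entry. *)
Lemma diff_diff_sym_row k (f : V -> 'rV[R]_k) (x u v : V) : smooth_at f x ->
  'd (fun y => 'd f y v) x u = 'd (fun y => 'd f y u) x v.
Proof.
move=> sf; apply/rowP => i.
have sfi := (smooth_at_rowP _ _).1 sf i.
have E1 w w' : ('d (fun y => 'd f y w) x w') ord0 i =
    'd (fun y => 'd (fun z => f z ord0 i : R^o) y w) x w'.
  have s1 : smooth_at (fun y => 'd f y w) x.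
    by apply: smooth_at_diff_app => //; exact: smooth_at_cst.
  have [d1 E1] := is_diff_coord i (smooth_at_diff s1).
  have N : \forall y \near x, 'd f y w ord0 i = 'd (fun z => f z ord0 i : R^o) y w.
    apply: filterS (smooth_at_near sf) => y sy.
    have [_ E2] := is_diff_coord i (smooth_at_diff sy).
    exact: (esym (congr1 (@^~ w) E2)).
  apply: etrans (esym (congr1 (@^~ w') E1)) _.
  exact: (esym (congr1 (@^~ w') (near_diff N d1))).
by rewrite E1 [RHS]E1; exact: diff_diff_sym.
Qed.

Lemma is_diff_diff_app (W : normedModType R) N (f : 'rV[R]_N -> W) (g : 'rV[R]_N -> 'rV[R]_N) x :
  smooth_at f x -> smooth_at g x ->
  is_diff x (fun y => 'd f y (g y))
    (fun v => 'd (fun y => 'd f y (g x)) x v + 'd f x ('d g x v)).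
Proof.
move=> sf sg.
have Fl : \forall y \near x, linear ('d f y : _ -> _).
  by apply: near_all => y a u v; rewrite linearP.
apply: (diff_linfam Fl) (smooth_at_diff sg) => u.
exact: (smooth_at_diff (smooth_at_diff_app (@finite_coords_row R N) sf (smooth_at_cst u x))).
Qed.

End SecondDerivative.

Section Blocks.
Variables (R : realType) (n k : nat) (W : normedModType R).
Implicit Types (z u p : 'rV[R]_(n + k)).

Lemma is_diff_lsub (F : 'rV[R]_n -> W) z : differentiable F (lsubmx z) ->
  is_diff z (fun p => F (lsubmx p)) (fun u => 'd F (lsubmx z) (lsubmx u)).
Proof. by move=> d; exact: (is_diff_comp (lsubmx_diff z) (differentiableP d)). Qed.

Lemma smooth_at_lsub (F : 'rV[R]_n -> W) z : smooth_at F (lsubmx z) ->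
  smooth_at (fun p => F (lsubmx p)) z.
Proof.
apply: smooth_at_comp; first exact: finite_coords_row.
by apply: smooth_at_linear; exact: continuous_lsubmx.
Qed.

Lemma near_lsub (P : 'rV[R]_n -> Prop) z : (\forall x \near lsubmx z, P x) ->
  \forall p \near z, P (lsubmx p).
Proof. by move=> h; exact: (@continuous_lsubmx R 1 n k z _ h). Qed.

Lemma is_diff_fam (F : 'rV[R]_n -> 'rV[R]_k -> W) z :
  (\forall x \near lsubmx z, linear (F x)) ->
  (forall y, differentiable (F ^~ y) (lsubmx z)) ->
  is_diff z (fun p => F (lsubmx p) (rsubmx p))
    (fun u => 'd (F ^~ (rsubmx z)) (lsubmx z) (lsubmx u) + F (lsubmx z) (rsubmx u)).
Proof.
move=> Fl Fd.
have Fl' : \forall p \near z, linear (F (lsubmx p)) by exact: (near_lsub (P := fun x => linear (F x)) Fl).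
have [dr Er] := rsubmx_diff z.
have Dl y := is_diff_lsub (Fd y).
have H := diff_linfam Fl' (fun y => let: DiffDef d _ := Dl y in d) dr.
apply: is_diff_eq H _; apply/funext => u.
congr (_ + _).
  by have [_ E] := Dl (rsubmx z); exact: (congr1 (@^~ u) E).
by rewrite (congr1 (@^~ u) Er).
Qed.

Lemma smooth_at_fam (F : 'rV[R]_n -> 'rV[R]_k -> W) z :
  (\forall x \near lsubmx z, linear (F x)) ->
  (forall y, smooth_at (F ^~ y) (lsubmx z)) ->
  smooth_at (fun p => F (lsubmx p) (rsubmx p)) z.
Proof.
move=> Fl Fs; apply: (smooth_at_linfam (near_lsub (P := fun x => linear (F x)) Fl)).
  by move=> u; exact: (smooth_at_lsub (F := F ^~ u) (Fs u)).
by apply: smooth_at_linear; exact: continuous_rsubmx.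
Qed.

End Blocks.

Section Coord.
Variables (R : realType) (n k : nat) (M : manifold R n) (E : vbundle k M).
Variable Delta : sectionA E -> sectionB E -> sectionB E.
Hypothesis HDelta : dorfman_connection Delta.
Variables (b : chart R E (n + k)) (c : chart R M n).
Hypotheses (ab : atlas b) (Hb : vb_over b c).
Variables (chi : M -> R).
Hypotheses (chiC : cutoff (cdom c) chi).
Variable p : E.
Hypotheses (bp : cdom b p) (chi1 : \forall q \near base p, chi q = 1).
Implicit Types (nu : sectionA E) (tau : sectionB E) (z : 'rV[R]_(n + k)).

Let cp : cdom c (base p).
Proof. by rewrite -(vb_domE Hb). Qed.

Let bpE : lsubmx (b p) = c (base p) := b_base Hb bp.

Local Notation Xr := (vect_rep c).
Local Notation er := (fibre_rep b c).
Local Notation tr := (form_rep c).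
Local Notation ar := (dual_rep b).
Local Notation Ga := (Gamma Delta b c chi).
Local Notation La := (Lambda Delta b c chi).
Local Notation V := (hor_vect Delta b c chi).
Local Notation T := (hor_form Delta b c chi).
Local Notation x := (lsubmx (b p)).
Local Notation y := (rsubmx (b p)).

Lemma near_Gamma_lin nu : smoothA nu -> \forall x' \near x, linear (Ga nu x').
Proof.
move=> s; rewrite bpE; have := near_cinv cp (near_cdom cp); have := near_cimg (cfun_img cp).
by apply: filterS2 => x' ix cx; rewrite -(cinvK ix); exact: (Gamma_lin HDelta ab Hb chiC).
Qed.

Lemma near_Lambda_lin nu w : smoothA nu -> \forall x' \near x, linear (fun v => La nu x' v w).
Proof. by move=> s; apply: near_all => x'; exact: (Lambda_lin HDelta ab Hb chiC). Qed.

Let sX nu : smoothA nu -> smooth_at (Xr nu) x.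
Proof. by move=> s; rewrite bpE; exact: (smooth_vect_rep Hb s cp). Qed.

Let sG nu v : smoothA nu -> smooth_at (Ga nu ^~ v) x.
Proof. by move=> s; rewrite bpE; exact: (smooth_Gamma HDelta ab Hb chiC v s cp). Qed.

Let sL nu v w : smoothA nu -> smooth_at (fun x' => La nu x' v w) x.
Proof. by move=> s; rewrite bpE; exact: (smooth_Lambda HDelta ab Hb chiC v w s cp). Qed.

Let sf nu : smoothA nu -> smooth_at (ell_rep b nu) (b p).
Proof. by move=> s; exact: (smooth_ell_rep ab Hb s bp). Qed.

Lemma is_diff_hor_vect nu : smoothA nu -> is_diff (b p) (V nu)
  (fun u => row_mx ('d (Xr nu) x (lsubmx u))
     (- ('d (Ga nu ^~ y) x (lsubmx u) + Ga nu x (rsubmx u)))).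
Proof.
move=> s.
have H1 := is_diff_lsub (smooth_at_diff (sX s)).
have H2 := is_diff_fam (near_Gamma_lin s) (fun v => smooth_at_diff (sG v s)).
exact: (is_diff_row_mx H1 (is_diffN H2)).
Qed.

Lemma smooth_hor_vect nu : smoothA nu -> smooth_at (V nu) (b p).
Proof.
move=> s; apply: smooth_at_row_mx; first exact: (smooth_at_lsub (sX s)).
apply: smooth_atN; apply: (smooth_at_fam (near_Gamma_lin s)) => v; exact: sG.
Qed.

Lemma is_diff_hor_form nu w : smoothA nu -> is_diff (b p) (T nu ^~ w)
  (fun u => 'd (fun z => 'd (ell_rep b nu) z w) (b p) u
    - ('d (fun x' => La nu x' y (lsubmx w)) x (lsubmx u) + La nu x (rsubmx u) (lsubmx w))).
Proof.
move=> s.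
have H1 := smooth_at_diff (smooth_at_diff_app (@finite_coords_row R (n + k)) (sf s)
  (smooth_at_cst w (b p))).
have H2 := is_diff_fam (near_Lambda_lin (lsubmx w) s) (fun v => smooth_at_diff (sL v (lsubmx w) s)).
exact: (is_diffB (differentiableP H1) H2).
Qed.

Lemma smooth_hor_form nu w : smoothA nu -> smooth_at (T nu ^~ w) (b p).
Proof.
move=> s; apply: smooth_atB.
  exact: (smooth_at_diff_app (@finite_coords_row R (n + k)) (sf s) (smooth_at_cst w (b p))).
by apply: (smooth_at_fam (near_Lambda_lin (lsubmx w) s)) => v; exact: sL.
Qed.

Lemma near_chi1 : \forall x' \near p, \forall q \near base x', chi q = 1.
Proof. have h := vb_proj_continuous Hb bp; exact: (h _ (near_join chi1)). Qed.

Lemma near_hor nu : smoothA nu -> \forall z \near b p,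
  V nu z = TE_vect b (hor_lift Delta nu) z /\
  forall w, T nu z w = TE_form b (hor_lift Delta nu) z w.
Proof.
move=> s; apply: filterS (near_E bp near_chi1) => z [iz [bz hz]].
have e1 := TE_vect_hor HDelta ab Hb chiC s bz hz.
have e2 w := TE_form_hor HDelta ab Hb chiC w s bz hz.
rewrite (cinvK iz) in e1; split=> [|w]; first by rewrite e1.
by have := e2 w; rewrite (cinvK iz) => ->.
Qed.

Definition vert_vect tau z : 'rV[R]_(n + k) := row_mx 0 (er tau (lsubmx z)).
Definition vert_form tau z (w : 'rV[R]_(n + k)) : R^o := tr tau (lsubmx z) (lsubmx w).

Lemma near_vlift tau : \forall z \near b p,
  vert_vect tau z = TE_vect b (vlift tau) z /\ forall w, vert_form tau z w = TE_form b (vlift tau) z w.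
Proof.
apply: filterS (near_E bp (near_cdom bp)) => z [iz [bz _]].
have e1 := TE_vect_vlift ab Hb tau bz.
have e2 w := TE_form_vlift ab Hb tau w bz.
rewrite (cinvK iz) in e1; split=> [|w]; first by rewrite e1.
by have := e2 w; rewrite (cinvK iz) => ->.
Qed.

Let sE tau : smoothB tau -> smooth_at (er tau) x.
Proof. by move=> s; rewrite bpE; exact: (smooth_fibre_rep ab Hb s cp). Qed.

Let sT tau w : smoothB tau -> smooth_at (tr tau ^~ w) x.
Proof. by move=> s; rewrite bpE; exact: (smooth_form_rep Hb w s cp). Qed.

Lemma is_diff_vert_vect tau : smoothB tau -> is_diff (b p) (vert_vect tau)
  (fun u => row_mx 0 ('d (er tau) x (lsubmx u))).
Proof.
move=> s; have H := is_diff_lsub (smooth_at_diff (sE s)).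
exact: (is_diff_row_mx (is_diff_cst (0 : 'rV[R]_n) (b p)) H).
Qed.

Lemma smooth_vert_vect tau : smoothB tau -> smooth_at (vert_vect tau) (b p).
Proof.
move=> s; apply: smooth_at_row_mx; first exact: smooth_at_cst.
exact: (smooth_at_lsub (sE s)).
Qed.

Lemma is_diff_vert_form tau w : smoothB tau -> is_diff (b p) (vert_form tau ^~ w)
  (fun u => 'd (tr tau ^~ (lsubmx w)) x (lsubmx u)).
Proof. by move=> s; exact: (is_diff_lsub (smooth_at_diff (sT (lsubmx w) s))). Qed.

Lemma smooth_vert_form tau w : smoothB tau -> smooth_at (vert_form tau ^~ w) (b p).
Proof. by move=> s; exact: (smooth_at_lsub (sT (lsubmx w) s)). Qed.

Lemma diff_hor_vect nu u : smoothA nu -> 'd (V nu) (b p) u =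
  row_mx ('d (Xr nu) x (lsubmx u)) (- ('d (Ga nu ^~ y) x (lsubmx u) + Ga nu x (rsubmx u))).
Proof. by move=> s; have [_ e] := is_diff_hor_vect s; exact: (congr1 (@^~ u) e). Qed.

Lemma diff_hor_form nu w u : smoothA nu -> 'd (T nu ^~ w) (b p) u =
  'd (fun z => 'd (ell_rep b nu) z w) (b p) u
    - ('d (fun x' => La nu x' y (lsubmx w)) x (lsubmx u) + La nu x (rsubmx u) (lsubmx w)).
Proof. by move=> s; have [_ e] := is_diff_hor_form w s; exact: (congr1 (@^~ u) e). Qed.

Lemma diff_vert_vect tau u : smoothB tau ->
  'd (vert_vect tau) (b p) u = row_mx 0 ('d (er tau) x (lsubmx u)).
Proof. by move=> s; have [_ e] := is_diff_vert_vect s; exact: (congr1 (@^~ u) e). Qed.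

Lemma diff_vert_form tau w u : smoothB tau ->
  'd (vert_form tau ^~ w) (b p) u = 'd (tr tau ^~ (lsubmx w)) x (lsubmx u).
Proof. by move=> s; have [_ e] := is_diff_vert_form w s; exact: (congr1 (@^~ u) e). Qed.

Lemma form_rep0 tau x' : tr tau x' 0 = 0.
Proof. by have := form_rep_lin c tau x' (-1) 0 0; rewrite scaler0 addr0 scaleN1r addNr. Qed.

Lemma Lambda0 nu x' v : La nu x' v 0 = 0.
Proof. exact: form_rep0. Qed.

Lemma diff_form_rep0 tau x' u : 'd (tr tau ^~ 0) x' u = 0.
Proof.
have e : tr tau ^~ 0 = cst 0 by apply/funext => z; exact: form_rep0.
by rewrite e; exact: (congr1 (@^~ u) (diff_cst (0 : R^o) x')).
Qed.

Lemma diff_Lambda0 nu v x' u : 'd (fun x => La nu x v 0) x' u = 0.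
Proof. exact: diff_form_rep0. Qed.

End Coord.

(** * The three brackets *)

(** The shape of the form component of the bracket: its four terms are computed separately. *)
Lemma congr_courant_snd (V : zmodType) (a a' b b' c c' d d' : V) : a = a' -> b = b' -> c = c' ->
  d = d' -> a + b - (c - d) = a' + b' - (c' - d').
Proof. by move=> -> -> -> ->. Qed.

Lemma vlift_vlift_fst_alg (R : realType) n k (f g : {linear 'rV[R]_n -> 'rV[R]_k}) :
  row_mx (0 : 'rV[R]_n) (f 0) - row_mx 0 (g 0) = 0.
Proof. by rewrite !linear0 subrr. Qed.

Lemma lin_add (R : realType) (U W : lmodType R) (f : U -> W) u v : linear f -> f (u + v) = f u + f v.
Proof. by move=> fl; have := fl 1 u v; rewrite !scale1r. Qed.

Lemma lin_opp (R : realType) (U W : lmodType R) (f : U -> W) u : linear f -> f (- u) = - f u.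
Proof.
move=> fl; apply/eqP; rewrite -subr_eq0 opprK; apply/eqP.
have f0 : f 0 = 0.
  by have := lin_add 0 0 fl; rewrite addr0 => /(canLR (addrK _)) <-; rewrite subrr.
by rewrite -(lin_add _ _ fl) addNr.
Qed.

Section Final.
Variables (R : realType) (n k : nat) (M : manifold R n) (E : vbundle k M).
Variable Delta : sectionA E -> sectionB E -> sectionB E.
Hypothesis HDelta : dorfman_connection Delta.
Implicit Types (nu : sectionA E) (tau : sectionB E).

Section InChart.
Variable p : E.
Variable b : chart R E (n + k).
Hypothesis eb : b = chart_at p.
Variable c : chart R M n.
Hypothesis Hb : vb_over b c.
Variables (chi : M -> R).
Hypotheses (chiC : cutoff (cdom c) chi).
Hypothesis chi1 : \forall q \near base p, chi q = 1.

Let ab : atlas b.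
Proof. by rewrite eb; exact: chart_at_atlas. Qed.
Let bp : cdom b p.
Proof. by rewrite eb; exact: chart_at_dom. Qed.
Let sc : smooth_chart c := vb_smooth Hb.
Let cp : cdom c (base p).
Proof. by rewrite -(vb_domE Hb). Qed.
Let bpE : lsubmx (b p) = c (base p) := b_base Hb bp.

Local Notation Xr := (vect_rep c).
Local Notation er := (fibre_rep b c).
Local Notation tr := (form_rep c).
Local Notation ar := (dual_rep b).
Local Notation Ga := (Gamma Delta b c chi).
Local Notation La := (Lambda Delta b c chi).
Local Notation V := (hor_vect Delta b c chi).
Local Notation T := (hor_form Delta b c chi).
Local Notation x := (lsubmx (b p)).
Local Notation y := (rsubmx (b p)).

Lemma sectionTE_eq (s t : (tangent p * cotangent p)%type) :
  s.1 = t.1 -> (forall w, s.2 w = t.2 w) -> s = t.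
Proof. by move=> h1 h2; apply: pair_ext => //; apply/lfunP. Qed.

Lemma TE_vect_p (s : sectionTE E) : TE_vect b s (b p) = (s p).1.
Proof. by rewrite (TE_vect_at s bp) eb; exact: tcoord_chart_at. Qed.

Lemma TE_form_p (s : sectionTE E) w : TE_form b s (b p) w = (s p).2 w.
Proof. by rewrite (TE_form_at s w bp) eb tvec_chart_at. Qed.

Let near1 (P Q : 'rV[R]_(n + k) -> Prop) : (\forall z \near b p, P z /\ Q z) -> \forall z \near b p, P z.
Proof. by apply: filterS => z []. Qed.
Let near2 (P Q : 'rV[R]_(n + k) -> Prop) : (\forall z \near b p, P z /\ Q z) -> \forall z \near b p, Q z.
Proof. by apply: filterS => z []. Qed.

Lemma lsubmx_vert_vect tau z : lsubmx (vert_vect b c tau z) = 0.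
Proof. by rewrite /vert_vect row_mxKl. Qed.

(** The vector fields are vertical, the forms vanish on vertical vectors, and all coefficients
    depend on the base point alone. *)
Lemma courant_vlift_vlift tau1 tau2 : smoothB tau1 -> smoothB tau2 ->
  courant_bracket (vlift tau1) (vlift tau2) p = 0.
Proof.
move=> s1 s2.
have N1 := near_vlift ab Hb bp tau1; have N2 := near_vlift ab Hb bp tau2.
have sV1 := smooth_vert_vect ab Hb bp s1; have sV2 := smooth_vert_vect ab Hb bp s2.
have sT1 w := smooth_vert_form Hb bp w s1; have sT2 w := smooth_vert_form Hb bp w s2.
apply: sectionTE_eq => [|w].
  apply: etrans (courant_fst eb sV1 sV2 (near1 N1) (near1 N2)) _.
  apply: etrans (congr2 (fun u v => u - v) (diff_vert_vect ab Hb bp (vert_vect b c tau1 (b p)) s2)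
    (diff_vert_vect ab Hb bp (vert_vect b c tau2 (b p)) s1)) _.
  rewrite !lsubmx_vert_vect; exact: vlift_vlift_fst_alg.
apply: etrans (courant_snd eb w sV1 sT1 sT2 (near1 N1) (near2 N1) (near1 N2) (near2 N2)) _.
apply: etrans (congr_courant_snd (diff_vert_form Hb bp w (vert_vect b c tau1 (b p)) s2)
  (congr1 (vert_form c tau2 (b p)) (diff_vert_vect ab Hb bp w s1))
  (diff_vert_form Hb bp w (vert_vect b c tau2 (b p)) s1)
  (diff_vert_form Hb bp (vert_vect b c tau2 (b p)) w s1)) _.
rewrite zero_lfunE !lsubmx_vert_vect.
apply: etrans (congr_courant_snd (linear0 _) (etrans (congr1 (tr tau2 x) (row_mxKl _ _)) (form_rep0 _ _ _))
  (linear0 _) (diff_form_rep0 _ _ _ _)) _.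
by rewrite !subr0 addr0.
Qed.

Lemma smoothB_Delta nu tau : smoothA nu -> smoothB tau -> smoothB (Delta nu tau).
Proof. by move=> s t; exact: (dorfman_smooth HDelta). Qed.

Lemma local_at nu tau : smoothA nu -> smoothB tau ->
  er (Delta nu tau) x = 'd (er tau) x (Xr nu x) + Ga nu x (er tau x) /\
  forall w, tr (Delta nu tau) x w =
    La nu x (er tau x) w + 'd (tr tau ^~ w) x (Xr nu x) + tr tau x ('d (Xr nu) x w).
Proof. by move=> s t; rewrite bpE; exact: (local_formula HDelta ab Hb chiC s t cp chi1). Qed.

Lemma hor_vlift_fst_alg (X : 'rV[R]_n) (d : {linear 'rV[R]_n -> 'rV[R]_k})
  (dX : {linear 'rV[R]_n -> 'rV[R]_n}) (dG : {linear 'rV[R]_n -> 'rV[R]_k}) (G e' : 'rV[R]_k) :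
  e' = d X + G ->
  row_mx (0 : 'rV[R]_n) (d X) - row_mx (dX 0) (- (dG 0 + G)) = row_mx 0 e'.
Proof.
move=> ->; rewrite !linear0 opp_row_mx add_row_mx oppr0 addr0 opprK.
by rewrite add0r.
Qed.

(** The second derivatives of l_eps cancel, d l_eps being closed; [local_formula] identifies
    what is left. *)
Lemma courant_hor_vlift nu tau : smoothA nu -> smoothB tau ->
  courant_bracket (hor_lift Delta nu) (vlift tau) p = vlift (Delta nu tau) p.
Proof.
move=> s1 s2.
have N1 := near_hor HDelta ab Hb chiC bp chi1 s1; have N2 := near_vlift ab Hb bp tau.
have sV1 := smooth_hor_vect HDelta ab Hb chiC bp s1; have sV2 := smooth_vert_vect ab Hb bp s2.
have sT1 w := smooth_hor_form HDelta ab Hb chiC bp w s1; have sT2 w := smooth_vert_form Hb bp w s2.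
have [F1 F2] := local_at s1 s2.
have lV1 : lsubmx (V nu (b p)) = Xr nu x by exact: row_mxKl.
have lV2 : lsubmx (vert_vect b c tau (b p)) = 0 by exact: row_mxKl.
have rV2 : rsubmx (vert_vect b c tau (b p)) = er tau x by exact: row_mxKr.
apply: sectionTE_eq => [|w].
  apply: etrans (courant_fst eb sV1 sV2 (near1 N1) (near1 N2)) _.
  apply: etrans (congr2 (fun u v => u - v) (diff_vert_vect ab Hb bp (V nu (b p)) s2)
    (diff_hor_vect HDelta ab Hb chiC bp (vert_vect b c tau (b p)) s1)) _.
  rewrite lV1 lV2 rV2 -TE_vect_p (TE_vect_vlift ab Hb (Delta nu tau) bp).
  by apply: hor_vlift_fst_alg; exact: F1.
apply: etrans (courant_snd eb w sV1 sT1 sT2 (near1 N1) (near2 N1) (near1 N2) (near2 N2)) _.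
apply: etrans (congr_courant_snd (diff_vert_form Hb bp w (V nu (b p)) s2)
  (congr1 (vert_form c tau (b p)) (diff_hor_vect HDelta ab Hb chiC bp w s1))
  (diff_hor_form HDelta ab Hb chiC bp w (vert_vect b c tau (b p)) s1)
  (diff_hor_form HDelta ab Hb chiC bp (vert_vect b c tau (b p)) w s1)) _.
rewrite -TE_form_p (TE_form_vlift ab Hb (Delta nu tau) w bp) F2.
rewrite lV1 lV2 rV2.
have sym := diff_diff_sym (vert_vect b c tau (b p)) w (smooth_ell_rep ab Hb s1 bp).
have e1 : vert_form c tau (b p) (row_mx ('d (Xr nu) x (lsubmx w)) (- ('d (Ga nu ^~ y) x (lsubmx w) + Ga nu x (rsubmx w))))
  = tr tau x ('d (Xr nu) x (lsubmx w)) by exact: (congr1 (tr tau x) (row_mxKl _ _)).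
have e2 : 'd (fun x' => La nu x' y (0 : 'rV[R]_n)) x (lsubmx w) = 0 by exact: diff_Lambda0.
have e3 : La nu x (rsubmx w) 0 = 0 by exact: Lambda0.
have e4 : 'd (fun x' => La nu x' y (lsubmx w)) x (0 : 'rV[R]_n) = 0 by exact: linear0.
have H (a1 a2 a3 a3' a4 a5 a6 a7 r : R) : a3 = a3' -> a4 = 0 -> a6 = 0 -> a7 = 0 ->
  r = a5 + a1 + a2 -> a1 + a2 - (a3 - (a4 + a5) - (a3' - (a6 + a7))) = r.
  by move=> -> -> -> -> ->; ring.
apply: etrans (congr2 (fun u v => _ + u - v) e1 (erefl _)) _.
by apply: H sym e4 e2 e3 _.
Qed.

Let sX nu : smoothA nu -> smooth_at (Xr nu) x.
Proof. by move=> s; rewrite bpE; exact: (smooth_vect_rep Hb s cp). Qed.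

Let sG nu v : smoothA nu -> smooth_at (Ga nu ^~ v) x.
Proof. by move=> s; rewrite bpE; exact: (smooth_Gamma HDelta ab Hb chiC v s cp). Qed.

Let sL nu v w : smoothA nu -> smooth_at (fun x' => La nu x' v w) x.
Proof. by move=> s; rewrite bpE; exact: (smooth_Lambda HDelta ab Hb chiC v w s cp). Qed.

Let sf nu : smoothA nu -> smooth_at (ell_rep b nu) (b p).
Proof. by move=> s; exact: (smooth_ell_rep ab Hb s bp). Qed.

Let se (e : forall m, fib E m) : smooth_section e -> smooth_at (section_rep b c e) x.
Proof. by move=> s; rewrite bpE; exact: (smooth_section_at Hb ab s cp). Qed.

Lemma near_Delta_inl nu e : smoothA nu -> smooth_section e ->
  \forall x' \near x,
    'd (section_rep b c e) x' (Xr nu x') + Ga nu x' (section_rep b c e x') = er (Delta nu (inlB e)) x' /\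
    forall w, La nu x' (section_rep b c e x') w = tr (Delta nu (inlB e)) x' w.
Proof.
move=> s ss; rewrite bpE; apply: filterS (near_chart cp (near_join chi1)) => x' [ix [cx hx]].
have bq : cdom b (Vec (e (cinv c x')) : E) by exact: (vb_dom Hb).
have [F1 F2] := @Delta_inl _ _ _ _ _ _ HDelta b c ab Hb chi chiC nu e
  (Vec (e (cinv c x')) : E) s ss erefl bq hx.
rewrite /= (cinvK ix) in F1; split; first by rewrite F1.
by move=> w; have := F2 w; rewrite /= (cinvK ix) => ->.
Qed.

(** [local_formula] twice. The inner instance is needed in a neighbourhood, because the outer
    one differentiates it. *)
Lemma Delta_Delta_fst nu1 nu2 e : smoothA nu1 -> smoothA nu2 -> smooth_section e ->
  section_rep b c e x = y ->
  er (Delta nu1 (Delta nu2 (inlB e))) x =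
  ('d (fun x' => 'd (section_rep b c e) x' (Xr nu2 x)) x (Xr nu1 x)
     + 'd (section_rep b c e) x ('d (Xr nu2) x (Xr nu1 x)))
  + ('d (Ga nu2 ^~ y) x (Xr nu1 x) + Ga nu2 x ('d (section_rep b c e) x (Xr nu1 x)))
  + Ga nu1 x ('d (section_rep b c e) x (Xr nu2 x) + Ga nu2 x y).
Proof.
move=> s1 s2 ss ex.
have [F1 _] := local_at s1 (smoothB_Delta s2 (smoothB_inl ss)).
have N := near_Delta_inl s2 ss.
have N1 : \forall x' \near x, ((fun x' => 'd (section_rep b c e) x' (Xr nu2 x'))
     + (fun x' => Ga nu2 x' (section_rep b c e x'))) x' = er (Delta nu2 (inlB e)) x'.
  by apply: filterS N => x' [].
have H := is_diffD (is_diff_diff_app (se ss) (sX s2))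
  (diff_linfam (near_Gamma_lin HDelta ab Hb chiC bp s2) (fun v => smooth_at_diff (sG v s2))
    (smooth_at_diff (se ss))).
have [_ D] := near_is_diff N1 H.
have N0 := (nbhs_singleton N).1.
rewrite ex in N0 D.
apply: etrans F1 _.
apply: (congr2 (fun u v => u + v)); first exact: (congr1 (@^~ (Xr nu1 x)) D).
exact: (congr1 (Ga nu1 x) (esym N0)).
Qed.

Lemma Delta_Delta_snd nu1 nu2 e w : smoothA nu1 -> smoothA nu2 -> smooth_section e ->
  section_rep b c e x = y ->
  tr (Delta nu1 (Delta nu2 (inlB e))) x w =
  La nu1 x ('d (section_rep b c e) x (Xr nu2 x) + Ga nu2 x y) w
  + ('d (fun x' => La nu2 x' y w) x (Xr nu1 x) + La nu2 x ('d (section_rep b c e) x (Xr nu1 x)) w)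
  + La nu2 x y ('d (Xr nu1) x w).
Proof.
move=> s1 s2 ss ex.
have [_ F2] := local_at s1 (smoothB_Delta s2 (smoothB_inl ss)).
have N := near_Delta_inl s2 ss.
have N1 : \forall x' \near x, La nu2 x' (section_rep b c e x') w = tr (Delta nu2 (inlB e)) x' w.
  by apply: filterS N => x' [].
have H := diff_linfam (F := fun x' v => La nu2 x' v w) (near_Lambda_lin HDelta ab Hb chiC p w s2)
  (fun v => smooth_at_diff (sL v w s2)) (smooth_at_diff (se ss)).
have [_ D] := near_is_diff N1 H.
have N0 := (nbhs_singleton N).1.
have N2 := (nbhs_singleton N).2.
rewrite ex in N0 D N2.
apply: etrans (F2 w) _.
apply: (congr2 (fun u v => u + v)); last exact: (esym (N2 _)).
apply: (congr2 (fun u v => u + v)); last exact: (congr1 (@^~ (Xr nu1 x)) D).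
exact: (congr1 (fun v => La nu1 x v w) (esym N0)).
Qed.

Lemma diff_ell_rep nu q u : smoothA nu -> cdom b q ->
  'd (ell_rep b nu) (b q) u =
  'd (ar nu ^~ (rsubmx (b q))) (lsubmx (b q)) (lsubmx u) + ar nu (lsubmx (b q)) (rsubmx u).
Proof.
move=> s bq; have cq : cdom c (base q) by rewrite -(vb_domE Hb).
have bqE := b_base Hb bq.
have F1 : \forall x' \near lsubmx (b q), linear (ar nu x').
  by rewrite bqE; exact: near_dual_rep_lin.
have F2 v : differentiable (ar nu ^~ v) (lsubmx (b q)).
  by rewrite bqE; exact: (smooth_at_diff (smooth_dual_rep ab Hb v s cq)).
have [_ D] := is_diff_fam F1 F2.
exact: (congr1 (@^~ u) D).
Qed.

(** The dual bracket paired with a constant section, where - <eps2, Gamma1 z2> is the fibre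
    part of the derivative of l_eps2 along the horizontal vector field of [nu1]. This form
    of the function is the one that can be differentiated once more. *)
Lemma near_ell_bracket nu1 nu2 : smoothA nu1 -> smoothA nu2 -> \forall z \near b p,
  'd (ell_rep b nu2) z (V nu1 z) - La nu1 (lsubmx z) (rsubmx z) (Xr nu2 (lsubmx z))
  = ell_rep b (dual_bracket Delta nu1 nu2) z.
Proof.
move=> s1 s2.
have N1 := near_bracket HDelta ab Hb chiC s1 s2 cp chi1; rewrite -bpE in N1.
have N2 := near_lsub (P := fun x' => _ /\ _) N1.
have N3 : \forall z \near b p, linear (ar nu2 (lsubmx z)).
  have N := near_dual_rep_lin Hb nu2 cp; rewrite -bpE in N.
  exact: (near_lsub (P := fun x' => linear (ar nu2 x')) N).
have N4 := near_E bp (near_cdom bp).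
move: N2 N3 N4; apply: filterS3 => z [_ e2] fl [iz [bz _]].
rewrite [RHS]/ell_rep -e2 /bracket_dual.
have D := diff_ell_rep (V nu1 (b (cinv b z))) s2 bz; rewrite (cinvK iz) in D.
have l1 : lsubmx (V nu1 z) = Xr nu1 (lsubmx z) by exact: row_mxKl.
have r1 : rsubmx (V nu1 z) = - Ga nu1 (lsubmx z) (rsubmx z) by exact: row_mxKr.
apply: (congr2 (fun u v => u - v)); last by [].
apply: etrans D _; rewrite l1 r1 (lin_opp _ fl).
by [].
Qed.

Lemma diff_ell_bracket nu1 nu2 w : smoothA nu1 -> smoothA nu2 ->
  'd (ell_rep b (dual_bracket Delta nu1 nu2)) (b p) w =
  'd (fun z => 'd (ell_rep b nu2) z (V nu1 (b p))) (b p) w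
  + 'd (ell_rep b nu2) (b p) ('d (V nu1) (b p) w)
  - (('d (fun x' => La nu1 x' y (Xr nu2 x)) x (lsubmx w) + La nu1 x (rsubmx w) (Xr nu2 x))
     + La nu1 x y ('d (Xr nu2) x (lsubmx w))).
Proof.
move=> s1 s2.
have N := near_ell_bracket s1 s2.
have H1 := is_diff_diff_app (sf s2) (smooth_hor_vect HDelta ab Hb chiC bp s1).
have Hv v := is_diff_fam (near_Lambda_lin HDelta ab Hb chiC p v s1)
  (fun v' => smooth_at_diff (sL v' v s1)).
have Fl : \forall z \near b p, linear (fun v => La nu1 (lsubmx z) (rsubmx z) v).
  by apply: near_all => z; exact: Lambda_linr.
have [dX EX] := is_diff_lsub (smooth_at_diff (sX s2)).
have H2 := diff_linfam Fl (fun v => let: DiffDef d _ := Hv v in d) dX.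
have [_ D] := near_is_diff N (is_diffB H1 H2).
apply: etrans (congr1 (@^~ w) D) _.
apply: (congr2 (fun u v => u - v)); first by [].
apply: (congr2 (fun u v => u + v)).
  have [_ Ev] := Hv (Xr nu2 x); exact: (congr1 (@^~ w) Ev).
exact: (congr1 (fun f => La nu1 x y (f w)) EX).
Qed.

(** Here [a1] and [a2] are the derivatives of X2 along X1 and of X1 along X2, [g2] and [g1] those
    of Gamma2 v along X1 and of Gamma1 v along X2; [d], [S] and [S'] are the first and second
    derivatives of the section e, and [Gb] belongs to the dual bracket. *)
Lemma hor_hor_fst_alg (G1 G2 : 'rV[R]_k -> 'rV[R]_k) (d : 'rV[R]_n -> 'rV[R]_k)
  (a1 a2 X1 X2 : 'rV[R]_n) (g1 g2 v S S' Gb : 'rV[R]_k) :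
  linear G1 -> linear G2 -> linear d -> S = S' ->
  row_mx a1 (- (g2 + G2 (- G1 v))) - row_mx a2 (- (g1 + G1 (- G2 v))) =
  row_mx (a1 - a2) (- Gb) - row_mx 0 (
     (S + d a1 + (g2 + G2 (d X1)) + G1 (d X2 + G2 v))
     - (S' + d a2 + (g1 + G1 (d X2)) + G2 (d X1 + G1 v))
     - (d (a1 - a2) + Gb)).
Proof.
move=> l1 l2 ld ->; rewrite !(lin_opp _ l1) !(lin_opp _ l2) !(lin_add _ _ l1) !(lin_add _ _ l2).
rewrite !(lin_add _ _ ld) (lin_opp _ ld) !opp_row_mx !add_row_mx subr0; congr row_mx.
apply/rowP => i; rewrite !mxE; ring.
Qed.

(** [H1], [H1'], [H2] and [H2'] are second derivatives of l_eps1 and l_eps2, and [e2] is the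
    differential of l_eps2. The names in L1 and L2 are values of Lambda1 and Lambda2, those in
    dL1 and dL2 their derivatives, and [Lb] belongs to the dual bracket. *)
Lemma hor_hor_snd_alg (H2 H2' H1 H1' L2G1 dL2 e2 L2dX1 dL1 L1G2 dL1X L1w L1dX2 L1d L2d Lb : R) :
  H2 = H2' -> H1 = H1' ->
  H2 - (dL2 - L2G1) + (e2 - L2dX1) - (H1 - (dL1 - L1G2) - (H1' - (dL1X + L1w))) =
  (H2' + e2 - ((dL1X + L1w) + L1dX2)) - Lb -
  ((L1d + L1G2 + (dL2 + L2d) + L2dX1) - (L2d + L2G1 + (dL1 + L1d) + L1dX2) - Lb).
Proof. by move=> -> ->; ring. Qed.

Lemma section_rep_at (e : forall m, fib E m) : e (base p) = vec p -> section_rep b c e x = y.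
Proof.
by move=> ex; rewrite bpE /section_rep (cfunK cp) ex /fibre_coord; case: (p).
Qed.

(** The section [e] that computes the curvature also computes the lift of the dual bracket, and
    the terms with [Delta] along the dual bracket cancel. The commutator of Delta_nu1 and
    Delta_nu2 on (e, 0) then agrees with the bracket of the lifts up to second derivatives of e,
    l_eps1 and l_eps2, which are symmetric. *)
Lemma courant_hor_hor nu1 nu2 : smoothA nu1 -> smoothA nu2 ->
  courant_bracket (hor_lift Delta nu1) (hor_lift Delta nu2) p
  = hor_lift Delta (dual_bracket Delta nu1 nu2) p
    - core_section (curvature_hom Delta nu1 nu2) p.
Proof.
move=> s1 s2.
have s12 := smooth_bracket HDelta s1 s2.
(* The section chosen in the definition of the curvature term. *)
have [e [ss ex ->]] : exists e, [/\ smooth_section e, e (base p) = vec p &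
    core_section (curvature_hom Delta nu1 nu2) p =
    vlift_at (curvature Delta nu1 nu2 (inlB e) (base p))].
  rewrite /core_section /curvature_hom; case: xgetP => [r _ [e [ss ex ->]]|no].
    by exists e.
  have [e ss ex] := section_through ab Hb chiC bp chi1.
  by case: (no (curvature Delta nu1 nu2 (inlB e) (base p))); exists e.
have exy := section_rep_at ex.
have N1 := near_hor HDelta ab Hb chiC bp chi1 s1.
have N2 := near_hor HDelta ab Hb chiC bp chi1 s2.
have sV1 := smooth_hor_vect HDelta ab Hb chiC bp s1; have sV2 := smooth_hor_vect HDelta ab Hb chiC bp s2.
have sT1 w := smooth_hor_form HDelta ab Hb chiC bp w s1.
have sT2 w := smooth_hor_form HDelta ab Hb chiC bp w s2.
have [e0 t0] := nbhs_singleton (near_hor HDelta ab Hb chiC bp chi1 s12).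
have [F1 F2] := nbhs_singleton (near_Delta_inl s12 ss).
have l1 : lsubmx (V nu1 (b p)) = Xr nu1 x by exact: row_mxKl.
have r1 : rsubmx (V nu1 (b p)) = - Ga nu1 x y by exact: row_mxKr.
have l2 : lsubmx (V nu2 (b p)) = Xr nu2 x by exact: row_mxKl.
have r2 : rsubmx (V nu2 (b p)) = - Ga nu2 x y by exact: row_mxKr.
have XB : Xr (dual_bracket Delta nu1 nu2) x = 'd (Xr nu2) x (Xr nu1 x) - 'd (Xr nu1) x (Xr nu2 x).
  by rewrite bpE; exact: (vect_rep_bracket HDelta ab Hb chiC s1 s2 cp chi1).
set r := curvature _ _ _ _ _.
have erE tau : er tau x = fibre_coord b (tau (base p)).1 by rewrite bpE /fibre_rep /section_rep (cfunK cp).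
have trE tau w : tr tau x w = (tau (base p)).2 (tvec c (base p) w).
  by rewrite bpE /form_rep (fcoord_at _ _ cp).
have G1l : linear (Ga nu1 x) by rewrite bpE; exact: (Gamma_lin HDelta ab Hb chiC s1 cp).
have G2l : linear (Ga nu2 x) by rewrite bpE; exact: (Gamma_lin HDelta ab Hb chiC s2 cp).
apply: sectionTE_eq => [|w].
- apply: etrans (courant_fst eb sV1 sV2 (near1 N1) (near1 N2)) _.
  apply: etrans (congr2 (fun u v => u - v) (diff_hor_vect HDelta ab Hb chiC bp (V nu1 (b p)) s2)
    (diff_hor_vect HDelta ab Hb chiC bp (V nu2 (b p)) s1)) _.
  rewrite l1 r1 l2 r2.
  have R1 : fibre_coord b r.1 = er (Delta nu1 (Delta nu2 (inlB e))) x
     - er (Delta nu2 (Delta nu1 (inlB e))) x - er (Delta (dual_bracket Delta nu1 nu2) (inlB e)) x.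
    rewrite !erE -[r.1]/((Delta nu1 (Delta nu2 (inlB e)) (base p)).1
      - (Delta nu2 (Delta nu1 (inlB e)) (base p)).1
      - (Delta (dual_bracket Delta nu1 nu2) (inlB e) (base p)).1).
    have fl := fibre_coord_linear Hb cp.
    by rewrite !(lin_add _ _ fl) !(lin_opp _ fl).
  have R2 : (hor_lift Delta (dual_bracket Delta nu1 nu2) p - vlift_at r).1
     = V (dual_bracket Delta nu1 nu2) (b p) - row_mx 0 (fibre_coord b r.1).
    apply: (congr2 (fun u v : 'rV[R]_(n + k) => u - v)).
      by rewrite e0 TE_vect_p.
    by rewrite -(tcoord_vlift ab Hb r bp) eb; exact: (esym (tcoord_chart_at _)).
  apply: etrans (esym R2).
  rewrite R1 (Delta_Delta_fst s1 s2 ss exy) (Delta_Delta_fst s2 s1 ss exy) -F1 exy XB.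
  have dl : linear ('d (section_rep b c e) x : _ -> _) by move=> a u v; exact: linearP.
  have sym := diff_diff_sym_row (@finite_coords_row R n) (Xr nu1 x) (Xr nu2 x) (se ss).
  have H := hor_hor_fst_alg ('d (Xr nu2) x (Xr nu1 x)) ('d (Xr nu1) x (Xr nu2 x)) (Xr nu1 x) (Xr nu2 x)
    ('d (Ga nu1 ^~ y) x (Xr nu2 x)) ('d (Ga nu2 ^~ y) x (Xr nu1 x)) y
    (Ga (dual_bracket Delta nu1 nu2) x y) G1l G2l dl sym.
  apply: etrans H _.
  apply: (congr2 (fun u v => u - v)); last by [].
  by rewrite -XB.
- apply: etrans (courant_snd eb w sV1 sT1 sT2 (near1 N1) (near2 N1) (near1 N2) (near2 N2)) _.
  have R3 : r.2 (tvec c (base p) (lsubmx w)) = tr (Delta nu1 (Delta nu2 (inlB e))) x (lsubmx w)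
     - tr (Delta nu2 (Delta nu1 (inlB e))) x (lsubmx w)
     - tr (Delta (dual_bracket Delta nu1 nu2) (inlB e)) x (lsubmx w).
    rewrite !trE -[r.2]/((Delta nu1 (Delta nu2 (inlB e)) (base p)).2
      - (Delta nu2 (Delta nu1 (inlB e)) (base p)).2
      - (Delta (dual_bracket Delta nu1 nu2) (inlB e) (base p)).2).
    by rewrite add_lfunE add_lfunE !opp_lfunE.
  have R4 : (hor_lift Delta (dual_bracket Delta nu1 nu2) p - vlift_at r).2 w
     = T (dual_bracket Delta nu1 nu2) (b p) w - r.2 (tvec c (base p) (lsubmx w)).
    rewrite -[LHS]/(((hor_lift Delta (dual_bracket Delta nu1 nu2) p).2 - (vlift_at r).2) w).
    have tw : tcoord b w = w by rewrite eb; exact: tcoord_chart_at.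
    rewrite add_lfunE opp_lfunE; apply: (congr2 (fun u v : R => u - v)).
      exact: etrans (esym (TE_form_p _ w)) (esym (t0 w)).
    apply: etrans (vlift_sndE ab Hb r w bp) _.
    exact: (congr1 (fun z => r.2 (tvec c (base p) (lsubmx z))) tw).
  apply: etrans (esym R4).
  have LD := diff_hor_vect HDelta ab Hb chiC bp w s1.
  have TV : T nu2 (b p) ('d (V nu1) (b p) w) =
      'd (ell_rep b nu2) (b p) ('d (V nu1) (b p) w) - La nu2 x y ('d (Xr nu1) x (lsubmx w)).
    rewrite /hor_form; apply: (congr2 (fun u v => u - v)); first by [].
    apply: (congr1 (La nu2 x y)); apply: etrans (congr1 lsubmx LD) _.
    exact: row_mxKl.
  apply: etrans (congr_courant_snd (diff_hor_form HDelta ab Hb chiC bp w (V nu1 (b p)) s2) TV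
    (diff_hor_form HDelta ab Hb chiC bp w (V nu2 (b p)) s1)
    (diff_hor_form HDelta ab Hb chiC bp (V nu2 (b p)) w s1)) _.
  rewrite l1 r1 l2 r2 R3 (Delta_Delta_snd (lsubmx w) s1 s2 ss exy) (Delta_Delta_snd (lsubmx w) s2 s1 ss exy).
  rewrite -F2 exy.
  have TB := congr1 (fun u => u - La (dual_bracket Delta nu1 nu2) x y (lsubmx w))
    (diff_ell_bracket w s1 s2).
  apply: etrans (congr1 (fun u => u - _) (esym TB)).
  have L1l w' : linear (fun v => La nu1 x v w') by exact: (Lambda_lin HDelta ab Hb chiC).
  have L2l w' : linear (fun v => La nu2 x v w') by exact: (Lambda_lin HDelta ab Hb chiC).
  rewrite (lin_add _ _ (L1l (lsubmx w))) (lin_add _ _ (L2l (lsubmx w))).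
  rewrite (lin_opp _ (L1l (lsubmx w))) (lin_opp _ (L2l (lsubmx w))).
  apply: hor_hor_snd_alg.
    exact: (diff_diff_sym _ _ (sf s2)).
  exact: (diff_diff_sym _ _ (sf s1)).
Qed.

End InChart.

End Final.

Theorem theorem4p9 (R : realType) (n k : nat) (M : manifold R n)
    (E : vbundle k M)
    (Delta : sectionA E -> sectionB E -> sectionB E)
    (HDelta : dorfman_connection Delta)
    (nu nu1 nu2 : sectionA E)
    (Hnu : smoothA nu) (Hnu1 : smoothA nu1) (Hnu2 : smoothA nu2)
    (tau tau1 tau2 : sectionB E)
    (Htau : smoothB tau) (Htau1 : smoothB tau1) (Htau2 : smoothB tau2) :
  [/\ forall x : E, courant_bracket (vlift tau1) (vlift tau2) x = 0,
      forall x : E,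
        courant_bracket (hor_lift Delta nu) (vlift tau) x
        = vlift (Delta nu tau) x &
      forall x : E,
        courant_bracket (hor_lift Delta nu1) (hor_lift Delta nu2) x
        = hor_lift Delta (dual_bracket Delta nu1 nu2) x
          - core_section (curvature_hom Delta nu1 nu2) x].
Proof.
have local_data (x : E) : exists c chi, [/\ vb_over (chart_at x) c,
    cutoff (cdom c) chi & \forall q \near base x, chi q = 1].
  have [c Hb] := atlas_vb_over (chart_at_atlas x).
  have cx : cdom c (base x) by rewrite -(vb_domE Hb); exact: chart_at_dom.
  have [chi chiU chi1] := bump_manifold (vb_smooth Hb) cx (near_cdom cx).
  by rewrite setIid in chiU; exists c, chi.
split=> x; have [c [chi [Hb chiC chi1]]] := local_data x.
- exact: (courant_vlift_vlift erefl Hb Htau1 Htau2).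
- exact: (courant_hor_vlift HDelta erefl Hb chiC chi1 Hnu Htau).
- exact: (courant_hor_hor HDelta erefl Hb chiC chi1 Hnu1 Hnu2).
Qed.
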